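(* Let $k$ be an algebraically closed field of characteristic $5$, let $\Gamma\subset\mathbb{P}^2$ be a $k$-Hermitian curve, and let $\mathcal{D}$ be the set of connected components of the graph $G$ on the set $\mathcal{Q}$ of non-singular conics totally tangent to $\Gamma$. Let $\mathcal{C}_1,\mathcal{C}_2,\mathcal{C}_3$ be the vertex sets of the three connected components of the graph $H$ on $\mathcal{D}$, and suppose $\{i,j,k\}=\{1,2,3\}$. Then the map $$g_k:\ D\in\mathcal{C}_i\cup\mathcal{C}_j\ \mapsto\ \{\,D'\in\mathcal{C}_k \mid T(D,D')=\beta^{21}\,\}$$ induces a bijection from $\mathcal{C}_i\cup\mathcal{C}_j$ to the set of $15$-cocliques in the Hoffman-Singleton graph $H|\mathcal{C}_k$. For distinct $D,D'\in\mathcal{C}_i\cup\mathcal{C}_j$, we have $$|g_k(D)\cap g_k(D')|=\begin{cases}0 & \text{if } T(D,D')=\alpha^{15}\gamma^{6},\\ 3 & \text{if } T(D,D')=\alpha^{3}\gamma^{18},\\ 5 & \text{if } T(D,D')=\gamma^{21},\\ 8 & \text{if } T(D,D')=\beta^{21}.\end{cases}$$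
   Context: Work over an algebraically closed field $k$ of characteristic $5$ (the letter $k$ is also used as an index in $\{1,2,3\}$). A $k$-Hermitian curve is a projective plane curve $\Gamma\subset\mathbb{P}^2$ of degree $6$ that is projectively isomorphic (via $\mathrm{PGL}_3(k)$) to the Fermat curve $\Gamma_5: x^6+y^6+z^6=0$. $\mathcal{P}$ denotes the set of Weierstrass points of $\Gamma$; equivalently, the set of points $P\in\Gamma$ whose tangent line meets $\Gamma$ at $P$ with intersection multiplicity $6$ (for $\Gamma=\Gamma_5$, the $\mathbb{F}_{25}$-rational points). One has $|\mathcal{P}|=126$. A line of $\mathbb{P}^2$ is a special secant line of $\Gamma$ if it passes through two distinct points of $\mathcal{P}$. A non-singular conic $Q\subset\mathbb{P}^2$ is totally tangent to $\Gamma$ if $Q$ meets $\Gamma$ at six distinct points, each with intersection multiplicity $2$. $\mathcal{Q}$ denotes the set of all such conics; one has $|\mathcal{Q}|=3150$ and $Q\cap\Gamma\subset\mathcal{P}$ for $Q\in\mathcal{Q}$. For $Q\in\mathcal{Q}$, $\mathcal{S}(Q)$ is the set of the $15$ special secant lines of $\Gamma$ passing through two distinct points of $Q\cap\Gamma$. $G$ is the graph with vertex set $\mathcal{Q}$ in which distinct $Q,Q'$ are adjacent if and only if $|Q\cap Q'|=4$ and $|\mathcal{S}(Q)\cap\mathcal{S}(Q')|=3$. $\mathcal{D}$ is the set of connected components of $G$ (there are $150$ of them); each $D\in\mathcal{D}$ is regarded as a subset of $\mathcal{Q}$, consisting of $21$ conics. For $Q\in\mathcal{Q}$ and $D'\in\mathcal{D}$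 with $Q\notin D'$, the type $t(Q,D')\in\{\alpha,\beta,\gamma\}$ is defined by the values of $|Q\cap Q'\cap\Gamma|$ as $Q'$ runs over the $21$ conics of $D'$: $t(Q,D')=\alpha$ if the value is $2$ for $3$ conics and $0$ for $18$; $t(Q,D')=\beta$ if it is $2$ for $1$ conic, $1$ for $4$ conics and $0$ for $16$; $t(Q,D')=\gamma$ if it is $1$ for $6$ conics and $0$ for $15$. (One of these three cases always occurs.) For distinct $D,D'\in\mathcal{D}$, the type $T(D,D')$ is: $\beta^{21}$ if $t(Q,D')=\beta$ for all $Q\in D$; $\gamma^{21}$ if $t(Q,D')=\gamma$ for all $Q\in D$; $\alpha^{15}\gamma^{6}$ if $t(Q,D')=\alpha$ for $15$ conics $Q\in D$ and $\gamma$ for the other $6$; $\alpha^{3}\gamma^{18}$ if $t(Q,D')=\alpha$ for $3$ conics $Q\in D$ and $\gamma$ for the other $18$. (One of these four cases always occurs, and $T(D,D')=T(D',D)$.) $H$ is the graph with vertex set $\mathcal{D}$ in which distinct $D,D'$ are adjacent if and only if $T(D,D')=\alpha^{15}\gamma^{6}$. It has exactly three connected components, with vertex sets $\mathcal{C}_1,\mathcal{C}_2,\mathcal{C}_3$ of size $50$ each; each induced subgraph $H|\mathcal{C}_i$ is the Hoffman-Singleton graph (the unique strongly regular graph of parameters $(50,7,0,1)$). A $15$-coclique is a set of $15$ pairwise non-adjacent vertices. *)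

(* Defs.v *)
From mathcomp Require Import all_boot all_order all_algebra.
From mathcomp Require Import boolp classical_sets functions cardinality.
From mathcomp Require Import mpoly.
From Stdlib Require Import Relation_Operators.

Set Implicit Arguments.
Unset Strict Implicit.
Unset Printing Implicit Defensive.

Import GRing.Theory.

Local Open Scope ring_scope.
Local Open Scope classical_set_scope.
Local Open Scope card_scope.

(* A graph is given by its vertex set [V] and an adjacency relation on [T].
   Walks stay inside [V]; steps may be taken in both directions. *)
Definition connected_in (T : Type) (V : set T) (adj : T -> T -> Prop) :
    T -> T -> Prop :=
  clos_refl_sym_trans T (fun x y => [/\ V x, V y & adj x y]).

Definition components (T : Type) (V : set T) (adj : T -> T -> Prop) :
    set (set T) :=
  [set X | exists2 x, V x & X = [set y | V y /\ connected_in V adj x y]].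

Definition cocliques (T : Type) (m : nat) (V : set T) (adj : T -> T -> Prop) :
    set (set T) :=
  [set A | [/\ A `<=` V, A #= `I_m &
     forall x y, A x -> A y -> x <> y -> ~ adj x y]].

Definition ppoint (k : fieldType) : Type :=
  {U : {vspace 'rV[k]_3} | \dim U == 1%N}.

Definition pline (k : fieldType) : Type :=
  {L : {vspace 'rV[k]_3} | \dim L == 2%N}.

Definition incident (k : fieldType) (P : ppoint k) (L : pline k) : bool :=
  (val P <= val L)%VS.

(* Homogeneous coordinates: those of some nonzero vector of [P].  They are only
   used in conditions that do not depend on the choice of this vector. *)
Definition coords (k : fieldType) (P : ppoint k) : 'I_3 -> k :=
  vpick (val P) 0.

Definition zeros (k : fieldType) (f : {mpoly k[3]}) : set (ppoint k) :=
  [set P | f.@[coords P] = 0].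

(* The local ring of the plane at [P], as the set of degree-0 fractions of
   k(X_0, X_1, X_2) that are defined at [P]. *)
Definition local_ring (k : fieldType) (P : ppoint k) :
    set {fraction {mpoly k[3]}} :=
  [set x | exists d a b, [/\ a \is d.-homog, b \is d.-homog,
     b.@[coords P] != 0 & x = tofrac a / tofrac b]].

(* The ideal of [local_ring P] generated by (dehomogenizations of) the
   homogeneous polynomials [f] and [g]. *)
Definition local_ideal (k : fieldType) (f g : {mpoly k[3]}) (P : ppoint k) :
    set {fraction {mpoly k[3]}} :=
  [set x | exists d a b c, [/\ a * f \is d.-homog, b * g \is d.-homog,
     c \is d.-homog, c.@[coords P] != 0 & x = tofrac (a * f + b * g) / tofrac c]].

(* The quotient of the local ring at [P] by the ideal of [f] and [g] has
   dimension [n] over [k]: the family [e] induces a basis of it. *)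
Definition has_imult (k : fieldType) (f g : {mpoly k[3]}) (P : ppoint k)
    (n : nat) : Prop :=
  exists e : 'I_n -> {fraction {mpoly k[3]}},
    (forall i, local_ring P (e i)) /\
    (forall x, local_ring P x -> exists! c : 'rV[k]_n,
       local_ideal f g P (x - \sum_(i < n) tofrac (c 0 i)%:MP * e i)).

Definition fermat_sextic (k : fieldType) : {mpoly k[3]} :=
  \sum_(i < 3) 'X_i ^+ 6.

Definition linear_subst (k : fieldType) (A : 'M[k]_3) (f : {mpoly k[3]}) :
    {mpoly k[3]} :=
  f \mPo [tuple \sum_(j < 3) A i j *: 'X_j | i < 3].

(* [F] is the equation of the curve, unique up to a nonzero scalar; the set of
   points of the curve is [zeros F]. *)
Definition hermitian_curve (k : fieldType) (F : {mpoly k[3]}) : Prop :=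
  exists A : 'M[k]_3, exists c : k,
    [/\ A \in unitmx, c != 0 & F = c *: linear_subst A (fermat_sextic k)].

(* Equation of the tangent line of [zeros F] at [P]. *)
Definition tangent_form (k : fieldType) (F : {mpoly k[3]}) (P : ppoint k) :
    {mpoly k[3]} :=
  \sum_(i < 3) (F^`M(i)).@[coords P] *: 'X_i.

Definition weierstrass (k : fieldType) (F : {mpoly k[3]}) : set (ppoint k) :=
  [set P | zeros F P /\ has_imult F (tangent_form F P) P 6].

Definition special_secant (k : fieldType) (F : {mpoly k[3]}) : set (pline k) :=
  [set L | exists P P' : ppoint k, [/\ weierstrass F P, weierstrass F P',
     P <> P', incident P L & incident P' L]].

(* A non-singular conic is identified with its set of
   points, which determines its equation up to a nonzero scalar. *)

Definition conic (k : fieldType) : Type := set (ppoint k).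

Definition nonsingular_conic_eq (k : fieldType) (q : {mpoly k[3]}) : Prop :=
  [/\ q != 0, q \is 2.-homog &
      forall P : ppoint k, zeros q P -> exists i, (q^`M(i)).@[coords P] != 0].

Definition tangent_conics (k : fieldType) (F : {mpoly k[3]}) : set (conic k) :=
  [set Q | exists q, [/\ nonsingular_conic_eq q, Q = zeros q,
     Q `&` zeros F #= `I_6 &
     forall P, (Q `&` zeros F) P -> has_imult q F P 2]].

Definition secants_of (k : fieldType) (F : {mpoly k[3]}) (Q : conic k) :
    set (pline k) :=
  [set L | special_secant F L /\
     exists P P' : ppoint k, [/\ (Q `&` zeros F) P, (Q `&` zeros F) P',
       P <> P', incident P L & incident P' L]].

Definition adjG (k : fieldType) (F : {mpoly k[3]}) (Q Q' : conic k) : Prop :=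
  [/\ Q <> Q', Q `&` Q' #= `I_4 & secants_of F Q `&` secants_of F Q' #= `I_3].

Definition comps_G (k : fieldType) (F : {mpoly k[3]}) : set (set (conic k)) :=
  components (tangent_conics F) (adjG F).

Inductive ttype := t_alpha | t_beta | t_gamma.

Inductive Ttype := T_beta21 | T_gamma21 | T_alpha15_gamma6 | T_alpha3_gamma18.

Definition meeting (k : fieldType) (F : {mpoly k[3]}) (Q : conic k)
    (D' : set (conic k)) (m : nat) : set (conic k) :=
  [set Q' | D' Q' /\ Q `&` Q' `&` zeros F #= `I_m].

(* [has_t F Q D' t] reads t(Q,D') = t, for [Q] not in [D'] (a relation, since
   it is a theorem that one of the cases always occurs). *)
Definition has_t (k : fieldType) (F : {mpoly k[3]}) (Q : conic k)
    (D' : set (conic k)) (t : ttype) : Prop :=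
  match t with
  | t_alpha => meeting F Q D' 2 #= `I_3 /\ meeting F Q D' 0 #= `I_18
  | t_beta => [/\ meeting F Q D' 2 #= `I_1, meeting F Q D' 1 #= `I_4 &
                  meeting F Q D' 0 #= `I_16]
  | t_gamma => meeting F Q D' 1 #= `I_6 /\ meeting F Q D' 0 #= `I_15
  end.

Definition with_t (k : fieldType) (F : {mpoly k[3]}) (D D' : set (conic k))
    (t : ttype) : set (conic k) :=
  [set Q | D Q /\ has_t F Q D' t].

(* [has_T F D D' T] reads T(D,D') = T, for distinct [D] and [D']. *)
Definition has_T (k : fieldType) (F : {mpoly k[3]}) (D D' : set (conic k))
    (T : Ttype) : Prop :=
  match T with
  | T_beta21 => forall Q, D Q -> has_t F Q D' t_beta
  | T_gamma21 => forall Q, D Q -> has_t F Q D' t_gamma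
  | T_alpha15_gamma6 =>
      with_t F D D' t_alpha #= `I_15 /\ with_t F D D' t_gamma #= `I_6
  | T_alpha3_gamma18 =>
      with_t F D D' t_alpha #= `I_3 /\ with_t F D D' t_gamma #= `I_18
  end.

Definition adjH (k : fieldType) (F : {mpoly k[3]}) (D D' : set (conic k)) :
    Prop :=
  D <> D' /\ has_T F D D' T_alpha15_gamma6.

Definition comps_H (k : fieldType) (F : {mpoly k[3]}) :
    set (set (set (conic k))) :=
  components (comps_G F) (adjH F).

Definition gmap (k : fieldType) (F : {mpoly k[3]}) (C : set (set (conic k)))
    (D : set (conic k)) : set (set (conic k)) :=
  [set D' | C D' /\ has_T F D D' T_beta21].

Definition common_size (T : Ttype) : nat :=
  match T with
  | T_alpha15_gamma6 => 0
  | T_alpha3_gamma18 => 3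
  | T_gamma21 => 5
  | T_beta21 => 8
  end.

(* Main.v *)
From HB Require Import structures.
Require Import Defs.
From mathcomp Require Import all_boot all_order all_algebra.
From mathcomp Require Import boolp classical_sets functions cardinality.
From mathcomp Require Import mpoly ring zify.
From Stdlib Require Import Relation_Operators.

Set Implicit Arguments.
Unset Strict Implicit.
Unset Printing Implicit Defensive.

Import GRing.Theory.

Local Open Scope ring_scope.
Local Open Scope classical_set_scope.
Local Open Scope card_scope.

(** Geometry reduces the statement to finite data, and the finite data are then decided by
    computation and by one counting argument.

    On a conic parametrized by (1, t, t^2) in some basis the sextic becomes a polynomial in t, and
    intersection multiplicities are its orders of vanishing ([has_imult_param], [has_imult_uniq]).
    In a suitable basis, a [frame], the sextic is a multiple of the Hermitian form x0 y2^5 + x2 y0^5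
    - 2 x1 y1^5 at x = y, whose value on (1, t, t^2) is (t^5 - t)^2. This standard conic is
    therefore tangent at the six points of P^1(F_5). Conversely [tangent_classify] shows that every
    totally tangent conic is the image of the standard one under a matrix of the unitary group of
    the form. Unitary matrices have entries in F_25 ([unitary_entries]), so all contact points lie
    among the 126 isotropic points over F_25.

    A component of [G] is coded by a labelling of these 126 points with 21 labels, whose fibres are
    the contact sets of its conics. One labelling [lab0] is given; the 150 labellings [labs] are its
    images under words in four unitary matrices [gens], which permute them through [sig]. These four
    matrices generate enough for every unitary matrix to permute the 150 blocks
    ([unitary_permutes]), so the blocks contain all conics ([cover]). The neighbours of the standard
    conic are found by inspecting all coded conics ([neighbours]), and they lie in its own block;
    two further matrices [stabs] move the standard conic through its whole block by steps to
    neighbours ([reframe]). Hence the components of [G] are exactly the blocks ([comps_GP]).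

    The types between block 0 and the others are computed and transported to a table [entry]
    ([has_TP]). Since types do not depend on the frame, the table is invariant under [sig]
    ([entry_sig]), and statements about it reduce to block 0. The components of [H] are the classes
    of [same]: 50 vertices, valency 7, one common neighbour for any two distinct non-adjacent
    vertices. The set attached to a block is the set of zeros of its row within a class; its size,
    its independence and the intersection numbers are read off in row 0 ([zeros_inP]). Injectivity
    follows since no intersection number is 15.

    Surjectivity is [coclique_zeros]. A 15-coclique attains Hoffman's bound, so each vertex of its
    class outside it has exactly three neighbours in it ([hoffman]). If the coclique contains vertex
    0, each of the seven neighbours of 0 has exactly two further neighbours in it, and a search over
    such pairs shows that the coclique lies in the zeros of some row. *)

Lemma subf_div (K : fieldType) (a b s l : K) : b != 0 -> l != 0 ->
  (a * l - b * s) / (b * l) = a / b - s / l.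
Proof. by move=> b0 l0; field; rewrite b0 l0. Qed.

Lemma expr_sub_div (K : fieldType) (a : K) i n : (i <= n)%N -> a != 0 ->
  a ^+ (n - i) / a ^+ n = (a ^+ i)^-1.
Proof.
move=> le a0; rewrite -{2}(subnKC le) exprD invfM mulrCA divff ?mulr1 //.
exact: expf_neq0.
Qed.

(** * Local ideals, and uniqueness of the intersection multiplicity *)

Section LocalIdeal.

Variables (k : fieldType) (q f : {mpoly k[3]}) (P : ppoint k).

Lemma local_ideal_sym x : local_ideal q f P x -> local_ideal f q P x.
Proof.
by move=> [d [a [b [c [ha hb hc c0 ->]]]]]; exists d, b, a, c; split; rewrite // addrC.
Qed.

Lemma tofracX (m : {mpoly k[3]}) n : tofrac (m ^+ n) = tofrac m ^+ n.
Proof. exact: rmorphXn. Qed.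

Lemma nz_eval (c : {mpoly k[3]}) v : c.@[v] != 0 -> c != 0.
Proof. by apply: contraNneq => ->; rewrite meval0. Qed.

Lemma local_idealD x y :
  local_ideal q f P x -> local_ideal q f P y -> local_ideal q f P (x + y).
Proof.
move=> [d [a [b [c [ha hb hc c0 ->]]]]] [d' [a' [b' [c' [ha' hb' hc' c0' ->]]]]].
exists (d + d')%N, (a * c' + a' * c), (b * c' + b' * c), (c * c'); split.
- by rewrite mulrDl !(mulrAC _ _ q) rpredD //; [|rewrite addnC]; apply: dhomogM.
- by rewrite mulrDl !(mulrAC _ _ f) rpredD //; [|rewrite addnC]; apply: dhomogM.
- exact: dhomogM.
- by rewrite mevalM mulf_neq0.
- rewrite addf_div ?tofrac_eq0 ?(nz_eval c0) ?(nz_eval c0') //.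
  by rewrite -!tofracM -tofracD; congr (tofrac _ / _); ring.
Qed.

Lemma local_idealZ (z : k) x : local_ideal q f P x -> local_ideal q f P (tofrac z%:MP * x).
Proof.
move=> [d [a [b [c [ha hb hc c0 ->]]]]].
exists d, (z *: a), (z *: b), c; split=> //; rewrite -?scalerAl ?rpredZ //.
by rewrite mulrA -tofracM mul_mpolyC scalerDr.
Qed.

Lemma local_ideal0 : local_ideal q f P 0.
Proof.
exists 0%N, 0, 0, 1; split; rewrite ?mul0r ?rpred0 ?dhomog1 ?meval1 ?oner_neq0 //.
by rewrite addr0 tofrac0 mul0r.
Qed.

Lemma local_ideal_sum n (z : 'I_n -> k) (x : 'I_n -> {fraction {mpoly k[3]}}) :
  (forall i, local_ideal q f P (x i)) ->
  local_ideal q f P (\sum_(i < n) tofrac (z i)%:MP * x i).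
Proof.
move=> hx; elim/big_ind: _ => [|u v|i _]; [exact: local_ideal0|exact: local_idealD|].
exact: local_idealZ.
Qed.

(** Each family expands in the other modulo the ideal. Uniqueness of coordinates forces the product
    of the two transition matrices to be the identity, and a rank comparison gives the
    inequality. *)
Lemma has_imult_sizes n m : has_imult q f P n -> has_imult q f P m -> (n <= m)%N.
Proof.
move=> [e [eL eB]] [e' [eL' eB']].
have h1 i : exists c : 'rV[k]_m,
    local_ideal q f P (e i - \sum_(j < m) tofrac (c 0 j)%:MP * e' j).
  by have [c [hc _]] := eB' _ (eL i); exists c.
have h2 i : exists c : 'rV[k]_n,
    local_ideal q f P (e' i - \sum_(j < n) tofrac (c 0 j)%:MP * e j).
  by have [c [hc _]] := eB _ (eL' i); exists c.
have [A hA] := choice h1; have [B hB] := choice h2.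
pose M := \matrix_(i < n, j < m) A i 0 j; pose N := \matrix_(i < m, j < n) B i 0 j.
suff MN : M *m N = 1%:M by exact: mulmx1_min MN.
apply/row_matrixP => i; have [c [_ cU]] := eB _ (eL i).
transitivity c; last first.
  apply: cU; rewrite (bigD1 i) //= !mxE eqxx mpolyC1 tofrac1 mul1r big1 ?addr0 ?subrr.
    exact: local_ideal0.
  by move=> j ji; rewrite !mxE eq_sym (negPf ji) mpolyC0 tofrac0 mul0r.
symmetry; apply: cU.
have := local_idealD (hA i) (local_ideal_sum (fun j => A i 0 j) hB).
congr (local_ideal _ _ _ _).
rewrite [X in _ + X](eq_bigr (fun j => tofrac (A i 0 j)%:MP * e' j -
   \sum_(l < n) tofrac (A i 0 j * B j 0 l)%:MP * e l)); last first.
  move=> j _; rewrite mulrBr mulr_sumr; congr (_ - _); apply: eq_bigr => l _.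
  by rewrite mpolyCM tofracM mulrA.
rewrite sumrB addrA subrK exchange_big /=; congr (_ - _); apply: eq_bigr => l _.
rewrite -mulr_suml !mxE; congr (_ * _); rewrite raddf_sum /= raddf_sum.
by apply: eq_bigr => j _; rewrite !mxE.
Qed.

End LocalIdeal.

Lemma has_imult_sym (k : fieldType) (q f : {mpoly k[3]}) P n :
  has_imult q f P n -> has_imult f q P n.
Proof.
move=> [e [eL eB]]; exists e; split=> // x /eB [c [hc cU]].
exists c; split; first exact: local_ideal_sym.
by move=> c' /local_ideal_sym/cU.
Qed.

Lemma has_imult_uniq (k : fieldType) (q f : {mpoly k[3]}) P n m :
  has_imult q f P n -> has_imult q f P m -> n = m.
Proof.
by move=> h h'; apply/eqP; rewrite eqn_leq (has_imult_sizes h h') (has_imult_sizes h' h).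
Qed.

(* The local ring at a point of a rational curve [q = 0], parametrized by
   [theta], is mapped by [theta] onto the local ring of the line at [0]. *)
Section Parametrized.

Variables (k : fieldType) (q f : {mpoly k[3]}) (P : ppoint k).
Variable theta : {rmorphism {mpoly k[3]} -> {poly k}}.
Variables (dq df n : nat) (u : {poly k}) (l0 l1 : {mpoly k[3]}).
Hypothesis q_hom : q \is dq.-homog.
Hypothesis f_hom : f \is df.-homog.
Hypothesis thetaq : theta q = 0.
Hypothesis thetaf : theta f = 'X^n * u.
Hypothesis u0 : u.[0] != 0.
Hypothesis ker_theta : forall d (a : {mpoly k[3]}), a \is d.-homog -> theta a = 0 ->
  exists r, a = r * q.
Hypothesis thetaP : forall d (a : {mpoly k[3]}), a \is d.-homog ->
  (a.@[coords P] != 0) = ((theta a).[0] != 0).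
Hypothesis theta_onto : forall p, exists d a, a \is d.-homog /\ theta a = p.
Hypothesis l0_hom : l0 \is 1.-homog.
Hypothesis l1_hom : l1 \is 1.-homog.
Hypothesis theta_l0 : theta l0 = 1.
Hypothesis theta_l1 : theta l1 = 'X.
Hypothesis thetaC : forall c : k, theta c%:MP = c%:P.

Lemma l0X_hom m : l0 ^+ m \is m.-homog.
Proof. by rewrite -[m in m.-homog]mul1n dhomogMn. Qed.

(** For the converse, lift [u] to a form [s] and the cofactor of ['X^n] to a form [w]. Then
    [s a - w f], with powers of [l0] inserted to equalize degrees, restricts to 0 on the curve,
    hence is a multiple of [q]; and [s] is invertible at [P] because [u] does not vanish at 0. *)
Lemma local_idealE d a b : a \is d.-homog -> b \is d.-homog ->
  b.@[coords P] != 0 ->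
  local_ideal q f P (tofrac a / tofrac b) <-> 'X^n %| theta a.
Proof.
move=> ha hb b0; split.
  move=> [e [a' [b' [c [ha' hb' hc c0 E]]]]].
  have {}E : a * c = (a' * q + b' * f) * b.
    apply/eqP; rewrite -tofrac_eq !tofracM; move/eqP: E.
    by rewrite eqr_div ?tofrac_eq0 ?(nz_eval b0) ?(nz_eval c0).
  have : 'X^n %| theta a * theta c.
    rewrite -rmorphM E rmorphM rmorphD !rmorphM thetaq mulr0 add0r thetaf.
    by rewrite -mulrA dvdp_mull // -mulrA dvdp_mulr.
  rewrite Gauss_dvdpl // coprimep_expl // coprimep_sym -['X]subr0 -polyC0.
  by rewrite coprimep_XsubC /root -(thetaP hc).
move=> /dvdpP [m Em].
have [ds [s [hs Es]]] := theta_onto u; have [dw [w [hw Ew]]] := theta_onto m.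
pose A := (dw + df)%N; pose B := (ds + d)%N.
have h1 : s * a * l0 ^+ A \is (B + A).-homog by rewrite !dhomogM // l0X_hom.
have h2 : w * l0 ^+ B * f \is (B + A).-homog.
  by rewrite mulrAC addnC !dhomogM // l0X_hom.
have [r Er] : exists r, s * a * l0 ^+ A - w * l0 ^+ B * f = r * q.
  apply: (@ker_theta (B + A)); first by rewrite rpredB.
  rewrite rmorphB !rmorphM !rmorphXn theta_l0 !expr1n /= Es Ew Em thetaf; ring.
exists (B + A)%N, r, (w * l0 ^+ B), (s * b * l0 ^+ A); split=> //.
- by rewrite -Er rpredB.
- by rewrite !dhomogM // l0X_hom.
- have h3 : s * b * l0 ^+ A \is (B + A).-homog by rewrite !dhomogM // l0X_hom.
  rewrite (thetaP h3) !rmorphM rmorphXn theta_l0 expr1n mulr1 Es hornerM.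
  by rewrite mulf_neq0 // -(thetaP hb).
rewrite -Er subrK; apply/eqP.
have s0 : s != 0.
  by apply: contraNneq u0 => s0; rewrite -Es s0 rmorph0 horner0.
have l00 : l0 != 0.
  by apply: contra_eq_neq theta_l0 => ->; rewrite rmorph0 eq_sym oner_eq0.
rewrite !tofracM eqr_div ?mulf_neq0 ?tofrac_eq0 ?expf_neq0 ?(nz_eval b0) //.
by apply/eqP; ring.
Qed.

(** The quotient is k[t]/(t^n) with t the class of [l1 / l0], so the powers of t form a basis. The
    coordinates of [a / b] are the coefficients of [theta a / theta b] modulo t^n, the denominator
    being inverted by a Bezout relation. *)
Lemma has_imult_param : has_imult q f P n.
Proof.
pose e (i : 'I_n) := (tofrac l1 / tofrac l0) ^+ i.
have l00 : l0 != 0.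
  by apply: contra_eq_neq theta_l0 => ->; rewrite rmorph0 eq_sym oner_eq0.
have l1X m : l1 ^+ m \is m.-homog by rewrite -[m in m.-homog]mul1n dhomogMn.
have hX m : (l0 ^+ m).@[coords P] != 0.
  by rewrite (thetaP (l0X_hom m)) rmorphXn theta_l0 expr1n hornerC oner_eq0.
exists e; split.
  move=> i; exists i, (l1 ^+ i), (l0 ^+ i).
  by split; rewrite ?l0X_hom // /e expr_div_n !tofracX.
move=> x [d [a [b [ha hb b0 ->]]]].
pose N (c : 'rV[k]_n) := a * l0 ^+ n - b * \sum_(i < n) c 0 i *: (l1 ^+ i * l0 ^+ (n - i)).
have NE (c : 'rV[k]_n) : tofrac a / tofrac b - \sum_(i < n) tofrac (c 0 i)%:MP * e i =
    tofrac (N c) / tofrac (b * l0 ^+ n).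
  have b0' : tofrac b != 0 by rewrite tofrac_eq0 (nz_eval b0).
  have l0' : tofrac l0 != 0 by rewrite tofrac_eq0.
  rewrite /N; set S := \sum_(i < n) _ *: _.
  have lX : tofrac (l0 ^+ n) != 0 by rewrite tofracX expf_neq0.
  rewrite tofracB !tofracM (subf_div (tofrac a) (tofrac S) b0' lX) /S; congr (_ - _).
  rewrite raddf_sum /= mulr_suml; apply: eq_bigr => i _.
  rewrite -mul_mpolyC 2!tofracM -!mulrA; congr (_ * _).
  rewrite !tofracX.
  rewrite /e expr_div_n; congr (_ * _).
  by rewrite (expr_sub_div (ltnW (ltn_ord i)) l0').
have Nhom (c : 'rV[k]_n) : N c \is (d + n).-homog.
  rewrite rpredB // dhomogM ?l0X_hom // rpred_sum // => i _; rewrite rpredZ //.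
  by have := dhomogM (l1X i) (l0X_hom (n - i)); rewrite subnKC // ltnW.
have hbl : b * l0 ^+ n \is (d + n).-homog by rewrite dhomogM ?l0X_hom.
have thN (c : 'rV[k]_n) : theta (N c) = theta a - theta b * rVpoly c.
  rewrite rmorphB !rmorphM rmorphXn theta_l0 expr1n mulr1 rmorph_sum; congr (_ - _ * _).
  rewrite /rVpoly poly_def; apply: eq_bigr => i _; rewrite valK -mul_mpolyC !rmorphM.
  by rewrite !rmorphXn theta_l0 theta_l1 thetaC expr1n mulr1 mul_polyC.
have bX : coprimep 'X^n (theta b).
  rewrite coprimep_expl // coprimep_sym -['X]subr0 -polyC0.
  by rewrite coprimep_XsubC /root -(thetaP hb).
have NP (c : 'rV[k]_n) : local_ideal q f P (tofrac a / tofrac b -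
      \sum_(i < n) tofrac (c 0 i)%:MP * e i) <->
    'X^n %| theta a - theta b * rVpoly c.
  rewrite NE -thN; apply: local_idealE (Nhom c) hbl _.
  by rewrite mevalM mulf_neq0 ?hX.
have [[v w] /= vw] := Bezout_eq1_coprimepP _ _ bX.
pose C := (w * theta a) %% 'X^n.
have sC : (size C <= n)%N.
  by rewrite -ltnS -[n.+1](size_polyXn k) ltn_modp -size_poly_eq0 size_polyXn.
have hC : 'X^n %| theta a - theta b * C.
  have -> : C = w * theta a - (w * theta a) %/ 'X^n * 'X^n.
    by rewrite {1}(divp_eq (w * theta a) 'X^n) addrC addKr.
  rewrite [X in 'X^n %| X](_ : _ = (v * theta a + theta b * (w * theta a %/ 'X^n)) * 'X^n).
    exact: dvdp_mull.
  transitivity ((v * 'X^n + w * theta b) * theta a -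
    theta b * (w * theta a - w * theta a %/ 'X^n * 'X^n)); last by ring.
  by rewrite vw mul1r.
exists (poly_rV C); split; first by apply/NP; rewrite poly_rV_K.
move=> c /NP hc; apply: (can_inj (@rVpolyK _ _)); rewrite poly_rV_K //.
apply/eqP; rewrite eq_sym -subr_eq0; apply: contraT => /dvdp_leq/(_ _) le.
suff /le : 'X^n %| rVpoly c - C.
  rewrite size_polyXn ltnNge (leq_trans (size_polyD _ _)) // size_polyN geq_max sC.
  by rewrite andbT size_poly.
rewrite -(Gauss_dvdpr _ bX) mulrBr.
have -> : theta b * rVpoly c - theta b * C = theta a - theta b * C - (theta a - theta b * rVpoly c).
  by ring.
by rewrite dvdp_sub.
Qed.

End Parametrized.

(** * Linear substitutions and restriction to a parametrized curve *)

Section Substitution.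

Variable k : fieldType.
Implicit Types (A B V : 'M[k]_3) (f a : {mpoly k[3]}) (v : 'rV[k]_3).

(** Restriction of a polynomial to the curve parametrized by the row [g]. *)
Definition par (g : 'rV[{poly k}]_3) : {mpoly k[3]} -> {poly k} :=
  mmap (@polyC k) (g 0).
HB.instance Definition _ g := GRing.RMorphism.copy (par g) (mmap (@polyC k) (g 0)).

Lemma parC g c : par g c%:MP = c%:P.
Proof. exact: mmapC. Qed.

Lemma parX g i : par g 'X_i = g 0 i.
Proof. by rewrite /par mmapX mmap1U. Qed.

Lemma horner_par g f t : (par g f).[t] = f.@[fun i => (g 0 i).[t]].
Proof.
rewrite (mpolyE f) raddf_sum /= horner_sum raddf_sum /=; apply: eq_bigr => m _.
rewrite -mul_mpolyC rmorphM /= parC hornerM hornerC mul_mpolyC mevalZ; congr (_ * _).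
by rewrite mevalX /par mmapX /mmap1 horner_prod; apply: eq_bigr => i _; rewrite horner_exp.
Qed.

Lemma meval_scale d f c (v : 'I_3 -> k) : f \is d.-homog ->
  f.@[fun i => c * v i] = c ^+ d * f.@[v].
Proof.
move=> /dhomogP hf; rewrite !mevalE mulr_sumr; apply: eq_big_seq => m /hf /= <-.
rewrite mulrCA; congr (_ * _); rewrite mdegE -prodrXr -big_split /=.
by apply: eq_bigr => i _; rewrite exprMn.
Qed.

Lemma linear_substX A i : linear_subst A 'X_i = \sum_(j < 3) A i j *: 'X_j.
Proof. by rewrite /linear_subst comp_mpolyXU -tnth_nth tnth_mktuple. Qed.

Lemma par_linear_subst g A f :
  par g (linear_subst A f) = par (g *m map_mx polyC A^T) f.
Proof.
rewrite /linear_subst comp_mpolyEX [in RHS](mpolyE f) !raddf_sum /=; apply: eq_bigr => m _.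
rewrite -!mul_mpolyC !rmorphM /= !parC; congr (_ * _).
rewrite (comp_mpolyX m) rmorph_prod [RHS]mmapX /mmap1; apply: eq_bigr => i _.
rewrite rmorphXn; congr (_ ^+ _); rewrite tnth_mktuple rmorph_sum mxE.
by apply: eq_bigr => j _; rewrite -mul_mpolyC rmorphM /= parC parX !mxE mulrC.
Qed.

Lemma meval_linear_subst A f v : (linear_subst A f).@[v 0] = f.@[(v *m A^T) 0].
Proof.
rewrite /linear_subst comp_mpoly_meval; apply: meval_eq => i.
rewrite tnth_mktuple raddf_sum mxE /=; apply: eq_bigr => j _.
by rewrite mevalZ mevalXU mxE mulrC.
Qed.

Lemma linear_subst_homog d A f : f \is d.-homog -> linear_subst A f \is d.-homog.
Proof.
move=> /dhomogP hf; rewrite /linear_subst comp_mpolyEX big_seq.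
apply: rpred_sum => m /hf /= <-; rewrite rpredZ // (comp_mpolyX m) mdegE.
elim/big_ind2: _ => [|a i b j ha hb|i _]; [exact: dhomog1|exact: dhomogM|].
rewrite -[X in _ \is X.-homog]mul1n dhomogMn // tnth_mktuple.
by apply: rpred_sum => j _; rewrite rpredZ // dhomogX /= mdeg1.
Qed.

Lemma linear_substM A B f : linear_subst A (linear_subst B f) = linear_subst (B *m A) f.
Proof.
rewrite /linear_subst (comp_mpolyEX f) raddf_sum [RHS]comp_mpolyEX.
apply: eq_bigr => m _ /=; rewrite comp_mpolyZ; congr (_ *: _).
rewrite !(comp_mpolyX m) rmorph_prod; apply: eq_bigr => i _; rewrite rmorphXn.
congr (_ ^+ _); rewrite !tnth_mktuple raddf_sum /=.
under eq_bigr => j _ do rewrite comp_mpolyZ comp_mpolyXU -tnth_nth tnth_mktuple scaler_sumr.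
rewrite exchange_big /=; apply: eq_bigr => l _.
by rewrite mxE scaler_suml; apply: eq_bigr => j _; rewrite scalerA.
Qed.

Lemma linear_subst1 f : linear_subst 1%:M f = f.
Proof.
rewrite -[RHS]comp_mpoly_id /linear_subst; congr (_ \mPo _).
apply: eq_from_tnth => i; rewrite !tnth_mktuple (bigD1 i) //= mxE eqxx scale1r.
by rewrite big1 ?addr0 // => j ji; rewrite mxE eq_sym (negPf ji) scale0r.
Qed.

End Substitution.

Lemma sum3 (M : nmodType) (F : 'I_3 -> M) : \sum_(i < 3) F i = F 0 + F 1 + F 2%:R.
Proof.
rewrite !big_ord_recl big_ord0 addr0 addrA.
by congr (F _ + F _ + F _); apply: val_inj.
Qed.

Lemma prod3 (R : comNzRingType) (F : 'I_3 -> R) :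
  \prod_(i < 3) F i = F 0 * F 1 * F 2%:R.
Proof.
rewrite !big_ord_recl big_ord0 mulr1 mulrA.
by congr (F _ * F _ * F _); apply: val_inj.
Qed.

Lemma sumn3 (F : 'I_3 -> nat) : (\sum_(i < 3) F i)%N = (F 0%R + F 1%R + F 2%:R%R)%N.
Proof.
rewrite !big_ord_recl big_ord0 addn0 addnA.
by congr (F _ + F _ + F _)%N; apply: val_inj.
Qed.

Lemma ord3P (P : 'I_3 -> Prop) : P 0 -> P 1 -> P 2%:R -> forall i, P i.
Proof.
move=> h0 h1 h2 [[|[|[|//]]] hi].
- by rewrite (_ : Ordinal hi = 0) //; apply: val_inj.
- by rewrite (_ : Ordinal hi = 1) //; apply: val_inj.
- by rewrite (_ : Ordinal hi = 2%:R) //; apply: val_inj.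
Qed.

Lemma monomE (k : fieldType) (m : 'X_{1..3}) :
  'X_[m] = 'X_0 ^+ m 0 * 'X_1 ^+ m 1 * 'X_2%:R ^+ m 2%:R :> {mpoly k[3]}.
Proof. by rewrite mpolyXE_id prod3. Qed.

(** * Multiplicities along a standard curve: the conic (1, t, t^2) and the line (1, t, 0) *)

Section Standard.

Variables (k : fieldType) (g : 'rV[{poly k}]_3) (q0 : {mpoly k[3]}).
(** Normal forms modulo [q0]: in each degree a monomial is congruent to its restriction, read with
    [T i] in place of t^i. Restrictions to both curves have degree at most 2d. *)
Hypothesis normal : forall d, exists T : nat -> {mpoly k[3]}, forall m, mdeg m = d ->
  exists r, 'X_[m] - \sum_(i < d.*2.+1) (par g 'X_[m])`_i *: T i = r * q0.

(* Modulo [q0] a form is determined by its restriction to the curve. *)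
Lemma ker_standard d (a : {mpoly k[3]}) : a \is d.-homog -> par g a = 0 ->
  exists r, a = r * q0.
Proof.
move=> /dhomogP ha a0; have [T hT] := normal d.
suff [r Er] : exists r, a - \sum_(i < d.*2.+1) (par g a)`_i *: T i = r * q0.
  by exists r; rewrite -Er a0 big1 ?subr0 // => i _; rewrite coef0 scale0r.
have -> : a - \sum_(i < d.*2.+1) (par g a)`_i *: T i =
    \sum_(m <- msupp a) a@_m *: ('X_[m] - \sum_(i < d.*2.+1) (par g 'X_[m])`_i *: T i).
  under [RHS]eq_bigr => m _ do rewrite scalerBr scaler_sumr.
  rewrite sumrB -mpolyE; congr (_ - _); rewrite exchange_big /=; apply: eq_bigr => i _.
  rewrite {1}(mpolyE a) raddf_sum /= coef_sum scaler_suml; apply: eq_bigr => m _.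
  by rewrite -mul_mpolyC rmorphM /= parC coefCM scalerA.
rewrite big_seq; elim/big_ind: _ => [|x y [r ->] [s ->]|m /ha /= /hT [r ->]].
- by exists 0; rewrite mul0r.
- by exists (r + s); rewrite mulrDl.
- by exists (a@_m *: r); rewrite scalerAl.
Qed.

Variables (V : 'M[k]_3) (q f : {mpoly k[3]}) (P : ppoint k) (alpha c : k).
Variables (df n : nat) (u : {poly k}).
Hypothesis V_unit : V \in unitmx.
Hypothesis g0 : g 0 0 = 1.
Hypothesis g1 : g 0 1 = 'X.
Hypothesis g2 : (g 0 2%:R).[0] = 0.
Hypothesis gq0 : par g q0 = 0.
Hypothesis alpha0 : alpha != 0.
Hypothesis Vq : linear_subst V^T q = alpha *: q0.
Hypothesis c0 : c != 0.
Hypothesis VP : forall i, coords P i = c * V 0 i.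
Hypothesis f_hom : f \is df.-homog.
Hypothesis Vf : par (g *m map_mx polyC V) f = 'X^n * u.
Hypothesis u0 : u.[0] != 0.

(** This is [has_imult_param] for the standard parametrization followed by the coordinate change
    [V]; the point has parameter 0. As [g] begins with (1, t), any polynomial in t lifts to a form
    in the first two coordinates. *)
Lemma has_imult_standard : has_imult q f P n.
Proof.
pose th := par (g *m map_mx polyC V).
have thV a : th a = par g (linear_subst V^T a) by rewrite par_linear_subst trmxK.
have thVi a : th (linear_subst (invmx V)^T a) = par g a.
  by rewrite thV linear_substM -trmx_mul mulmxV // trmx1 linear_subst1.
apply: (@has_imult_param _ _ _ _ th df n u
  (linear_subst (invmx V)^T 'X_0) (linear_subst (invmx V)^T 'X_1)) => //.
- by rewrite -[LHS]/(th q) thV Vq -mul_mpolyC rmorphM /= gq0 mulr0.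
- move=> d a ha a0; have [r Er] := ker_standard (linear_subst_homog V^T ha) (etrans (esym (thV a)) a0).
  exists (linear_subst (invmx V)^T (alpha^-1 *: r)).
  rewrite -[LHS](@linear_subst1 k) -trmx1 -(mulVmx V_unit) trmx_mul -linear_substM Er.
  rewrite -[q in RHS](@linear_subst1 k) -trmx1 -(mulVmx V_unit) trmx_mul -linear_substM Vq.
  rewrite /linear_subst -rmorphM /= -scalerAr -scalerAl scalerA.
  by rewrite mulfV // scale1r.
- move=> d a ha; rewrite horner_par.
  have -> : a.@[coords P] = c ^+ d * a.@[V 0].
    by rewrite -(meval_scale _ _ ha); apply: meval_eq => i; rewrite VP.
  rewrite mulf_eq0 expf_eq0 (negPf c0) andbF /=; congr (_ != _); apply: meval_eq => i.
  rewrite mxE sum3 !mxE !hornerD !hornerM !hornerC g0 g1 g2 hornerX hornerC.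
  by rewrite mul1r !mul0r !addr0.
- move=> p; pose s := (size p).
  exists s, (linear_subst (invmx V)^T (\sum_(i < s) p`_i *: ('X_0 ^+ (s - i) * 'X_1 ^+ i))).
  split.
    apply: linear_subst_homog; apply: rpred_sum => i _; rewrite rpredZ //.
    rewrite -[X in _ \is X.-homog](subnK (ltnW (ltn_ord i))).
    by rewrite dhomogM // -[X in _ \is X.-homog]mul1n dhomogMn // dhomogX /= mdeg1.
  rewrite -[LHS]/(th _) thVi raddf_sum /= -[RHS]coefK poly_def.
  apply: eq_bigr => i _; rewrite -mul_mpolyC !rmorphM !rmorphXn /= parC !parX g0 g1.
  by rewrite expr1n mul1r mul_polyC.
- by apply: linear_subst_homog; rewrite dhomogX /= mdeg1.
- by apply: linear_subst_homog; rewrite dhomogX /= mdeg1.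
- by rewrite -[LHS]/(th _) thVi parX.
- by rewrite -[LHS]/(th _) thVi parX.
- by move=> z; exact: parC.
Qed.

End Standard.

Section ConicLine.

Variable k : fieldType.

Definition conic_param : 'rV[{poly k}]_3 := \row_i 'X^i.
Definition line_param : 'rV[{poly k}]_3 := \row_i (if i == 2%:R then 0 else 'X^i).

Definition conic_form : {mpoly k[3]} := 'X_1 ^+ 2 - 'X_0 * 'X_2%:R.

Lemma conic_paramE : (conic_param 0 0 = 1) * (conic_param 0 1 = 'X) *
  (conic_param 0 2%:R = 'X^2).
Proof. by rewrite !mxE. Qed.

Lemma line_paramE : (line_param 0 0 = 1) * (line_param 0 1 = 'X) *
  (line_param 0 2%:R = 0).
Proof. by rewrite !mxE. Qed.

(** The relation X1^2 = X0 X2 removes squares of X1, so modulo the conic a monomial of degree d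
    depends only on the exponent of t in its restriction. *)
Lemma conic_normal d : exists T : nat -> {mpoly k[3]}, forall m, mdeg m = d ->
  exists r, 'X_[m] - \sum_(i < d.*2.+1) (par conic_param 'X_[m])`_i *: T i = r * conic_form.
Proof.
exists (fun e => 'X_0 ^+ (d - e./2 - odd e) * 'X_1 ^+ odd e * 'X_2%:R ^+ e./2) => m hm.
have {}hm : (m 0%R + m 1%R + m 2%:R%R)%N = d by rewrite -sumn3 -mdegE.
pose e := (m 1%R + (m 2%:R%R).*2)%N.
have -> : par conic_param 'X_[m] = 'X^e.
  rewrite monomE !rmorphM !rmorphXn /= !parX !conic_paramE expr1n mul1r.
  by rewrite -exprM -exprD mul2n.
have le : (e < d.*2.+1)%N by rewrite /e -hm; lia.
rewrite (bigD1 (Ordinal le)) //= coefXn eqxx scale1r big1 ?addr0; last first.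
  by move=> i; rewrite -val_eqE /= coefXn => /negPf ->; rewrite scale0r.
pose b := (m 1%R)./2.
have Em : m 1%R = (odd (m 1%R) + b.*2)%N by rewrite odd_double_half.
have oe : odd e = odd (m 1%R) by rewrite /e oddD odd_double addbF.
have he : e./2 = (b + m 2%:R%R)%N.
  by rewrite /e halfD odd_double andbF add0n doubleK.
(* The cofactor is that of A^b - B^b by A - B, for A = X1^2 and B = X0 X2. *)
exists ('X_0 ^+ m 0 * 'X_1 ^+ odd (m 1%R) * 'X_2%:R ^+ m 2%:R *
  \sum_(i < b) ('X_1 ^+ 2) ^+ (b.-1 - i) * ('X_0 * 'X_2%:R) ^+ i).
rewrite -(mulrA _ _ conic_form) [X in _ = _ * X]mulrC -subrXX monomE oe he (_ : d - _ - _ = m 0%R + b)%N; last by lia.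
rewrite {1}Em !exprD -exprM mul2n exprMn; ring.
Qed.

Lemma line_normal d : exists T : nat -> {mpoly k[3]}, forall m, mdeg m = d ->
  exists r, 'X_[m] - \sum_(i < d.*2.+1) (par line_param 'X_[m])`_i *: T i = r * 'X_2%:R.
Proof.
exists (fun e => 'X_0 ^+ (d - e) * 'X_1 ^+ e) => m hm.
have {}hm : (m 0%R + m 1%R + m 2%:R%R)%N = d by rewrite -sumn3 -mdegE.
have E : par line_param 'X_[m] = if m 2%:R is 0 then 'X^(m 1%R) else 0.
  rewrite monomE !rmorphM !rmorphXn /= !parX !line_paramE expr1n mul1r.
  by case: (m 2%:R) => [|l]; rewrite ?expr0 ?mulr1 ?expr0n ?mulr0.
case hm2 : (m 2%:R) E => [|l] ->; last first.
  exists ('X_0 ^+ m 0 * 'X_1 ^+ m 1%R * 'X_2%:R ^+ l).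
  rewrite big1 ?subr0; last by move=> i _; rewrite coef0 scale0r.
  by rewrite monomE hm2 exprSr mulrA.
have le : (m 1%R < d.*2.+1)%N by rewrite -hm; lia.
rewrite (bigD1 (Ordinal le)) //= coefXn eqxx scale1r big1 ?addr0; last first.
  by move=> i; rewrite -val_eqE /= coefXn => /negPf ->; rewrite scale0r.
exists 0; rewrite monomE hm2 expr0 mulr1 mul0r (_ : d - _ = m 0%R)%N ?subrr //; lia.
Qed.

End ConicLine.

(** * Points of the plane given by coordinate vectors *)

Section Points.

Variable k : fieldType.
Implicit Types (v w : 'rV[k]_3) (P : ppoint k).

Lemma delta0_neq0 : delta_mx 0 0 != 0 :> 'rV[k]_3.
Proof. by apply/eqP => /matrixP/(_ 0 0)/eqP; rewrite !mxE !eqxx oner_eq0. Qed.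

Lemma dim_delta0 : \dim <[delta_mx 0 0 : 'rV[k]_3]> == 1%N.
Proof. by rewrite dim_vline delta0_neq0. Qed.

Definition pt0 : ppoint k :=
  exist (fun U : {vspace 'rV[k]_3} => \dim U == 1%N) _ dim_delta0.

(* The point with coordinates [v]; junk for [v = 0]. *)
Definition pt v : ppoint k := insubd pt0 <[v]>%VS.

Lemma val_pt v : v != 0 -> val (pt v) = <[v]>%VS.
Proof. by move=> v0; rewrite val_insubd dim_vline v0. Qed.

Definition rep P : 'rV[k]_3 := vpick (val P).

Lemma rep_neq0 P : rep P != 0.
Proof. by rewrite vpick0 -dimv_eq0 (eqP (valP P)). Qed.

Lemma repK P : pt (rep P) = P.
Proof.
apply: val_inj; rewrite val_pt ?rep_neq0 //; apply/eqP.
by rewrite eqEdim -memvE memv_pick (eqP (valP P)) dim_vline rep_neq0.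
Qed.

Lemma rep_pt v : v != 0 -> exists2 c, c != 0 & rep (pt v) = c *: v.
Proof.
move=> v0; have := memv_pick (val (pt v)); rewrite {2}val_pt // => /vlineP [c E].
exists c => //; apply: contraTneq (rep_neq0 (pt v)) => c0.
by rewrite /rep E c0 scale0r eqxx.
Qed.

Lemma pt_scale c v : c != 0 -> v != 0 -> pt (c *: v) = pt v.
Proof.
move=> c0 v0; apply: val_inj; rewrite !val_pt ?scaler_eq0 ?negb_or ?c0 //; apply/eqP.
by rewrite eqEdim -memvE memvZ ?memv_line //= !dim_vline scaler_eq0 negb_or c0 v0.
Qed.

Lemma pt_inj v w : v != 0 -> w != 0 -> pt v = pt w -> exists2 c, c != 0 & v = c *: w.
Proof.
move=> v0 w0 /(congr1 val); rewrite !val_pt // => E.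
have := memv_line v; rewrite E => /vlineP [c Ec]; exists c => //.
by apply: contraNneq v0 => c0; rewrite Ec c0 scale0r.
Qed.

Lemma zeros_pt d f v : f \is d.-homog -> v != 0 -> zeros f (pt v) <-> f.@[v 0] = 0.
Proof.
move=> hf v0; have [c c0 E] := rep_pt v0.
rewrite /zeros /= -[coords _]/((rep (pt v)) 0) E.
have -> : f.@[(c *: v) 0] = c ^+ d * f.@[v 0].
  by rewrite -(meval_scale _ _ hf); apply: meval_eq => i; rewrite mxE.
split=> [/eqP|->]; last by rewrite mulr0.
by rewrite mulf_eq0 expf_eq0 (negPf c0) andbF => /eqP.
Qed.

Lemma mul_unit_neq0 v (V : 'M[k]_3) : V \in unitmx -> v != 0 -> v *m V != 0.
Proof.
by move=> hV; apply: contraNneq => /(congr1 (mulmx^~ (invmx V))); rewrite mul0mx mulmxK // => ->.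
Qed.

End Points.

(** * Quadratic forms and symmetric matrices *)

Section Quadratic.

Variable k : fieldType.
Implicit Types (M V : 'M[k]_3) (v : 'rV[k]_3) (q : {mpoly k[3]}).

Definition Xrow : 'rV[{mpoly k[3]}]_3 := \row_i 'X_i.

Definition quad M : {mpoly k[3]} := (Xrow *m map_mx (@mpolyC 3 k) M *m Xrow^T) 0 0.

Lemma quadE M : quad M = \sum_i \sum_j M i j *: ('X_i * 'X_j).
Proof.
rewrite /quad mxE exchange_big; apply: eq_bigr => j _; rewrite !mxE mulr_suml.
by apply: eq_bigr => i _; rewrite !mxE -mul_mpolyC; ring.
Qed.

Lemma quadD M N : quad (M + N) = quad M + quad N.
Proof. by rewrite /quad map_mxD mulmxDr mulmxDl mxE. Qed.

Lemma quadZ c M : quad (c *: M) = c *: quad M.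
Proof. by rewrite /quad map_mxZ -scalemxAr -scalemxAl mxE mul_mpolyC. Qed.

Lemma quad_homog M : quad M \is 2.-homog.
Proof.
rewrite quadE; apply: rpred_sum => i _; apply: rpred_sum => j _; rewrite rpredZ //.
by rewrite (@dhomogM _ _ _ 1 _ 1) // dhomogX /= mdeg1.
Qed.

Lemma quad_delta i j : quad (delta_mx i j) = 'X_i * 'X_j.
Proof.
rewrite quadE (bigD1 i) //= (bigD1 j) //= !mxE !eqxx scale1r !big1 ?addr0 //.
  by move=> a /negPf ai; rewrite big1 // => b _; rewrite mxE ai scale0r.
by move=> b /negPf bj; rewrite mxE bj andbF scale0r.
Qed.

Lemma meval_quad M v : (quad M).@[v 0] = (v *m M *m v^T) 0 0.
Proof.
have -> : (quad M).@[v 0] = (map_mx (meval (v 0)) (Xrow *m map_mx (@mpolyC 3 k) M *m Xrow^T)) 0 0.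
  by rewrite [RHS]mxE.
rewrite !map_mxM; congr ((_ *m _ *m _) 0 0); apply/matrixP => i j.
- by rewrite !mxE ord1; exact: mevalXU.
- by rewrite !mxE; exact: mevalC.
- by rewrite !mxE ord1; exact: mevalXU.
Qed.

Lemma linear_subst_quad M V : linear_subst V^T (quad M) = quad (V *m M *m V^T).
Proof.
pose ls : {mpoly k[3]} -> {mpoly k[3]} :=
  comp_mpoly [tuple \sum_(j < 3) V^T i j *: 'X_j | i < 3].
have -> : linear_subst V^T (quad M) = (map_mx ls (Xrow *m map_mx (@mpolyC 3 k) M *m Xrow^T)) 0 0.
  by rewrite [RHS]mxE.
have lX : map_mx ls Xrow = Xrow *m map_mx (@mpolyC 3 k) V.
  apply/matrixP => i j; rewrite !mxE -[LHS]/(linear_subst V^T 'X_j) linear_substX.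
  by apply: eq_bigr => a _; rewrite !mxE -mul_mpolyC mulrC.
have lM : map_mx ls (map_mx (@mpolyC 3 k) M) = map_mx (@mpolyC 3 k) M.
  by apply/matrixP => i j; rewrite !mxE; exact: comp_mpolyC.
have -> : quad (V *m M *m V^T) = (Xrow *m map_mx (@mpolyC 3 k) V *m
    map_mx (@mpolyC 3 k) M *m (Xrow *m map_mx (@mpolyC 3 k) V)^T) 0 0.
  by rewrite /quad trmx_mul 2!map_mxM map_trmx !mulmxA.
by rewrite 2!map_mxM -map_trmx lX lM.
Qed.

Lemma mderivXU (i j : 'I_3) : ('X_j)^`M(i) = ((j == i)%:R)%:MP :> {mpoly k[3]}.
Proof.
rewrite mderivX mnm1E; case: eqP => [->|_]; last by rewrite scale0r mpolyC0.
have -> : (U_(i) - U_(i))%MM = 0%MM by apply/mnmP => a; rewrite mnmBE subnn mnm0E.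
by rewrite mpolyX0 scale1r mpolyC1.
Qed.

Lemma mderiv_quad M i v : M^T = M -> ((quad M)^`M(i)).@[v 0] = 2%:R * (v *m M) 0 i.
Proof.
move=> MT; have Msym a b : M a b = M b a by rewrite -{1}MT mxE.
have -> : ((quad M)^`M(i)).@[v 0] =
    \sum_b \sum_a M b a * ((b == i)%:R * v 0 a + v 0 b * (a == i)%:R).
  have dS (G : 'I_3 -> {mpoly k[3]}) : (\sum_a G a)^`M(i) = \sum_a (G a)^`M(i).
    exact: raddf_sum.
  have eS (G : 'I_3 -> {mpoly k[3]}) : (\sum_a G a).@[v 0] = \sum_a (G a).@[v 0].
    exact: raddf_sum.
  rewrite quadE dS eS; apply: eq_bigr => b _.
  rewrite dS eS; apply: eq_bigr => c _.
  rewrite mderivZ mderivM mevalZ mevalD !mevalM !mderivXU !mevalC !mevalXU //.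
rewrite !mxE mulr2n mulrDl !mul1r.
under eq_bigr => b _ do (under eq_bigr => a _ do rewrite mulrDr; rewrite big_split).
rewrite big_split /=; congr (_ + _).
  rewrite (bigD1 i) //= [X in _ + X]big1 ?addr0; last first.
    by move=> b /negPf bi; rewrite big1 // => a _; rewrite bi mul0r mulr0.
  by apply: eq_bigr => a _; rewrite eqxx mul1r mulrC Msym.
apply: eq_bigr => b _; rewrite (bigD1 i) //= big1 ?addr0 ?eqxx ?mulr1 1?mulrC //.
by move=> a /negPf ai; rewrite ai !mulr0.
Qed.

Lemma mdeg2 (m : 'X_{1..3}) : mdeg m = 2%N -> exists i j, m = (U_(i) + U_(j))%MM.
Proof.
have [->|/eqP m0] := eqVneq m 0%MM; first by rewrite mdeg0.
have [i mi] : exists i, (0 < m i)%N.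
  apply/existsP; apply: contra_notT m0; rewrite negb_exists => /forallP h.
  by apply/mnmP => i; move: (h i); rewrite -eqn0Ngt mnm0E => /eqP.
have Em : m = (U_(i) + (m - U_(i)))%MM by rewrite addmC submK // lep1mP -lt0n.
move=> hm; have h1 : mdeg (m - U_(i)) = 1%N.
  by move: hm; rewrite {1}Em mdegD mdeg1 => -[].
by exists i; have /mdeg1P [j /eqP Ej] := introT eqP h1; exists j; rewrite -Ej.
Qed.

Lemma homog2_quad q : 2%:R != 0 :> k -> q \is 2.-homog -> exists2 M, M^T = M & q = quad M.
Proof.
move=> two0 /dhomogP hq; rewrite (mpolyE q) big_seq.
elim/big_ind: _ => [|x y [M MT ->] [N NT ->]|m /hq /mdeg2 [i [j ->]]].
- by exists 0; rewrite ?trmx0 //; have := quadZ 0 0; rewrite !scale0r.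
- by exists (M + N); rewrite ?quadD // raddfD /= MT NT.
exists ((q@_(U_(i) + U_(j)) / 2%:R) *: (delta_mx i j + delta_mx j i)).
  by rewrite linearZ raddfD /= !trmx_delta addrC.
rewrite quadZ quadD !quad_delta mpolyXD [X in _ + X]mulrC -mulr2n -scaler_nat scalerA.
by rewrite divfK.
Qed.

End Quadratic.

Definition mx3 (R : nmodType) (l : seq (seq R)) : 'M[R]_3 :=
  \matrix_(i, j) nth 0 (nth [::] l i) j.

(* Diagonalizes [p * conj v + ...]: the Fermat form is [x0 y2^5 + x2 y0^5 - 2 x1 y1^5] in a
   basis made of two isotropic vectors and a third one orthogonal to them. *)
Lemma fermat_frame (R : comNzRingType) (a b p q r u v w : R) :
  5%:R = 0 :> R -> b ^+ 6 = -1 -> a ^+ 6 = - 2%:R ->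
  (p + 3%:R * r) * (u + 3%:R * v) ^+ 5 + (b * (p - 3%:R * r)) * (b * (u - 3%:R * v)) ^+ 5 +
    (a * q) * (a * w) ^+ 5 = p * v ^+ 5 + r * u ^+ 5 - 2%:R * (q * w ^+ 5).
Proof.
move=> five hb ha.
transitivity ((p + 3%:R * r) * (u + 3%:R * v) ^+ 5 +
  b ^+ 6 * ((p - 3%:R * r) * (u - 3%:R * v) ^+ 5) + a ^+ 6 * (q * w ^+ 5)); first by ring.
rewrite hb ha; transitivity (p * v ^+ 5 + r * u ^+ 5 - 2%:R * (q * w ^+ 5) +
  5%:R * (r * u ^+ 5 + 97%:R * p * v ^+ 5 + 108%:R * r * u ^+ 3 * v ^+ 2 +
  486%:R * r * u * v ^+ 4 + 6%:R * p * u ^+ 4 * v + 108%:R * p * u ^+ 2 * v ^+ 3)).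
  by ring.
by rewrite five mul0r addr0.
Qed.

Lemma mderivXn (R : comNzRingType) m (p : {mpoly R[m]}) i n :
  (p ^+ n.+1)^`M(i) = n.+1%:R * (p ^+ n * p^`M(i)).
Proof.
elim: n => [|n IH]; first by rewrite expr1 expr0 !mul1r.
by rewrite exprS mderivM IH [in RHS]mulrS exprS; ring.
Qed.

Lemma linear_subst_fermat (k : fieldType) (A : 'M[k]_3) :
  linear_subst A (fermat_sextic k) = \sum_a (linear_subst A 'X_a) ^+ 6.
Proof.
by rewrite /linear_subst /fermat_sextic rmorph_sum; apply: eq_bigr => a _; rewrite rmorphXn.
Qed.

(** * Bases in which the sextic is the standard Hermitian form *)

Section Frame.

Variables (k : fieldType) (char5 : 5%N \in [pchar k]).
Hypothesis closed_root : forall n (c : k), (0 < n)%N -> exists x : k, x ^+ n = c.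

Lemma five0 : 5%:R = 0 :> k.
Proof. exact: pcharf0. Qed.

Lemma nat_neq0 n : ~~ (5 %| n)%N -> n%:R != 0 :> k.
Proof. by rewrite (dvdn_pcharf char5). Qed.

(** The Hermitian form whose conjugation is x -> x^5, the Frobenius of F_25 over F_5. Its value on
    (1, t, t^2) is (t^5 - t)^2. *)
Definition hermP (R : comNzRingType) (x y : 'rV[R]_3) : R :=
  x 0 0 * y 0 2%:R ^+ 5 + x 0 2%:R * y 0 0 ^+ 5 - 2%:R * (x 0 1 * y 0 1 ^+ 5).

(** The rows of [E] form a basis adapted to the curve. In [frame_tangent] the gradient sees only the
    linear argument of the form, since fifth powers have zero derivative. *)
Record frame (F : {mpoly k[3]}) (E : 'M[k]_3) (c : k) : Prop := Frame {
  frame_unit : E \in unitmx;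
  frame_c : c != 0;
  frame_homog : F \is 6.-homog;
  frame_par : forall g : 'rV[{poly k}]_3,
    par (g *m map_mx polyC E) F = c%:P * hermP g g;
  frame_tangent : forall y y' : 'rV[k]_3,
    \sum_i (F^`M(i)).@[(y' *m E) 0] * (y *m E) 0 i = c * hermP y y' }.

Lemma fermat_homog : fermat_sextic k \is 6.-homog.
Proof.
apply: rpred_sum => i _; rewrite -[X in _ \is X.-homog]mul1n.
by rewrite dhomogMn // dhomogX /= mdeg1.
Qed.

Lemma hermitian_frame F : hermitian_curve F -> exists E c, frame F E c.
Proof.
move=> [A [c [Au c0 ->]]].
have [a ha] := closed_root (- 2%:R) (isT : 0 < 6)%N.
have [b hb] := closed_root (- 1) (isT : 0 < 6)%N.
(* For the Fermat form, rows 0 and 2 are isotropic and row 1 is orthogonal to both; [a] and [b] are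
   the constants of [fermat_frame]. *)
pose K0 := mx3 [:: [:: 1; b; 0]; [:: 0; 0; a]; [:: 3%:R; - 3%:R * b; 0]].
have a0 : a != 0 by apply: contra_eq_neq ha => ->; rewrite expr0n eq_sym oppr_eq0 nat_neq0.
have b0 : b != 0 by apply: contra_eq_neq hb => ->; rewrite expr0n eq_sym oppr_eq0 oner_eq0.
have K0u : K0 \in unitmx.
  pose K1 := mx3 [:: [:: 2%:R^-1; 0; 6%:R^-1]; [:: (2%:R * b)^-1; 0; - (6%:R * b)^-1]; [:: 0; a^-1; 0]].
  suff : K0 *m K1 = 1%:M by case/mulmx1_unit.
  have h2 : 2%:R != 0 :> k := @nat_neq0 2 isT.
  have h6 : 6%:R != 0 :> k := @nat_neq0 6 isT.
  by apply/matrixP; apply: ord3P; apply: ord3P; rewrite !mxE sum3 !mxE /=; field;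
    rewrite ?a0 ?b0 ?h2 ?h6.
pose E := K0 *m invmx A^T.
have AEu : A^T \in unitmx by rewrite unitmx_tr.
have EA : E *m A^T = K0 by rewrite mulmxKV.
exists E, c; split=> //.
- by rewrite unitmx_mul K0u unitmx_inv.
- by rewrite rpredZ // linear_subst_homog // fermat_homog.
- move=> g; rewrite -mul_mpolyC rmorphM /= parC par_linear_subst -mulmxA -map_mxM EA.
  congr (_ * _); rewrite /fermat_sextic raddf_sum sum3 /= !rmorphXn /= !parX /hermP.
  have fiveP : 5%:R = 0 :> {poly k} by rewrite -polyC_natr five0.
  have := @fermat_frame {poly k} a%:P b%:P (g 0 0) (g 0 1) (g 0 2%:R) (g 0 0) (g 0 2%:R) (g 0 1) fiveP.
  rewrite -!polyC_exp hb ha polyCN polyCN polyC1 polyC_natr => /(_ erefl erefl) <-.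
  rewrite !mxE !sum3 !mxE /= polyC0 polyC1 polyCM polyCN polyC_natr; ring.
- move=> y y'.
have dS (G : 'I_3 -> {mpoly k[3]}) i : (\sum_a G a)^`M(i) = \sum_a (G a)^`M(i).
  exact: raddf_sum.
have eS (G : 'I_3 -> {mpoly k[3]}) (v : 'rV[k]_3) : (\sum_a G a).@[v 0] = \sum_a (G a).@[v 0].
  exact: raddf_sum.
have L (x : 'rV[k]_3) e : (linear_subst A 'X_e).@[(x *m E) 0] = (x *m K0) 0 e.
  by rewrite meval_linear_subst mevalXU -mulmxA EA.
have D i e (v : 'rV[k]_3) : ((linear_subst A 'X_e)^`M(i)).@[v 0] = A e i.
  rewrite linear_substX dS eS (bigD1 i) //= big1 ?addr0; last first.
    by move=> j /negPf ji; rewrite mderivZ mderivXU ji mpolyC0 scaler0 meval0.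
  by rewrite mderivZ mderivXU eqxx mevalZ mevalC mulr1.
transitivity (c * \sum_e (y *m K0) 0 e * (y' *m K0) 0 e ^+ 5).
  rewrite mulr_sumr (eq_bigr (fun i => \sum_e c * ((y' *m K0) 0 e ^+ 5 * (A e i * (y *m E) 0 i)))).
    rewrite exchange_big; apply: eq_bigr => e _ /=.
    transitivity (c * ((y' *m K0) 0 e ^+ 5 * \sum_i A e i * (y *m E) 0 i)).
      by rewrite !mulr_sumr.
    have -> : \sum_i A e i * (y *m E) 0 i = (y *m K0) 0 e.
      rewrite -EA mulmxA [RHS]mxE; apply: eq_bigr => i _.
      by rewrite [A^T _ _]mxE mulrC.
    by rewrite [X in c * X]mulrC.
  move=> i _; rewrite mderivZ mevalZ linear_subst_fermat dS eS mulr_sumr mulr_suml.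
  apply: eq_bigr => e _; rewrite mderivXn 2!mevalM D.
  have -> : (linear_subst A 'X_e ^+ 5).@[(y' *m E) 0] = (y' *m K0) 0 e ^+ 5.
    by rewrite -L; exact: rmorphXn.
  have -> : (6%:R : {mpoly k[3]}).@[(y' *m E) 0] = 1.
    by rewrite -mpolyC_nat mevalC -[6%N]/(5 + 1)%N natrD five0 add0r.
  by rewrite mul1r !mulrA.
congr (_ * _); rewrite sum3 /hermP -(@fermat_frame k a b _ _ _ _ _ _ five0 hb ha).
by rewrite !mxE !sum3 !mxE /=; ring.
Qed.

End Frame.

(** * The shape of the sextic on a totally tangent conic *)

Section SquareOfSextic.

Variables (k : fieldType) (char5 : 5%N \in [pchar k]).

Lemma dvdp_prod_sqr (f : {poly k}) (rs : seq k) : uniq rs ->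
  (forall r, r \in rs -> ('X - r%:P) ^+ 2 %| f) ->
  (\prod_(r <- rs) ('X - r%:P)) ^+ 2 %| f.
Proof.
elim: rs => [|r rs IH] /=; first by rewrite big_nil expr1n dvd1p.
move=> /andP [rrs urs] h; rewrite big_cons exprMn Gauss_dvdp.
  by rewrite h ?mem_head // IH // => s srs; apply: h; rewrite inE srs orbT.
rewrite coprimep_expl // coprimep_expr // coprimep_sym -[X in coprimep _ X]addr0.
by rewrite addr0 coprimep_XsubC root_prod_XsubC.
Qed.

(* The six double roots of [f], two of which are [0] and [oo], make [f] the
   square of [t p(t)], where [p] has degree 4; the shape of [f] forces [p] to be
   [t ^ 4 + p0]. *)
Lemma sparse_square (h02 h11 h20 h01 h21 : k) (rs : seq k) :
  let f := h02 *: 'X^10 + h21 *: 'X^7 + h11 *: 'X^6 + h01 *: 'X^5 + h20 *: 'X^2 in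
  h02 != 0 -> uniq rs -> size rs = 4%N -> 0 \notin rs ->
  (forall r, r \in rs -> ('X - r%:P) ^+ 2 %| f) ->
  exists2 p0, p0 != 0 & [/\ h11 = 2%:R * p0 * h02, h20 = p0 ^+ 2 * h02, h01 = 0 & h21 = 0].
Proof.
move=> f h02n urs s4 rs0 hrs.
pose p := \prod_(r <- rs) ('X - r%:P).
have sp : size p = 5 by rewrite size_prod_XsubC s4.
have pm : p`_4 = 1.
  by have /monicP : p \is monic := monic_prod_XsubC _ _ _; rewrite /lead_coef sp.
have Ep : p = 'X^4 + p`_3 *: 'X^3 + p`_2 *: 'X^2 + p`_1 *: 'X + (p`_0)%:P.
  rewrite -{1}[p]coefK sp poly_def !big_ord_recr big_ord0 /= pm scale1r add0r.
  by rewrite expr0 expr1 alg_polyC; ring.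
have p00 : p`_0 != 0.
  by rewrite -horner_coef0 -/(root p 0) root_prod_XsubC.
have sf : (size f <= 11)%N.
  rewrite /f; do !(apply: leq_trans (size_polyD _ _) _; rewrite geq_max; apply/andP; split);
  by apply: leq_trans (size_scale_leq _ _) _; rewrite size_polyXn.
have cX n m : ('X^n : {poly k})`_m = (m == n)%:R by exact: coefXn.
have f0 : f != 0.
  apply: contra_neq h02n => f0; have : f`_10 = 0 by rewrite f0 coef0.
  by rewrite /f !coefD !coefZ !cX /= mulr1 !mulr0 !addr0.
have hdvd : ('X * p) ^+ 2 %| f.
  have -> : 'X * p = \prod_(r <- 0 :: rs) ('X - r%:P) by rewrite big_cons polyC0 subr0.
  apply: dvdp_prod_sqr; first by rewrite /= rs0.
  move=> r; rewrite inE => /orP [/eqP ->|]; last exact: hrs.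
  rewrite polyC0 subr0; apply/dvdpP.
  exists (h02 *: 'X^8 + h21 *: 'X^5 + h11 *: 'X^4 + h01 *: 'X^3 + h20%:P).
  by rewrite /f -!mul_polyC; ring.
have [m Em] := dvdpP _ _ hdvd.
have sXp : size (('X * p) ^+ 2) = 11%N.
  have Xp0 : 'X * p != 0 by rewrite mulf_neq0 ?polyX_eq0 // -size_poly_eq0 sp.
  by rewrite expr2 (size_mul Xp0 Xp0) size_mul ?polyX_eq0 -?size_poly_eq0 ?sp // size_polyX.
have m0 : m != 0 by apply: contraNneq f0 => m0; rewrite Em m0 mul0r.
have sm : size m = 1%N.
  have := sf; rewrite Em size_mul // -?size_poly_eq0 ?sXp //.
  have : (0 < size m)%N by rewrite size_poly_gt0.
  by case: (size m) => [|[|a]] //=; rewrite !addnS.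
have [a a0 Ea] : exists2 a, a != 0 & m = a%:P by apply/size_poly1P/eqP.
have Ef : f = a *: ('X^10 + (2%:R * p`_3) *: 'X^9 + (2%:R * p`_2 + p`_3 ^+ 2) *: 'X^8
  + (2%:R * p`_1 + 2%:R * p`_3 * p`_2) *: 'X^7
  + (2%:R * p`_0 + 2%:R * p`_3 * p`_1 + p`_2 ^+ 2) *: 'X^6
  + (2%:R * p`_3 * p`_0 + 2%:R * p`_2 * p`_1) *: 'X^5
  + (2%:R * p`_2 * p`_0 + p`_1 ^+ 2) *: 'X^4
  + (2%:R * p`_1 * p`_0) *: 'X^3 + (p`_0 ^+ 2) *: 'X^2).
  rewrite Em Ea; move: (p`_0) (p`_1) (p`_2) (p`_3) Ep => q0 q1 q2 q3 ->.
  rewrite -!mul_polyC.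
  have [w hw] : exists w : k, w = 2%:R by exists 2%:R.
  by rewrite -hw !(polyCM, polyCD, polyC_exp) hw polyC_natr; ring.
have C n : f`_n = f`_n by [].
have two0 : 2%:R != 0 :> k by exact: (nat_neq0 char5).
have c9 : p`_3 = 0.
  have := C 9; rewrite {2}Ef /f !(coefD, coefZ) !cX /= !(mulr0, mulr1, addr0, add0r).
  by move/esym/eqP; rewrite !mulf_eq0 (negPf a0) (negPf two0) /= => /eqP.
have c8 : p`_2 = 0.
  have := C 8; rewrite {2}Ef /f !(coefD, coefZ) !cX /= !(mulr0, mulr1, addr0, add0r).
  rewrite c9 expr0n addr0.
  by move/esym/eqP; rewrite !mulf_eq0 (negPf a0) (negPf two0) /= => /eqP.
have c3 : p`_1 = 0.
  have := C 3; rewrite {2}Ef /f !(coefD, coefZ) !cX /= !(mulr0, mulr1, addr0, add0r).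
  by move/esym/eqP; rewrite !mulf_eq0 (negPf a0) (negPf two0) (negPf p00) orbF /= => /eqP.
have c10 : h02 = a.
  by have := C 10; rewrite {2}Ef /f !(coefD, coefZ) !cX /= !(mulr0, mulr1, addr0, add0r).
exists (p`_0) => //; split.
- have := C 6; rewrite {2}Ef /f !(coefD, coefZ) !cX /= !(mulr0, mulr1, addr0, add0r).
  by rewrite c8 c9 c10 => ->; ring.
- have := C 2; rewrite {2}Ef /f !(coefD, coefZ) !cX /= !(mulr0, mulr1, addr0, add0r).
  by rewrite c10 => ->; ring.
- have := C 5; rewrite {2}Ef /f !(coefD, coefZ) !cX /= !(mulr0, mulr1, addr0, add0r).
  by rewrite c8 c9 => ->; ring.
- have := C 7; rewrite {2}Ef /f !(coefD, coefZ) !cX /= !(mulr0, mulr1, addr0, add0r).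
  by rewrite c3 c9 => ->; ring.
Qed.

End SquareOfSextic.

Lemma card_ordP (T : Type) (A : set T) n : A #= `I_n <->
  exists f : 'I_n -> T, injective f /\ (forall x, A x <-> exists i, x = f i).
Proof.
split=> [|[f [fi Af]]].
  rewrite card_eq_sym => h; have {}h : [set: 'I_n] #= A.
    by rewrite -(card_eql card_II).
  have /card_bijP [f fb] := h.
  exists (fun i => val (f (SigSub (mem_setT i)))); split.
    by move=> i j /val_inj /(bij_inj fb) [].
  move=> x; split=> [Ax|[i ->]]; last exact: set_mem (valP _).
  have [g fK gK] := fb; pose z : [set: 'I_n] := g (SigSub (mem_set Ax)); exists (val z).
  have -> : SigSub (mem_setT (val z)) = z by exact: val_inj.
  by rewrite /z gK.
have -> : A = range f.
  by apply/seteqP; split=> x; [move=> /Af [i ->]; exists i|move=> [i _ <-]; apply/Af; exists i].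
rewrite (card_eql (inj_card_eq _)); last by move=> i j _ _; exact: fi.
by rewrite card_eq_sym card_II.
Qed.

(** Turns the cardinality conditions in the definitions of adjacency and of types into counts over
    lists of indices. *)
Lemma card_seqP (T : Type) (g : nat -> T) (s : seq nat) (A : set T) m : uniq s ->
  (forall i j, i \in s -> j \in s -> g i = g j -> i = j) ->
  (forall x, A x <-> exists2 i, i \in s & x = g i) ->
  (A #= `I_m) <-> (size s == m).
Proof.
move=> us gi Ag; have : A #= `I_(size s).
  apply/card_ordP; exists (fun i : 'I_(size s) => g (nth 0%N s i)); split.
    move=> i j /gi; rewrite !mem_nth // => /(_ isT isT) /eqP.
    by rewrite nth_uniq // => /eqP /val_inj.
  move=> x; rewrite Ag; split=> [[i is_ ->]|[i ->]]; last by exists (nth 0%N s i); rewrite ?mem_nth.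
  have h : (index i s < size s)%N by rewrite index_mem.
  by exists (Ordinal h); rewrite nth_index.
move=> h; rewrite (card_eql h); split=> [/card_eq_II/eqP //|/eqP ->]; exact: card_eqxx.
Qed.

Lemma frob3 (R : comNzRingType) (x y z : R) : 5%:R = 0 :> R ->
  (x + y + z) ^+ 5 = x ^+ 5 + y ^+ 5 + z ^+ 5.
Proof.
move=> five; have D a b : (a + b) ^+ 5 = a ^+ 5 + b ^+ 5 :> R.
  transitivity (a ^+ 5 + b ^+ 5 + 5%:R * (a ^+ 4 * b + 2%:R * a ^+ 3 * b ^+ 2 +
    2%:R * a ^+ 2 * b ^+ 3 + a * b ^+ 4)); first by ring.
  by rewrite five mul0r addr0.
by rewrite !D.
Qed.

Lemma hermP_mul (R : comNzRingType) (x y : 'rV[R]_3) (W : 'M[R]_3) : 5%:R = 0 :> R ->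
  hermP (x *m W) (y *m W) =
  \sum_a \sum_b (x 0 a * y 0 b ^+ 5) * hermP (row a W) (row b W).
Proof.
move=> five; rewrite !sum3 /hermP !mxE !sum3 !frob3 // !exprMn; ring.
Qed.

Lemma hermP_scale (R : comNzRingType) (x y : 'rV[R]_3) a b :
  hermP (a *: x) (b *: y) = a * b ^+ 5 * hermP x y.
Proof. by rewrite /hermP !mxE !exprMn; ring. Qed.

Lemma hermP_map (R S : comNzRingType) (phi : {rmorphism R -> S}) (x y : 'rV[R]_3) :
  hermP (map_mx phi x) (map_mx phi y) = phi (hermP x y).
Proof. by rewrite /hermP !mxE -!rmorphXn -!rmorphM -(rmorph_nat phi 2) -rmorphM -rmorphD -rmorphB. Qed.

(** * The unitary group of the Hermitian form *)

Section Unitary.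

Variables (k : fieldType) (char5 : 5%N \in [pchar k]).
Implicit Types (W V : 'M[k]_3) (x y : 'rV[k]_3).

Definition Jmx : 'M[k]_3 := mx3 [:: [:: 0; 0; 1]; [:: 0; - 2%:R; 0]; [:: 1; 0; 0]].

Definition unitary W := forall a b, hermP (row a W) (row b W) = Jmx a b.

Lemma herm_unitary W x y : unitary W -> hermP (x *m W) (y *m W) = hermP x y.
Proof.
move=> hW; rewrite (hermP_mul _ _ _ (five0 char5)) !sum3 !hW !mxE /= /hermP.
ring.
Qed.

Lemma unitary_unit W : unitary W -> W \in unitmx.
Proof.
move=> hW; have two0 : 2%:R != 0 :> k by exact: (nat_neq0 char5).
rewrite -row_free_unit -kermx_eq0; apply/rowV0P => x /sub_kermxP xW.
have h b : \sum_a x 0 a * Jmx a b = 0.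
  have := hermP_mul x (delta_mx 0 b) W (five0 char5).
  rewrite xW {1}/hermP !mxE !mul0r mulr0 subr0 addr0 => /esym.
  under eq_bigr => a _.
    rewrite (bigD1 b) //= big1 ?addr0; last first.
      by move=> c /negPf cb; rewrite mxE cb andbF expr0n mulr0 mul0r.
    by rewrite mxE !eqxx expr1n mulr1 hW; over.
  by [].
apply/rowP; apply: ord3P; rewrite mxE.
- by move: (h 2%:R); rewrite sum3 !mxE /= !mulr0 mulr1 !addr0.
- move: (h 1); rewrite sum3 !mxE /= !mulr0 add0r addr0 mulrN => /eqP.
  by rewrite oppr_eq0 mulf_eq0 (negPf two0) orbF => /eqP.
- by move: (h 0); rewrite sum3 !mxE /= !mulr0 mulr1 !add0r.
Qed.

Lemma unitaryM W V : unitary W -> unitary V -> unitary (W *m V).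
Proof. by move=> hW hV a b; rewrite !row_mul herm_unitary // hW. Qed.

Lemma unitary1 : unitary 1%:M.
Proof.
move=> a b; rewrite /hermP !mxE.
by move: a b; do 2!apply: ord3P; rewrite /= ?(expr1n, expr0n) /=; ring.
Qed.

Lemma unitaryV W : unitary W -> unitary (invmx W).
Proof.
move=> hW a b; rewrite -(herm_unitary _ _ hW) -!row_mul mulVmx ?unitary_unit //.
exact: unitary1.
Qed.

End Unitary.

(** * Images of the standard conic, and changes of its parameter *)

Section Conics.

Variable k : fieldType.
Implicit Types (V : 'M[k]_3) (y : 'rV[k]_3) (P : ppoint k).

Definition conicM : 'M[k]_3 :=
  mx3 [:: [:: 0; 0; - 2%:R^-1]; [:: 0; 1; 0]; [:: - 2%:R^-1; 0; 0]].

Lemma quad_conicM : 2%:R != 0 :> k -> quad conicM = conic_form k.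
Proof.
move=> two0; rewrite quadE !sum3 !mxE /= !scale0r scale1r /conic_form !scaleNr.
have {2}-> : 'X_0 * 'X_2%:R = 2%:R^-1 *: ('X_0 * 'X_2%:R) + 2%:R^-1 *: ('X_2%:R * 'X_0) :> {mpoly k[3]}.
  rewrite [X in _ = _ + _ *: X]mulrC -scalerDl -mulr2n -[_^-1 *+ 2]mulr_natr mulVf //.
  by rewrite scale1r.
by rewrite -!mul_mpolyC; ring.
Qed.

Lemma conic_form_homog : conic_form k \is 2.-homog.
Proof.
rewrite rpredB //; first by rewrite -[X in _ \is X.-homog]mul1n dhomogMn // dhomogX /= mdeg1.
by rewrite (@dhomogM _ _ _ 1 _ 1) // dhomogX /= mdeg1.
Qed.

Lemma meval_conic_form y : (conic_form k).@[y 0] = y 0 1 ^+ 2 - y 0 0 * y 0 2%:R.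
Proof. by rewrite /conic_form mevalB rmorphXn /= mevalM !mevalXU. Qed.

Lemma par_conic_form : par (conic_param k) (conic_form k) = 0.
Proof.
by rewrite /conic_form rmorphB rmorphXn rmorphM /= !parX !conic_paramE mul1r subrr.
Qed.

(** Equation of the conic traced by (1, t, t^2) [V]. *)
Definition cform V : {mpoly k[3]} := linear_subst (invmx V)^T (conic_form k).
Definition conicset V : conic k := zeros (cform V).

Lemma cform_homog V : cform V \is 2.-homog.
Proof. exact/linear_subst_homog/conic_form_homog. Qed.

Lemma linear_subst_cform V : V \in unitmx -> linear_subst V^T (cform V) = conic_form k.
Proof.
by move=> hV; rewrite /cform linear_substM -trmx_mul mulmxV // trmx1 linear_subst1.
Qed.

Lemma cform_of_subst V q alpha : V \in unitmx ->
  linear_subst V^T q = alpha *: conic_form k -> q = alpha *: cform V.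
Proof.
move=> hV E; rewrite -[q]linear_subst1 -trmx1 -(mulVmx hV) trmx_mul -linear_substM E.
by rewrite /linear_subst comp_mpolyZ.
Qed.

Lemma zeros_scale (alpha : k) q : alpha != 0 -> zeros (alpha *: q) = zeros q.
Proof.
move=> a0; apply/seteqP; split=> P; rewrite /zeros /= mevalZ; last by move=> ->; rewrite mulr0.
by move/eqP; rewrite mulf_eq0 (negPf a0) => /eqP.
Qed.

Lemma conicset_pt V y : V \in unitmx -> y != 0 ->
  conicset V (pt (y *m V)) <-> y 0 1 ^+ 2 = y 0 0 * y 0 2%:R.
Proof.
move=> hV y0; rewrite /conicset (zeros_pt (cform_homog V)) ?mul_unit_neq0 //.
rewrite meval_linear_subst trmxK mulmxK // meval_conic_form.
by split=> [/eqP|->]; rewrite ?subrr // subr_eq0 => /eqP.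
Qed.

Definition cvec (t : k) : 'rV[k]_3 := \row_i t ^+ i.
Definition cinf : 'rV[k]_3 := delta_mx 0 2%:R.

Lemma cvec_neq0 t : cvec t != 0.
Proof. by apply/eqP => /rowP/(_ 0)/eqP; rewrite !mxE expr0 oner_eq0. Qed.

Lemma cinf_neq0 : cinf != 0.
Proof. by apply/eqP => /rowP/(_ 2%:R)/eqP; rewrite !mxE !eqxx oner_eq0. Qed.

Lemma pt_mul_rep V P : V \in unitmx -> exists2 y, y != 0 & P = pt (y *m V).
Proof.
move=> hV; exists (rep P *m invmx V); last by rewrite mulmxKV // repK.
by rewrite mul_unit_neq0 ?rep_neq0 // unitmx_inv.
Qed.

Lemma conicsetP V P : V \in unitmx ->
  conicset V P <-> (exists t, P = pt (cvec t *m V)) \/ P = pt (cinf *m V).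
Proof.
move=> hV; split; last first.
  move=> [[t ->]|->]; apply/conicset_pt; rewrite ?cvec_neq0 ?cinf_neq0 //.
    by rewrite !mxE expr0 mul1r -exprM.
  by rewrite !mxE /= expr0n mul0r.
have [y y0 ->] := pt_mul_rep P hV; rewrite conicset_pt // => E.
have [z|nz] := eqVneq (y 0 0) 0.
  right; move/eqP: E; rewrite z mul0r sqrf_eq0 => /eqP y1.
  have Ey : y = y 0 2%:R *: cinf.
    by apply/rowP; apply: ord3P; rewrite !mxE /= ?mulr0 ?mulr1.
  have y2 : y 0 2%:R != 0 by apply: contraNneq y0 => y2; rewrite Ey y2 scale0r.
  by rewrite Ey -scalemxAl pt_scale ?mul_unit_neq0 ?cinf_neq0.
left; exists (y 0 1 / y 0 0).
have -> : y = y 0 0 *: cvec (y 0 1 / y 0 0).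
  apply/rowP; apply: ord3P; rewrite !mxE /= ?expr0 ?mulr1 ?expr1 //; first by rewrite mulrC divfK.
  by rewrite expr_div_n E expr2 -mulf_div divff // mul1r mulrC divfK.
rewrite -scalemxAl !mxE expr0 mulr1 expr1 [y 0 0 * _]mulrC divfK //.
by rewrite pt_scale ?mul_unit_neq0 ?cvec_neq0.
Qed.

End Conics.

Lemma par_comp (k : fieldType) (g : 'rV[{poly k}]_3) (p : {poly k}) f :
  par (map_mx (fun h => h \Po p) g) f = par g f \Po p.
Proof.
rewrite (mpolyE f).
rewrite (raddf_sum (par (map_mx _ g))) (raddf_sum (par g)) (raddf_sum (comp_poly p)) /=.
apply: eq_bigr => m _; rewrite -mul_mpolyC !rmorphM /= !parC comp_polyC; congr (_ * _).
rewrite /par !mmapX /mmap1 (rmorph_prod (comp_poly p)); apply: eq_bigr => i _.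
by rewrite mxE (rmorphXn (comp_poly p)).
Qed.

Section Reparam.

Variables (k : fieldType).
Implicit Types (V : 'M[k]_3).

Lemma linear_subst_conic V : linear_subst V^T (conic_form k) =
  (\sum_j V j 1 *: 'X_j) ^+ 2 - (\sum_j V j 0 *: 'X_j) * (\sum_j V j 2%:R *: 'X_j).
Proof.
have E i : linear_subst V^T 'X_i = \sum_j V j i *: 'X_j.
  by rewrite linear_substX; apply: eq_bigr => j _; rewrite mxE.
by rewrite -!E /conic_form /linear_subst rmorphB rmorphXn rmorphM.
Qed.

(** [shiftmx], [swapmx] and [scalemx] realize t -> t + s, t -> 1/t and t -> l t on the conic. They
    bring any of its points to parameter 0, where multiplicities are read. *)
Definition shiftmx (s : k) : 'M[k]_3 :=
  mx3 [:: [:: 1; s; s ^+ 2]; [:: 0; 1; 2%:R * s]; [:: 0; 0; 1]].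
Definition swapmx : 'M[k]_3 := mx3 [:: [:: 0; 0; 1]; [:: 0; 1; 0]; [:: 1; 0; 0]].
Definition scalemx (m l : k) : 'M[k]_3 := diag_mx (\row_i (m * l ^+ i)).

Lemma conic_shift s : linear_subst (shiftmx s)^T (conic_form k) = conic_form k.
Proof.
rewrite linear_subst_conic !sum3 !mxE /= -!mul_mpolyC [s ^+ 2]expr2 !mpolyCM.
by rewrite mpolyC1 mpolyC0 mpolyC_nat /conic_form; ring.
Qed.

Lemma conic_swap : linear_subst swapmx^T (conic_form k) = conic_form k.
Proof.
by rewrite linear_subst_conic !sum3 !mxE /= !scale0r !scale1r /conic_form; ring.
Qed.

Lemma conic_scale m l :
  linear_subst (scalemx m l)^T (conic_form k) = (m ^+ 2 * l ^+ 2) *: conic_form k.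
Proof.
rewrite linear_subst_conic !sum3 !mxE /= !mulr1n !mulr0n !scale0r /conic_form.
by rewrite -!mul_mpolyC expr0 expr1 ?(expr2 m) ?(expr2 l) !mpolyCM mpolyC1; ring.
Qed.

Lemma shift_unit s : shiftmx s \in unitmx.
Proof.
suff : shiftmx s *m shiftmx (- s) = 1%:M by case/mulmx1_unit.
by apply/matrixP; do 2!apply: ord3P; rewrite !mxE sum3 !mxE /=; ring.
Qed.

Lemma swap_unit : swapmx \in unitmx.
Proof.
suff : swapmx *m swapmx = 1%:M by case/mulmx1_unit.
by apply/matrixP; do 2!apply: ord3P; rewrite !mxE sum3 !mxE /=; ring.
Qed.

Lemma scalemx_unit m l : m != 0 -> l != 0 -> scalemx m l \in unitmx.
Proof.
move=> m0 l0; suff : scalemx m l *m scalemx m^-1 l^-1 = 1%:M by case/mulmx1_unit.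
apply/matrixP; do 2!apply: ord3P; rewrite !mxE sum3 !mxE /=
  ?(mulr1n, mulr0n, mulr0, mul0r, addr0, add0r, expr0, mulr1) //; by field; rewrite ?m0 ?l0.
Qed.

Lemma row0_shift s V : row 0 (shiftmx s *m V) = cvec s *m V.
Proof.
rewrite row_mul; congr (_ *m _); apply/rowP; apply: ord3P; rewrite !mxE //=.
Qed.

Lemma row0_swap V : row 0 (swapmx *m V) = cinf k *m V.
Proof. by rewrite row_mul; congr (_ *m _); apply/rowP; apply: ord3P; rewrite !mxE. Qed.

Lemma conic_param_shift s V : conic_param k *m map_mx polyC (shiftmx s *m V) =
  map_mx (fun h => h \Po ('X + s%:P)) (conic_param k *m map_mx polyC V).
Proof.
rewrite map_mxM mulmxA.
have -> : conic_param k *m map_mx polyC (shiftmx s) =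
    map_mx (fun h => h \Po ('X + s%:P)) (conic_param k).
  apply/rowP => i; rewrite mxE sum3 !conic_paramE; move: i; apply: ord3P; rewrite !mxE /=.
  - by rewrite expr0 comp_polyC polyC0 polyC1; ring.
  - by rewrite comp_polyX polyC0 polyC1; ring.
  - by rewrite (rmorphXn (comp_poly _)) /= comp_polyX polyC1 polyC_exp polyCM polyC_natr; ring.
apply/rowP => i; rewrite !mxE !sum3 !mxE !rmorphD !rmorphM /= !comp_polyC //.
Qed.

End Reparam.

(** * Contact of the sextic with a conic, through its restriction *)

Section Contact.

Variables (k : fieldType) (char5 : 5%N \in [pchar k]).
Variables (F : {mpoly k[3]}) (E : 'M[k]_3) (c : k) (fr : frame F E c).
Implicit Types (V W : 'M[k]_3) (q : {mpoly k[3]}).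

Lemma coords_pt (v : 'rV[k]_3) : v != 0 ->
  exists2 d, d != 0 & forall i, coords (pt v) i = d * v 0 i.
Proof.
by move=> /rep_pt [d d0 Ed]; exists d => // i; rewrite -[LHS]/(rep (pt v) 0 i) Ed mxE.
Qed.

Lemma row_neq0 V i : V \in unitmx -> row i V != 0.
Proof.
move=> hV; rewrite rowE mul_unit_neq0 //.
by apply/eqP => /rowP/(_ i)/eqP; rewrite !mxE !eqxx oner_eq0.
Qed.

Lemma conic_imult V q alpha n u : V \in unitmx -> alpha != 0 ->
  linear_subst V^T q = alpha *: conic_form k ->
  par (conic_param k *m map_mx polyC V) F = 'X^n * u -> u.[0] != 0 ->
  has_imult q F (pt (row 0 V)) n.
Proof.
move=> hV a0 Eq Ef u0; have [d d0 hd] := coords_pt (row_neq0 0 hV).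
apply: (has_imult_standard (@conic_normal k) hV _ _ _ (par_conic_form k) a0 Eq d0 _
  (frame_homog fr) Ef u0); rewrite ?conic_paramE //.
- by rewrite hornerXn expr0n.
- by move=> i; rewrite hd mxE.
Qed.

(** Factor the exact power of t out of the restriction; [conic_imult] and uniqueness of the
    multiplicity identify its exponent. *)
Lemma conic_imultE V q alpha n : V \in unitmx -> alpha != 0 ->
  linear_subst V^T q = alpha *: conic_form k ->
  par (conic_param k *m map_mx polyC V) F != 0 ->
  has_imult q F (pt (row 0 V)) n ->
  exists2 u, u.[0] != 0 & par (conic_param k *m map_mx polyC V) F = 'X^n * u.
Proof.
move=> hV a0 Eq; set f := par _ _ => f0 hn.
have [m [u ru Eu]] := multiplicity_XsubC f 0.
rewrite polyC0 subr0 in Eu; have u0 : u.[0] != 0 by move: ru; rewrite f0.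
exists u => //; rewrite Eu mulrC; congr ('X^_ * _); apply: has_imult_uniq _ hn.
by apply: (conic_imult hV a0 Eq _ u0); rewrite -/f Eu mulrC.
Qed.

Lemma par_conic W : par (conic_param k *m map_mx polyC (W *m E)) F =
  c *: \sum_a \sum_b hermP (row a W) (row b W) *: 'X^(a + 5 * b).
Proof.
rewrite map_mxM mulmxA (frame_par fr) hermP_mul; last first.
  by rewrite -polyC_natr (five0 char5) polyC0.
rewrite mul_polyC; congr (_ *: _); apply: eq_bigr => a _; apply: eq_bigr => b _.
by rewrite -!map_row hermP_map !mxE -exprM -exprD mulnC [in RHS]addnC mulrC mul_polyC [(5 * _)%N]mulnC addnC.
Qed.

(** Fifth powers being additive, only the nine exponents a + 5b with a, b at most 2 occur, and their
    coefficients are the entries of the Gram matrix of [W]. *)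
Lemma par_conicE W (h := fun a b => hermP (row a W) (row b W)) :
  par (conic_param k *m map_mx polyC (W *m E)) F =
  c *: (h 2%:R 2%:R *: 'X^12 + h 1 2%:R *: 'X^11 + h 0 2%:R *: 'X^10 +
        h 2%:R 1 *: 'X^7 + h 1 1 *: 'X^6 + h 0 1 *: 'X^5 +
        h 2%:R 0 *: 'X^2 + h 1 0 *: 'X + (h 0 0)%:P).
Proof.
rewrite par_conic; congr (_ *: _); rewrite !sum3 /= -/(h _ _) -!mul_polyC; ring.
Qed.

(** The nine exponents are distinct, so a zero restriction would make the whole Gram matrix of the
    invertible [W] vanish, against non-degeneracy of the form. *)
Lemma par_conic_neq0 W : W \in unitmx ->
  par (conic_param k *m map_mx polyC (W *m E)) F != 0.
Proof.
move=> hW; apply: contraTneq isT => E0.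
have cX n m : ('X^n : {poly k})`_m = (m == n)%:R by exact: coefXn.
have h n : (par (conic_param k *m map_mx polyC (W *m E)) F)`_n = 0 by rewrite E0 coef0.
have z a b : hermP (row a W) (row b W) = 0.
  move: a b (frame_c fr) => a b c0; apply/eqP; move: a b.
  by do 2!apply: ord3P; [move: (h 0) | move: (h 5) | move: (h 10) | move: (h 1)
    | move: (h 6) | move: (h 11) | move: (h 2) | move: (h 7) | move: (h 12)];
  rewrite par_conicE !(coefD, coefZ, coefC) !cX coefX /= !(mulr0, mulr1, addr0, add0r);
  move/eqP; rewrite mulf_eq0 (negPf c0).
have := hermP_mul (delta_mx 0 0 *m invmx W) (delta_mx 0 2%:R *m invmx W) W (five0 char5).
rewrite !mulmxKV // big1 => [|a _]; last by rewrite big1 // => b _; rewrite z mulr0.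
rewrite /hermP !mxE /= !(expr1n, expr0n) /= !(mulr0, mul0r, subr0, addr0, mulr1).
by move/eqP; rewrite oner_eq0.
Qed.

End Contact.

(** * Bases adapted to two points of a conic *)

Section PolarFrame.

Variables (k : fieldType) (two0 : 2%:R != 0 :> k).
Implicit Types (M V : 'M[k]_3) (v w : 'rV[k]_3).

Definition bil M v w : k := (v *m M *m w^T) 0 0.

Lemma bilC M v w : M^T = M -> bil M v w = bil M w v.
Proof.
move=> MT; rewrite /bil; transitivity ((v *m M *m w^T)^T 0 0); first by rewrite [RHS]mxE.
by rewrite !trmx_mul trmxK MT mulmxA.
Qed.

Lemma bilZl M a v w : bil M (a *: v) w = a * bil M v w.
Proof. by rewrite /bil -!scalemxAl mxE. Qed.

Lemma bilZr M a v w : bil M v (a *: w) = a * bil M v w.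
Proof. by rewrite /bil linearZ /= -scalemxAr mxE. Qed.

Lemma bil_row M V i j : bil M (row i V) (row j V) = (V *m M *m V^T) i j.
Proof.
rewrite /bil -row_mul [LHS]mxE [RHS]mxE; apply: eq_bigr => a _.
by rewrite [row _ _ _ _]mxE [(row j V)^T _ _]mxE [row _ _ _ _]mxE [V^T _ _]mxE.
Qed.

Definition rows3 v0 v1 v2 : 'M[k]_3 :=
  \matrix_i (if i == 0 then v0 else if i == 1 then v1 else v2).

(* Two points of a nonsingular conic, and the pole of their chord, form a frame
   in which the conic is [x1 ^ 2 = x0 x2]. *)
Lemma conic_frame M v0 v2 : M^T = M -> M \in unitmx -> v0 != 0 -> v2 != 0 ->
  pt v0 <> pt v2 -> bil M v0 v0 = 0 -> bil M v2 v2 = 0 ->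
  exists V alpha, [/\ V \in unitmx, alpha != 0, row 0 V = v0, pt (row 2%:R V) = pt v2 &
    linear_subst V^T (quad M) = alpha *: conic_form k].
Proof.
move=> MT Mu v00 v20 v02 b00 b22.
have dep a b : a *: v0 + b *: v2 = 0 -> a = 0 /\ b = 0.
  move=> E; have [a0|a0] := eqVneq a 0.
    by move/eqP: E; rewrite a0 scale0r add0r scaler_eq0 (negPf v20) orbF => /eqP ->.
  case: v02; have Ev : v0 = (- (b / a)) *: v2.
    move/eqP: E; rewrite addr_eq0 => /eqP /(congr1 ( *:%R a^-1)).
    by rewrite scalerA mulVf // scale1r => ->; rewrite scalerN scaleNr scalerA mulrC.
  have b0 : - (b / a) != 0 by apply: contraNneq v00 => z; rewrite Ev z scale0r.
  by rewrite Ev pt_scale.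
pose N := M *m (col_mx v0 v2)^T.
have [v1 v10 v1N] : exists2 v1 : 'rV_3, v1 != 0 & v1 *m N = 0.
  exists (nz_row (kermx N)); last by apply/sub_kermxP; exact: nz_row_sub.
  by rewrite nz_row_eq0 -mxrank_eq0 mxrank_ker -lt0n subn_gt0 (leq_ltn_trans (rank_leq_col _)).
have [b10 b12] : bil M v1 v0 = 0 /\ bil M v1 v2 = 0.
  move: v1N; rewrite /N mulmxA tr_col_mx mul_mx_row -row_mx0 => /eq_row_mx [h h'].
  by rewrite /bil h h' !mxE.
have b020 : bil M v0 v2 != 0.
  apply/eqP => b02.
  have h : (col_mx v0 v2 *m M) *m (col_mx v0 v2)^T = 0.
    have z w w' : bil M w w' = 0 -> w *m M *m w'^T = 0.
      by move=> e; rewrite [LHS]mx11_scalar -/(bil M w w') e raddf0.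
    by rewrite mul_col_mx tr_col_mx mul_col_row !z ?block_mx0 // bilC.
  have r2 : \rank (col_mx v0 v2) = 2.
    apply/eqP; rewrite -[_ == _]/(row_free (col_mx v0 v2)) -kermx_eq0; apply/rowV0P => x.
    move/sub_kermxP; rewrite -[x]hsubmxK mul_row_col => e.
    have : (lsubmx x) 0 0 *: v0 + (rsubmx x) 0 0 *: v2 = 0.
      by rewrite -!mul_scalar_mx -!mx11_scalar.
    move/dep => [e1 e2]; rewrite [lsubmx x]mx11_scalar [rsubmx x]mx11_scalar e1 e2.
    by rewrite !raddf0 row_mx0.
  have := mulmx0_rank_max h; rewrite mxrankMfree ?row_free_unit // mxrank_tr r2 //.
have V0u u2 : u2 != 0 -> rows3 v0 v1 (u2 *: v2) \in unitmx.
  move=> u20; rewrite -row_free_unit -kermx_eq0; apply/rowV0P => x /sub_kermxP.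
  have -> : x *m rows3 v0 v1 (u2 *: v2) = x 0 0 *: v0 + x 0 1 *: v1 + (x 0 2%:R * u2) *: v2.
    apply/rowP => j; rewrite mxE sum3 !mxE /=; ring.
  move=> e.
  have B w : bil M (x 0 0 *: v0 + x 0 1 *: v1 + (x 0 2%:R * u2) *: v2) w =
      x 0 0 * bil M v0 w + x 0 1 * bil M v1 w + x 0 2%:R * u2 * bil M v2 w.
    by rewrite -!bilZl /bil !mulmxDl !mxE.
  have bil0 w : bil M 0 w = 0 by rewrite /bil !mul0mx mxE.
  have x2 : x 0 2%:R = 0.
    have := B v0; rewrite e bil0 b00 b10 !mulr0 !add0r => /esym/eqP.
    by rewrite (bilC _ _ MT) !mulf_eq0 (negPf u20) (negPf b020) !orbF => /eqP.
  have x0 : x 0 0 = 0.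
    have := B v2; rewrite e bil0 b22 b12 !mulr0 !addr0 => /esym/eqP.
    by rewrite mulf_eq0 (negPf b020) orbF => /eqP.
  move/eqP: e; rewrite x0 x2 mul0r !scale0r add0r addr0 scaler_eq0 (negPf v10) orbF => /eqP x1.
  by apply/rowP; apply: ord3P; rewrite mxE.
pose d := bil M v1 v1.
have d0 : d != 0.
  apply/eqP => d0; pose V := rows3 v0 v1 (1 *: v2).
  have Vu : V \in unitmx by apply: V0u; rewrite oner_eq0.
  have : v1 *m M *m V^T = 0.
    apply/rowP => j; rewrite [RHS]mxE; have -> : v1 = row 1 V by rewrite rowK.
    rewrite -row_mul -row_mul mxE -bil_row !rowK /=; move: j.
    by apply: ord3P => /=; rewrite ?scale1r.
  move/(congr1 (mulmx^~ (invmx V^T))); rewrite mul0mx mulmxK ?unitmx_tr //.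
  move/(congr1 (mulmx^~ (invmx M))); rewrite mul0mx mulmxK // => v1z.
  by move: v10; rewrite v1z eqxx.
pose u2 := - d / (2%:R * bil M v0 v2).
have u20 : u2 != 0 by rewrite mulf_neq0 ?oppr_eq0 // invr_eq0 mulf_neq0.
exists (rows3 v0 v1 (u2 *: v2)), d; split=> //; rewrite ?rowK //=; first exact: V0u.
  by rewrite pt_scale.
set V := rows3 _ _ _; rewrite linear_subst_quad quadE !sum3.
rewrite -!(bil_row M V) !rowK /= !(bilZl, bilZr) (bilC v2 v0) // (bilC v2 v1) // (bilC v0 v1) //.
rewrite b00 b22 b10 b12 -/d !mulr0 !scale0r /conic_form.
have -> : u2 * bil M v0 v2 = - (d / 2%:R).
  by rewrite /u2; field; rewrite b020 two0.
have : d = d / 2%:R + d / 2%:R by field.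
move: (d / 2%:R) => e ->; rewrite -!mul_mpolyC mpolyCN mpolyCD; ring.
Qed.

End PolarFrame.

(** * Every totally tangent conic is a unitary image of the standard one *)

Section Classification.

Variables (k : fieldType) (char5 : 5%N \in [pchar k]).
Hypothesis closed_root : forall n (c : k), (0 < n)%N -> exists x : k, x ^+ n = c.
Variables (F : {mpoly k[3]}) (E : 'M[k]_3) (c : k) (fr : frame F E c).
Implicit Types (V W : 'M[k]_3) (q : {mpoly k[3]}).

Let two0 : 2%:R != 0 :> k := @nat_neq0 k char5 2 isT.

Lemma nonsingular_unit M : M^T = M -> @nonsingular_conic_eq k (quad M) -> M \in unitmx.
Proof.
move=> MT [_ _ ns].
rewrite -row_free_unit -kermx_eq0; apply/rowV0P => x /sub_kermxP xM.
apply/eqP; apply: contraT => x0.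
have /ns [i] : @zeros k (quad M) (pt x).
  by rewrite (zeros_pt (quad_homog M) x0) meval_quad xM mul0mx mxE.
have [d d0 hd] := rep_pt x0; rewrite -[coords _]/((rep (pt x)) 0) hd mderiv_quad //.
by rewrite -scalemxAl xM scaler0 mxE mulr0 eqxx.
Qed.

Lemma nonsingular_quad M : M^T = M -> M \in unitmx -> @nonsingular_conic_eq k (quad M).
Proof.
move=> MT Mu; have D (v : 'rV[k]_3) : v != 0 -> exists i, (quad M)^`M(i).@[v 0] != 0.
  move=> v0; apply: contrapT => h; have /eqP := mul_unit_neq0 Mu v0; apply.
  apply/rowP => i; rewrite [RHS]mxE; apply/eqP; apply: contrapT => e; apply: h; exists i.
  by rewrite mderiv_quad // mulf_neq0 //; exact/negP.
split; [|exact: quad_homog|by move=> P _; exact: D (rep_neq0 P)].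
have [i hi] := D _ (@delta0_neq0 k).
by apply: contraNneq hi => ->; rewrite mderiv0 meval0.
Qed.

(** Take the basis given by two contact points and the pole of their chord, so that these points
    have parameters 0 and infinity. Double contact there kills the extreme coefficients of the
    restriction, and [sparse_square] shows that the Gram matrix is anti-diagonal, the other four
    contact points being the roots of t^4 + p0. Rescaling t and the basis turns it into [Jmx]. *)
Lemma tangent_classify Q : tangent_conics F Q ->
  exists2 W, unitary W & Q = conicset (W *m E).
Proof.
move=> [q [ns -> /card_ordP [P [Pinj hP]] mult]].
have [_ qhom _] := ns.
have [M MT Eq] := homog2_quad two0 qhom; subst q.
have Mu : M \in unitmx.
  exact: nonsingular_unit.
have PQ i : (zeros (quad M) `&` zeros F) (P i) by apply/hP; exists i.
pose i0 : 'I_6 := inord 0; pose i1 : 'I_6 := inord 1.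
have i01 : i0 != i1 by rewrite -val_eqE /= !inordK.
have [V [alpha [Vu a0 V0 V2 EV]]] : exists V alpha, [/\ V \in unitmx, alpha != 0,
   row 0 V = rep (P i0), pt (row 2%:R V) = pt (rep (P i1)) &
   linear_subst V^T (quad M) = alpha *: conic_form k].
  apply: conic_frame => //; rewrite ?rep_neq0 ?repK //.
  - by move/Pinj/eqP; exact/negP.
  - by have [+ _] := PQ i0; rewrite -{1}[P i0]repK (zeros_pt (quad_homog M)) ?rep_neq0 // meval_quad.
  - by have [+ _] := PQ i1; rewrite -{1}[P i1]repK (zeros_pt (quad_homog M)) ?rep_neq0 // meval_quad.
pose W := V *m invmx E; have EW : W *m E = V by rewrite mulmxKV ?(frame_unit fr).
have Wu : W \in unitmx by rewrite unitmx_mul Vu unitmx_inv (frame_unit fr).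
pose h a b := hermP (row a W) (row b W).
have cX n m : ('X^n : {poly k})`_m = (m == n)%:R by exact: coefXn.
have coefs (f u : {poly k}) : f = 'X^2 * u -> u.[0] != 0 -> [/\ f`_0 = 0, f`_1 = 0 & f`_2 != 0].
  by move=> ->; rewrite !coefXnM /= horner_coef0.
have at0 : [/\ h 0 0 = 0, h 1 0 = 0 & h 2%:R 0 != 0].
  have : has_imult (quad M) F (pt (row 0 V)) 2 by rewrite V0 repK; exact: mult.
  have f0 := par_conic_neq0 char5 fr Wu; move: (f0); rewrite EW => f0'.
  move=> /(conic_imultE fr Vu a0 EV f0') [u u0 Eu].
  have := coefs _ _ Eu u0; rewrite -EW (par_conicE char5 fr) -/h.
  rewrite !(coefD, coefZ, coefC) !cX !coefX /= !(mulr0, mulr1, addr0, add0r).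
  move=> [/eqP + /eqP]; rewrite !mulf_eq0 !(negPf (frame_c fr)) /=.
  by move=> /eqP e0 /eqP e1 e2; split.
(* The point at infinity is brought to parameter 0 by [swapmx]. *)
have atoo : [/\ h 2%:R 2%:R = 0, h 1 2%:R = 0 & h 0 2%:R != 0].
  have Su : swapmx k *m W \in unitmx by rewrite unitmx_mul swap_unit.
  have SVu : swapmx k *m V \in unitmx by rewrite unitmx_mul swap_unit.
  have : has_imult (quad M) F (pt (row 0 (swapmx k *m V))) 2.
    by rewrite row0_swap /cinf -rowE V2 repK; exact: mult.
  have f0 := par_conic_neq0 char5 fr Su; move: (f0); rewrite -mulmxA EW => f0'.
  have ES : linear_subst (swapmx k *m V)^T (quad M) = alpha *: conic_form k.
    by rewrite trmx_mul -linear_substM EV /linear_subst comp_mpolyZ -/(linear_subst _ _) conic_swap.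
  move=> /(conic_imultE fr SVu a0 ES f0') [u u0 Eu].
  have := coefs _ _ Eu u0; rewrite -EW mulmxA (par_conicE char5 fr).
  have rS i j : row i (swapmx k) = delta_mx 0 j -> row i (swapmx k *m W) = row j W.
    by move=> e; rewrite row_mul e -rowE.
  rewrite (rS 0 2%:R) ?(rS 1 1) ?(rS 2%:R 0);
    try by apply/rowP; apply: ord3P; rewrite !mxE.
  rewrite -/h.
  rewrite !(coefD, coefZ, coefC) !cX !coefX /= !(mulr0, mulr1, addr0, add0r).
  move=> [/eqP + /eqP]; rewrite !mulf_eq0 !(negPf (frame_c fr)) /=.
  by move=> /eqP e0 /eqP e1 e2; split.
have P0 : pt (cvec 0 *m V) = P i0.
  rewrite -[RHS]repK -V0 rowE; congr (pt (_ *m _)).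
  by apply/rowP; apply: ord3P; rewrite !mxE //= ?expr0 ?expr0n.
have P1 : pt (cinf k *m V) = P i1 by rewrite /cinf -rowE V2 repK.
have Vq : zeros (quad M) = conicset V.
  by rewrite (cform_of_subst Vu EV) zeros_scale.
(* The four remaining contact points, numbered 2 to 5, have finite nonzero parameters. *)
pose J (i : 'I_4) : 'I_6 := inord i.+2.
have vJ i : J i = i.+2 :> nat by rewrite /J inordK //; exact: (ltn_ord i).
have ex i : exists t, P (J i) = pt (cvec t *m V).
  have [] := PQ (J i); rewrite Vq => /(conicsetP _ Vu) [//|e] _.
  have /Pinj/(congr1 (@nat_of_ord 6)) : P (J i) = P i1 by rewrite e P1.
  by rewrite vJ /= inordK.
have [r hr] := choice ex.
have rinj : injective r.
  move=> i j e; have /Pinj/(congr1 (@nat_of_ord 6)) : P (J i) = P (J j) by rewrite !hr e.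
  by rewrite !vJ => -[] /val_inj.
pose f := par (conic_param k *m map_mx polyC V) F.
have f0 : f != 0 by rewrite /f -EW; exact: (par_conic_neq0 char5 fr Wu).
have rdiv t i : P i = pt (cvec t *m V) -> ('X - t%:P) ^+ 2 %| f.
  move=> e; have sVu : shiftmx t *m V \in unitmx by rewrite unitmx_mul shift_unit.
  have Es : linear_subst (shiftmx t *m V)^T (quad M) = alpha *: conic_form k.
    by rewrite trmx_mul -linear_substM EV /linear_subst comp_mpolyZ -/(linear_subst _ _) conic_shift.
  have ft : par (conic_param k *m map_mx polyC (shiftmx t *m V)) F = f \Po ('X + t%:P).
    by rewrite conic_param_shift par_comp.
  have Ef : f = (f \Po ('X + t%:P)) \Po ('X - t%:P).
    by rewrite -comp_polyA comp_polyD comp_polyX comp_polyC subrK comp_polyXr.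
  have : has_imult (quad M) F (pt (row 0 (shiftmx t *m V))) 2.
    by rewrite row0_shift -e; exact: mult.
  move=> /(conic_imultE fr sVu a0 Es) []; rewrite ft.
    by apply: contraNneq f0 => z; rewrite Ef z comp_poly0.
  move=> u _ Eu; rewrite Ef Eu comp_polyM (rmorphXn (comp_poly _)) /= comp_polyX.
  exact: dvdp_mulr.
have fE : f = c *: (h 0 2%:R *: 'X^10 + h 2%:R 1 *: 'X^7 + h 1 1 *: 'X^6 +
    h 0 1 *: 'X^5 + h 2%:R 0 *: 'X^2).
  rewrite /f -EW (par_conicE char5 fr) -!/(h _ _).
  have [-> -> _] := at0; have [-> -> _] := atoo.
  by rewrite !scale0r polyC0 !addr0 !add0r.
have [p0 p00 [h11 h20 h01 h21]] : exists2 p0, p0 != 0 &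
   [/\ h 1 1 = 2%:R * p0 * h 0 2%:R, h 2%:R 0 = p0 ^+ 2 * h 0 2%:R, h 0 1 = 0 & h 2%:R 1 = 0].
  apply: (sparse_square char5 (rs := [seq r i | i <- enum 'I_4])).
  - by case: atoo.
  - by rewrite map_inj_uniq ?enum_uniq.
  - by rewrite size_map size_enum_ord.
  - apply/mapP => -[i _ ri]; have /Pinj/(congr1 (@nat_of_ord 6)) : P i0 = P (J i) by rewrite hr -ri P0.
    by rewrite vJ /= inordK.
  - move=> _ /mapP [i _ ->]; have := rdiv _ _ (hr i).
    by rewrite fE dvdpZr ?(frame_c fr).
(* With l^4 = -p0 the substitution t -> l t turns t^4 + p0 into a multiple of t^4 - 1; the scalar
   [m] then normalizes the entry (0, 2) of the Gram matrix to 1. *)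
have [h00 h10 h20n] := at0; have [h22 h12 h02n] := atoo.
have [l hl] := closed_root (- p0) (isT : 0 < 4)%N.
have l0 : l != 0 by apply: contra_eq_neq hl => ->; rewrite expr0n eq_sym oppr_eq0.
have [m hm] := closed_root (l ^+ 2 * (p0 ^+ 2 * h 0 2%:R))^-1 (isT : 0 < 6)%N.
have z0 : l ^+ 2 * (p0 ^+ 2 * h 0 2%:R) != 0.
  by rewrite !mulf_neq0 ?expf_neq0.
have m0 : m != 0 by apply: contra_eq_neq hm => ->; rewrite expr0n eq_sym invr_eq0.
have Du := scalemx_unit m0 l0.
exists (scalemx m l *m W).
  have rD i : row i (scalemx m l *m W) = (m * l ^+ i) *: row i W.
    by rewrite /scalemx mul_diag_mx; apply/rowP => j; rewrite !mxE.
  have H a b : hermP (row a (scalemx m l *m W)) (row b (scalemx m l *m W)) =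
      m ^+ 6 * l ^+ (a + 5 * b) * h a b.
    by rewrite !rD hermP_scale exprMn -exprM [(_ * 5)%N]mulnC exprD /h; ring.
  move=> a b; rewrite H; move: a b.
  do 2!apply: ord3P; rewrite !mxE /= ?h00 ?h10 ?h01 ?h12 ?h21 ?h22 ?mulr0 //.
  - rewrite [X in l ^+ X](_ : _ = 4 + 4 + 2)%N // !exprD hl hm.
    by apply: (mulIf z0); rewrite mul1r; field; rewrite h02n l0 p00.
  - rewrite h11 [X in l ^+ X](_ : _ = 4 + 2)%N // !exprD hl hm.
    by apply: (mulIf z0); field; rewrite h02n l0 p00.
  - rewrite h20 [X in l ^+ X](_ : _ = 2)%N // hm; by apply: (mulIf z0); field; rewrite h02n l0 p00.
rewrite -mulmxA EW; have Eq : linear_subst (scalemx m l *m V)^T (quad M) =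
    (alpha * (m ^+ 2 * l ^+ 2)) *: conic_form k.
  rewrite trmx_mul -linear_substM EV /linear_subst comp_mpolyZ -/(linear_subst _ _).
  by rewrite conic_scale scalerA.
have DVu : scalemx m l *m V \in unitmx by rewrite unitmx_mul Du.
by rewrite (cform_of_subst DVu Eq) zeros_scale // !mulf_neq0 ?expf_neq0.
Qed.

End Classification.

(** * Contact points of unitary images of the standard conic *)

Section Converse.

Variables (k : fieldType) (char5 : 5%N \in [pchar k]).
Variables (F : {mpoly k[3]}) (E : 'M[k]_3) (c : k) (fr : frame F E c).
Implicit Types (V W : 'M[k]_3) (q : {mpoly k[3]}).

Let two0 : 2%:R != 0 :> k := @nat_neq0 k char5 2 isT.

Lemma frame_eval y : F.@[(y *m E) 0] = c * hermP y y.
Proof.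
have := congr1 (horner^~ 0) (frame_par fr (map_mx polyC y)).
rewrite horner_par hermP_map -polyCM hornerC => <-; apply: meval_eq => i.
by rewrite -map_mxM !mxE hornerC.
Qed.

Lemma zeros_frame y : y != 0 -> zeros F (pt (y *m E)) <-> hermP y y = 0.
Proof.
move=> y0; rewrite (zeros_pt (frame_homog fr)) ?mul_unit_neq0 ?(frame_unit fr) //.
rewrite frame_eval; split=> [/eqP|->]; last by rewrite mulr0.
by rewrite mulf_eq0 (negPf (frame_c fr)) => /eqP.
Qed.

Lemma par_unitary W : unitary W ->
  par (conic_param k *m map_mx polyC (W *m E)) F = 'X^2 * (c *: ('X^4 - 1) ^+ 2).
Proof.
move=> hW; rewrite (par_conicE char5 fr) !hW !mxE /= !scale0r !scale1r polyC0.
by rewrite -!mul_polyC polyCN polyC_natr; ring.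
Qed.

Lemma swap_unitary : @unitary k (swapmx k).
Proof.
move=> a b; rewrite /hermP; move: a b; do 2!apply: ord3P;
  by rewrite !mxE /= ?(expr1n, expr0n) /=; ring.
Qed.

(** Translations by F_5 and the inversion [swapmx] act transitively on the six contact points. *)
Lemma shift_unitary s : s ^+ 5 = s -> @unitary k (shiftmx s).
Proof.
move=> hs; have five := five0 char5.
have h2 : (s ^+ 2) ^+ 5 = s ^+ 2 by rewrite -exprM mulnC exprM hs.
have h3 : (2%:R * s) ^+ 5 = 2%:R * s.
  by rewrite exprMn hs; congr (_ * _); transitivity (2%:R + 5%:R * 6%:R : k); [ring|rewrite five mul0r addr0].
have e0 (x : k) : 0 ^+ 5 = 0 :> k by rewrite expr0n.
move=> a b; rewrite /hermP; move: a b; do 2!apply: ord3P;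
  rewrite !mxE /= ?h2 ?h3 ?hs ?(e0 0) ?expr1n; try ring.
Qed.

Lemma cform_mul A V : A \in unitmx -> V \in unitmx ->
  linear_subst A^T (conic_form k) = conic_form k -> cform (A *m V) = cform V.
Proof.
move=> hA hV h; have hAV : A *m V \in unitmx by rewrite unitmx_mul hA.
have : linear_subst (A *m V)^T (cform V) = 1 *: conic_form k.
  by rewrite trmx_mul -linear_substM linear_subst_cform // h scale1r.
by move/(cform_of_subst hAV); rewrite scale1r.
Qed.

Lemma unitary_frame_unit W : unitary W -> W *m E \in unitmx.
Proof. by move=> hW; rewrite unitmx_mul (unitary_unit char5 hW) (frame_unit fr). Qed.

Lemma prime_subfieldP (t : k) : t ^+ 5 = t <-> exists2 n, (n < 5)%N & t = n%:R.
Proof.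
have five := five0 char5; split=> [h|[n n5 ->]]; last first.
  have frn : n%:R ^+ 5 = n%:R :> k.
    elim: n {n5} => [|n IH]; first by rewrite expr0n.
    by rewrite -addn1 natrD -[X in (X)^+5]addr0 frob3 // IH expr1n expr0n addr0.
  exact: frn.
have : t * (t - 1) * (t - 2%:R) * (t - 3%:R) * (t - 4%:R) = 0.
  transitivity (t ^+ 5 - t + 5%:R * (- 2%:R * t ^+ 4 + 7%:R * t ^+ 3 - 10%:R * t ^+ 2 + 5%:R * t)).
    by ring.
  by rewrite h subrr five mul0r addr0.
move/eqP; rewrite !mulf_eq0 !subr_eq0 -!orbA.
by case/or4P=> [/eqP->|/eqP->|/eqP->|/orP[]/eqP->];
  [exists 0%N|exists 1%N|exists 2%N|exists 3%N|exists 4%N].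
Qed.

(** The points of P^1(F_5) on the standard conic, the value n = 5 standing for infinity. *)
Definition bvec n : 'rV[k]_3 := if (n < 5)%N then cvec n%:R else cinf k.

Lemma bvec_neq0 n : bvec n != 0.
Proof. by rewrite /bvec; case: ifP; rewrite ?cvec_neq0 ?cinf_neq0. Qed.

(* Every contact point of the conic is the first vector of a unitary frame of it. *)
Lemma bvec_unitary W n : unitary W -> exists2 W', unitary W' &
  row 0 (W' *m E) = bvec n *m (W *m E) /\ cform (W' *m E) = cform (W *m E).
Proof.
move=> hW; have hV := unitary_frame_unit hW; rewrite /bvec; case: ifP => h.
  exists (shiftmx n%:R *m W).
    by apply: unitaryM => //; apply: shift_unitary; apply/prime_subfieldP; exists n.
  by rewrite -mulmxA row0_shift cform_mul ?shift_unit ?conic_shift.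
exists (swapmx k *m W); first by apply: unitaryM => //; exact: swap_unitary.
by rewrite -mulmxA row0_swap cform_mul ?swap_unit ?conic_swap.
Qed.

(** A unitary matrix preserves the form, whose value at parameter t is (t^5 - t)^2; this vanishes
    exactly on F_5, and the form also vanishes at infinity. *)
Lemma contactP W P : unitary W ->
  (conicset (W *m E) `&` zeros F) P <-> exists2 n, (n < 6)%N & P = pt (bvec n *m (W *m E)).
Proof.
move=> hW; have hV := unitary_frame_unit hW; have Wu := unitary_unit char5 hW.
split=> [[/(conicsetP _ hV)]|[n n6 ->]].
  move=> [[t ->]|->]; last by exists 5.
  rewrite mulmxA zeros_frame ?mul_unit_neq0 ?cvec_neq0 // herm_unitary // /hermP !mxE.
  rewrite expr0 mul1r !expr1n expr1 mulr1 => e.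
  have [n n5 ->] : exists2 n, (n < 5)%N & t = n%:R.
    apply/prime_subfieldP/eqP; rewrite -subr_eq0 -sqrf_eq0 -e; apply/eqP; ring.
  by exists n; rewrite ?mulmxA /bvec ?n5 // ltnW.
split; first by apply/(conicsetP _ hV); rewrite /bvec; case: ifP; [left; eexists|right].
rewrite mulmxA zeros_frame ?mul_unit_neq0 ?bvec_neq0 // herm_unitary // /bvec.
case: ifP => n5; rewrite /hermP !mxE /=; last by rewrite !(mul0r, expr0n, mulr0) /=; ring.
have : n%:R ^+ 5 = n%:R :> k by apply/prime_subfieldP; exists n.
move: (n%:R) => t ht; rewrite expr0 expr1 mul1r expr1n mulr1 -exprM mulnC exprM ht.
ring.
Qed.

Lemma natr5_inj a b : (a < 5)%N -> (b < 5)%N -> a%:R = b%:R :> k -> a = b.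
Proof.
wlog ab : a b / (a <= b)%N.
  by move=> H a5 b5 e; case/orP: (leq_total a b) => h; [|symmetry]; apply: H.
move=> a5 b5 /eqP; rewrite eq_sym -subr_eq0 -natrB // => h.
have : (5 %| b - a)%N by rewrite (dvdn_pcharf char5).
move: a5 b5 ab; clear; case: a b => [|[|[|[|[|a]]]]] [|[|[|[|[|b]]]]] //.
Qed.

Lemma bvec_inj W n m : unitary W -> (n < 6)%N -> (m < 6)%N ->
  pt (bvec n *m (W *m E)) = pt (bvec m *m (W *m E)) -> n = m.
Proof.
move=> hW n6 m6; have hV := unitary_frame_unit hW.
case/pt_inj; rewrite ?mul_unit_neq0 ?bvec_neq0 // => d d0.
rewrite scalemxAl => /(can_inj (mulmxK hV)); rewrite /bvec.
case: ifP => n5; case: ifP => m5 /rowP e.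
- have := e 0; rewrite !mxE !expr0 mulr1 => d1.
  by have := e 1; rewrite !mxE -d1 mul1r !expr1; exact: natr5_inj.
- by have /eqP := e 0; rewrite !mxE /= expr0 mulr0 oner_eq0.
- by have := e 0; rewrite !mxE /= expr0 mulr1 => dz; case/eqP: d0; rewrite -dz.
- by move: n5 m5 n6 m6; clear; lia.
Qed.

Definition cformM V : 'M[k]_3 := invmx V *m conicM k *m (invmx V)^T.

Lemma cform_quad V : cform V = quad (cformM V).
Proof. by rewrite /cform -quad_conicM // linear_subst_quad. Qed.

Lemma cformM_sym V : (cformM V)^T = cformM V.
Proof.
rewrite /cformM !trmx_mul trmxK mulmxA; congr (_ *m _ *m _).
by apply/matrixP; do 2!apply: ord3P; rewrite !mxE.
Qed.

Lemma cformM_unit V : V \in unitmx -> cformM V \in unitmx.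
Proof.
move=> hV; have cu : conicM k \in unitmx.
  pose K := mx3 [:: [:: 0; 0; - 2%:R]; [:: 0; 1; 0]; [:: - 2%:R; 0; 0]] : 'M[k]_3.
  suff : conicM k *m K = 1%:M by case/mulmx1_unit.
  by apply/matrixP; do 2!apply: ord3P; rewrite !mxE sum3 !mxE /=; field.
by rewrite !unitmx_mul unitmx_tr unitmx_inv hV cu.
Qed.

Lemma tangent_conicset W : unitary W -> tangent_conics F (conicset (W *m E)).
Proof.
move=> hW; have hV := unitary_frame_unit hW; exists (cform (W *m E)); split=> //.
- by rewrite cform_quad; apply: nonsingular_quad; rewrite ?cformM_sym ?cformM_unit.
- apply/card_ordP; exists (fun i : 'I_6 => pt (bvec i *m (W *m E))); split.
    by move=> i j /(bvec_inj hW (ltn_ord i) (ltn_ord j)) /val_inj.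
  move=> P; split=> [/(contactP _ hW) [n n6 ->]|[i ->]]; first by exists (Ordinal n6).
  by apply/(contactP _ hW); exists i.
move=> P /(contactP _ hW) [n n6 ->].
have [W' hW' [<- Ec]] := bvec_unitary n hW.
have hV' := unitary_frame_unit hW'.
apply: (conic_imult fr hV' (oner_neq0 _) _ (par_unitary hW')).
  by rewrite scale1r -Ec linear_subst_cform.
rewrite hornerZ mulf_neq0 ?(frame_c fr) //.
rewrite !(hornerE, hornerXn) expr0n /= sub0r sqrrN expr1n oner_neq0 //.
Qed.

(** In the basis [W *m E] the tangent at the first basis point is x2 = 0, and on its points (1, t,
    0) the form is -2 t^6. With [bvec_unitary] this makes all contact points Weierstrass points. *)
Lemma weierstrass_unitary W : unitary W -> weierstrass F (pt (row 0 (W *m E))).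
Proof.
move=> hW; have hV := unitary_frame_unit hW; pose V := W *m E.
have r0 := row_neq0 0 hV; have rW := row_neq0 0 (unitary_unit char5 hW).
split; first by rewrite row_mul zeros_frame // hW !mxE.
apply: has_imult_sym; have [d d0 hd] := coords_pt r0.
have hT : linear_subst V^T (tangent_form F (pt (row 0 V))) = (c * d ^+ 5) *: 'X_2%:R.
  rewrite /tangent_form /linear_subst raddf_sum /=.
  transitivity (\sum_i \sum_j ((F^`M(i)).@[((d *: row 0 W) *m E) 0] * V j i) *: 'X_j : {mpoly k[3]}).
    apply: eq_bigr => i _; rewrite comp_mpolyZ -/(linear_subst _ _) linear_substX scaler_sumr.
    apply: eq_bigr => j _; rewrite mxE scalerA; congr ((_ * _) *: _); apply: meval_eq => l.
    by rewrite hd -scalemxAl -row_mul !mxE.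
  rewrite exchange_big /= (eq_bigr (fun j => (c * d ^+ 5 * Jmx k j 0) *: 'X_j)); last first.
    move=> j _; rewrite -scaler_suml; congr (_ *: _).
    transitivity (\sum_i (F^`M(i)).@[((d *: row 0 W) *m E) 0] * (row j W *m E) 0 i).
      by apply: eq_bigr => i _; rewrite -row_mul [row _ _ _ _]mxE.
    rewrite (frame_tangent fr) -[row j W]scale1r hermP_scale hW; ring.
  by rewrite sum3 !mxE /= !mulr0 !scale0r mulr1 !add0r.
apply: (has_imult_standard (@line_normal k) (u := (- 2%:R * c)%:P) hV _ _ _ _ _ hT d0 _ (frame_homog fr));
  rewrite ?line_paramE //.
- by rewrite hornerC.
- by rewrite parX line_paramE.
- by rewrite mulf_neq0 ?expf_neq0 ?(frame_c fr).
- by move=> i; rewrite hd mxE.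
- rewrite map_mxM mulmxA (frame_par fr) hermP_mul; last first.
    by rewrite -polyC_natr (five0 char5) polyC0.
  rewrite !sum3 -!map_row !hermP_map !hW !line_paramE !mxE /= polyC0 expr1n expr0n /=.
  by rewrite polyCM polyCN polyC_natr; ring.
- by rewrite hornerC mulf_neq0 ?oppr_eq0 ?(frame_c fr).
Qed.

End Converse.

Local Open Scope nat_scope.

(** * Computable arithmetic of F_25 and the 126 isotropic points *)

Inductive f5 := F0 | F1 | F2 | F3 | F4.

Definition succ5 a := match a with F0 => F1 | F1 => F2 | F2 => F3 | F3 => F4 | F4 => F0 end.
Definition add5 a b := match a with
  F0 => b | F1 => succ5 b | F2 => succ5 (succ5 b) | F3 => succ5 (succ5 (succ5 b))
  | F4 => succ5 (succ5 (succ5 (succ5 b))) end.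
Definition mul5 a b := match a with
  F0 => F0 | F1 => b | F2 => add5 b b | F3 => add5 b (add5 b b)
  | F4 => add5 b (add5 b (add5 b b)) end.
Definition opp5 a := mul5 F4 a.
Definition inv5 a := match a with F2 => F3 | F3 => F2 | _ => a end.
Definition eqb5 a b := match a, b with
  F0, F0 | F1, F1 | F2, F2 | F3, F3 | F4, F4 => true | _, _ => false end.

(* [(a, b)] stands for [a + b s], where [s ^ 2 = 2]. *)
Definition f25 := (f5 * f5)%type.
Definition zero25 : f25 := (F0, F0).
Definition one25 : f25 := (F1, F0).
Definition add25 (x y : f25) : f25 := (add5 x.1 y.1, add5 x.2 y.2).
Definition mul25 (x y : f25) : f25 :=
  (add5 (mul5 x.1 y.1) (mul5 F2 (mul5 x.2 y.2)), add5 (mul5 x.1 y.2) (mul5 x.2 y.1)).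
Definition opp25 (x : f25) : f25 := (opp5 x.1, opp5 x.2).
Definition conj25 (x : f25) : f25 := (x.1, opp5 x.2).
Definition inv25 (x : f25) : f25 :=
  let n := inv5 (add5 (mul5 x.1 x.1) (mul5 F3 (mul5 x.2 x.2))) in
  (mul5 n x.1, mul5 n (opp5 x.2)).
Definition eqb25 (x y : f25) := eqb5 x.1 y.1 && eqb5 x.2 y.2.
Definition is0 (x : f25) := eqb25 x zero25.

Definition v3 := (f25 * f25 * f25)%type.
Definition m3 := (v3 * v3 * v3)%type.
Definition eqbv (x y : v3) := [&& eqb25 x.1.1 y.1.1, eqb25 x.1.2 y.1.2 & eqb25 x.2 y.2].
Definition zscale (a : f25) (x : v3) : v3 := (mul25 a x.1.1, mul25 a x.1.2, mul25 a x.2).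
Definition vadd (x y : v3) : v3 := (add25 x.1.1 y.1.1, add25 x.1.2 y.1.2, add25 x.2 y.2).
Definition vmul (x : v3) (m : m3) : v3 :=
  vadd (vadd (zscale x.1.1 m.1.1) (zscale x.1.2 m.1.2)) (zscale x.2 m.2).
Definition herm25 (x y : v3) : f25 :=
  add25 (add25 (mul25 x.1.1 (conj25 y.2)) (mul25 x.2 (conj25 y.1.1)))
    (mul25 (F3, F0) (mul25 x.1.2 (conj25 y.1.2))).
Definition dot (x y : v3) : f25 :=
  add25 (add25 (mul25 x.1.1 y.1.1) (mul25 x.1.2 y.1.2)) (mul25 x.2 y.2).
Definition sub25 x y := add25 x (opp25 y).
Definition cross (x y : v3) : v3 :=
  (sub25 (mul25 x.1.2 y.2) (mul25 x.2 y.1.2),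
   sub25 (mul25 x.2 y.1.1) (mul25 x.1.1 y.2),
   sub25 (mul25 x.1.1 y.1.2) (mul25 x.1.2 y.1.1)).
Definition pivot (x : v3) : f25 :=
  if is0 x.1.1 then if is0 x.1.2 then x.2 else x.1.2 else x.1.1.
Definition normalize (x : v3) : v3 := zscale (inv25 (pivot x)) x.

Definition all5 := [:: F0; F1; F2; F3; F4].
Definition all25 : seq f25 := [seq (a, b) | b <- all5, a <- all5].
(** The isotropic points of P^2(F_25), with first nonzero coordinate 1. Number 0 is (1, 0, 0) and
    number 125, the last one, is (0, 0, 1). *)
Definition pts : seq v3 :=
  [seq x <- [seq (one25, a, b) | a <- all25, b <- all25] ++
            [seq (zero25, one25, a) | a <- all25] ++ [:: (zero25, zero25, one25)]
   | is0 (herm25 x x)].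
Definition p0 : v3 := (one25, zero25, zero25).
Definition ptv x := nth p0 pts x.
Definition ptindex (x : v3) : nat := find (eqbv (normalize x)) pts.

Definition unitary25 (m : m3) :=
  [&& eqb25 (herm25 m.1.1 m.1.1) zero25, eqb25 (herm25 m.1.1 m.1.2) zero25,
      eqb25 (herm25 m.1.1 m.2) one25, eqb25 (herm25 m.1.2 m.1.1) zero25,
      eqb25 (herm25 m.1.2 m.1.2) (F3, F0), eqb25 (herm25 m.1.2 m.2) zero25,
      eqb25 (herm25 m.2 m.1.1) one25, eqb25 (herm25 m.2 m.1.2) zero25 &
      eqb25 (herm25 m.2 m.2) zero25].

Lemma all25P (P : f25 -> bool) : all P all25 -> forall x, P x.
Proof. by move=> /= /and5P [? ? ? ? /and5P [? ? ? ? /and5P [? ? ? ? /and5P [? ? ? ? /and5P [? ? ? ? /and5P [? ? ? ? /andP [? _]]]]]]] [[] []]. Qed.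

Lemma eqb5P x y : reflect (x = y) (eqb5 x y).
Proof. by move: x y => [] []; constructor. Qed.

Lemma eqb25P x y : reflect (x = y) (eqb25 x y).
Proof.
rewrite /eqb25; case: x y => [a b] [a' b'] /=.
case: eqb5P => [->|ne] /=; last by constructor=> -[].
by case: eqb5P => [->|ne]; constructor=> // -[].
Qed.

Lemma eqbvP x y : reflect (x = y) (eqbv x y).
Proof.
rewrite /eqbv; case: x y => [[a b] c] [[a' b'] c'] /=.
case: eqb25P => [->|ne] /=; last by constructor=> -[].
case: eqb25P => [->|ne] /=; last by constructor=> -[].
by case: eqb25P => [->|ne]; constructor=> // -[].
Qed.

HB.instance Definition _ := hasDecEq.Build f5 eqb5P.

Local Open Scope ring_scope.

(** * The embedding of F_25 in the ground field *)

Section Embedding.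

Variables (k : fieldType) (char5 : 5%N \in [pchar k]) (s : k).
Hypothesis s2 : s ^+ 2 = 2%:R.

Let five : 5%:R = 0 :> k := five0 char5.

Definition iota5 (a : f5) : k :=
  match a with F0 => 0 | F1 => 1 | F2 => 2%:R | F3 => 3%:R | F4 => 4%:R end.

Definition em (x : f25) : k := iota5 x.1 + iota5 x.2 * s.

Lemma iota5S a : iota5 (succ5 a) = 1 + iota5 a.
Proof.
by case: a => /=; rewrite ?addr0 //; ring.
Qed.

Lemma iota5D a b : iota5 (add5 a b) = iota5 a + iota5 b.
Proof. by case: a => /=; rewrite ?iota5S; ring. Qed.

Lemma iota5M a b : iota5 (mul5 a b) = iota5 a * iota5 b.
Proof. by case: a => /=; rewrite ?iota5D; ring. Qed.

Lemma iota5N a : iota5 (opp5 a) = - iota5 a.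
Proof.
rewrite /opp5 iota5M /=; transitivity (- iota5 a + 5%:R * iota5 a); first by ring.
by rewrite five mul0r addr0.
Qed.

Lemma em0 : em zero25 = 0. Proof. by rewrite /em /= mul0r addr0. Qed.
Lemma em1 : em one25 = 1. Proof. by rewrite /em /= mul0r addr0. Qed.

Lemma emD x y : em (add25 x y) = em x + em y.
Proof. by rewrite /em /= !iota5D; ring. Qed.

Lemma emM x y : em (mul25 x y) = em x * em y.
Proof.
rewrite /em /= !(iota5D, iota5M).
transitivity (iota5 x.1 * iota5 y.1 + s ^+ 2 * (iota5 x.2 * iota5 y.2) +
  (iota5 x.1 * iota5 y.2 + iota5 x.2 * iota5 y.1) * s); last by ring.
by rewrite s2; ring.
Qed.

Lemma emN x : em (opp25 x) = - em x.
Proof. by rewrite /em !iota5N; ring. Qed.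

Lemma emB x y : em (sub25 x y) = em x - em y.
Proof. by rewrite /sub25 emD emN. Qed.

Lemma emconj x : em (conj25 x) = em x ^+ 5.
Proof.
have f a : iota5 a ^+ 5 = iota5 a.
  by apply/(prime_subfieldP char5); case: a; [exists 0|exists 1|exists 2|exists 3|exists 4].
have h := @frob3 k (iota5 x.1) (iota5 x.2 * s) 0 five.
rewrite expr0n !addr0 in h; rewrite /em h exprMn !f iota5N.
have -> : s ^+ 5 = 4%:R * s.
  by transitivity ((s ^+ 2) ^+ 2 * s); [ring|rewrite s2; ring].
transitivity (iota5 x.1 - iota5 x.2 * s + 5%:R * (iota5 x.2 * s)); last by ring.
by rewrite five mul0r addr0 mulNr.
Qed.

Lemma inv25K x : is0 x = false -> mul25 x (inv25 x) = one25.
Proof.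
have /implyP h := all25P (P := fun x => ~~ is0 x ==> eqb25 (mul25 x (inv25 x)) one25) isT x.
by move=> /negbT /h /eqb25P.
Qed.

Lemma em_neq0 x : is0 x = false -> em x != 0.
Proof.
move=> /inv25K /(congr1 em); rewrite emM em1 => e.
by apply/eqP => z; move/eqP: e; rewrite z mul0r eq_sym oner_eq0.
Qed.

Lemma em_eq0 x : (em x == 0) = is0 x.
Proof.
case h : (is0 x); last by apply/negbTE; exact: em_neq0.
by move/eqb25P: h => ->; rewrite em0 eqxx.
Qed.

Lemma emV x : em (inv25 x) = (em x)^-1.
Proof.
case h : (is0 x).
  by move/eqb25P: h => ->; rewrite (_ : inv25 _ = zero25) // em0 invr0.
have x0 := em_neq0 h; apply: (mulfI x0); rewrite -emM inv25K // em1 mulfV //.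
Qed.

Lemma em_inj : injective em.
Proof.
move=> x y e; have : is0 (sub25 x y) by rewrite -em_eq0 emB e subrr.
by move: x y {e} => [[] []] [[] []].
Qed.

(** The image already consists of 25 roots of X^25 - X, so one more root would exceed the degree. *)
Lemma em_onto (x : k) : x ^+ 25 = x -> exists z, x = em z.
Proof.
move=> hx; apply: contrapT => h.
pose p : {poly k} := 'X^25 - 'X.
have sp : size p = 26%N.
  by rewrite size_polyDl size_polyXn // size_polyN size_polyX.
have p0 : p != 0 by rewrite -size_poly_eq0 sp.
have rs : all (root p) (x :: map em all25).
  have r y : y ^+ 25 = y -> root p y.
    by move=> e; rewrite /root /p !(hornerE, hornerXn) e subrr.
  apply/allP => y; rewrite inE => /orP [/eqP ->|/mapP [z _ ->]]; apply: r => //.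
  by rewrite (exprM _ 5 5) -!emconj; congr em; case: z => [[] []].
have ur : uniq (x :: map em all25).
  rewrite cons_uniq (map_inj_uniq em_inj) andbT; apply/mapP => -[z _ e].
  by apply: h; exists z.
by have := max_poly_roots p0 rs ur; rewrite sp.
Qed.

End Embedding.

(** * The explicit data: unitary matrices, base component, action on the 150 blocks *)

Local Open Scope nat_scope.

(** A matrix is listed by the positions of its entries in [all25], where position a + 5b holds a + b
    s. *)
Definition mx9 (l : seq nat) : m3 :=
  let c i := nth zero25 all25 (nth 0 l i) in
  ((c 0, c 1, c 2), (c 3, c 4, c 5), (c 6, c 7, c 8)).

(** The anti-diagonal swap, two diagonal matrices and a unipotent one. The last three fix the point
    (1, 0, 0). *)
Definition gens : seq m3 := [seq mx9 l | l <- [::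
  [:: 0; 0; 1; 0; 1; 0; 1; 0; 0];
  [:: 7; 0; 0; 0; 1; 0; 0; 0; 16];
  [:: 1; 0; 0; 0; 18; 0; 0; 0; 1];
  [:: 1; 0; 0; 1; 1; 0; 4; 3; 1]]].

(** Unitary matrices preserving the partition given by [lab0] and, together, transitive on its 21
    parts. *)
Definition stabs : seq m3 := [seq mx9 l | l <- [::
  [:: 20; 0; 1; 0; 1; 0; 4; 0; 5];
  [:: 9; 3; 1; 1; 1; 0; 9; 10; 20]]].

(** The base component of [G]: its conics have disjoint contact sets, and point x is on the conic
    with label [nth 0 lab0 x]. Label 0 is the standard conic and labels 1 to 10 are its
    neighbours. *)
Definition lab0 : seq nat := [::
  0; 2; 1; 2; 1; 0; 4; 3; 4; 3; 0; 10; 9; 10; 9; 0; 7; 5; 7; 5; 0; 8; 6; 8;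
  6; 19; 18; 3; 8; 15; 2; 19; 18; 11; 9; 13; 5; 4; 18; 11; 11; 13; 15; 6; 10;
  1; 7; 13; 15; 19; 17; 20; 5; 10; 16; 12; 6; 7; 20; 14; 1; 8; 12; 16; 17; 2;
  17; 20; 14; 3; 14; 12; 16; 9; 4; 17; 16; 9; 7; 20; 12; 14; 20; 5; 8; 2; 17;
  16; 12; 6; 1; 4; 14; 20; 17; 14; 3; 10; 16; 12; 19; 15; 6; 4; 18; 1; 10;
  11; 18; 19; 13; 11; 18; 3; 7; 11; 9; 8; 15; 13; 2; 19; 15; 13; 5; 0].

(** The action of the four generators on the indices of the 150 blocks. *)
Definition sig : seq (seq nat) := [::
[::
  0; 1; 2; 3; 9; 5; 14; 7; 18; 4; 24; 22; 30; 33; 6; 15; 37; 42; 8; 19; 47;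
  53; 11; 58; 10; 61; 60; 67; 56; 72; 12; 45; 73; 13; 34; 79; 83; 16; 88; 39;
  40; 86; 17; 75; 50; 31; 97; 20; 100; 49; 44; 98; 101; 21; 77; 108; 28; 113;
  23; 87; 26; 25; 93; 118; 104; 116; 66; 27; 68; 80; 70; 84; 29; 32; 127; 43;
  125; 54; 128; 35; 69; 81; 99; 36; 71; 133; 41; 59; 38; 89; 135; 91; 121;
  62; 119; 123; 120; 46; 51; 82; 48; 52; 102; 110; 64; 105; 106; 141; 55;
  109; 103; 134; 143; 57; 146; 115; 65; 138; 63; 94; 96; 92; 122; 95; 124;
  76; 132; 74; 78; 129; 140; 131; 126; 85; 111; 90; 149; 137; 117; 139; 130;
  107; 147; 112; 144; 148; 114; 142; 145; 136];
[::
  1; 2; 3; 5; 10; 7; 15; 0; 19; 21; 25; 26; 31; 34; 36; 37; 39; 43; 46; 47;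
  49; 54; 55; 45; 22; 62; 63; 68; 65; 73; 24; 75; 53; 78; 79; 81; 59; 84; 83;
  86; 87; 89; 77; 93; 94; 61; 52; 57; 97; 98; 103; 102; 106; 11; 44; 110;
  112; 107; 42; 91; 56; 60; 119; 72; 9; 32; 101; 121; 80; 122; 74; 41; 4; 17;
  115; 50; 92; 108; 123; 117; 128; 67; 129; 16; 111; 120; 132; 71; 40; 38;
  133; 134; 69; 118; 29; 138; 135; 20; 114; 139; 66; 113; 48; 143; 12; 14;
  141; 144; 28; 127; 64; 105; 30; 51; 8; 82; 23; 125; 116; 104; 147; 13; 95;
  137; 99; 131; 88; 124; 35; 140; 70; 33; 6; 148; 126; 136; 145; 76; 27; 130;
  109; 146; 85; 58; 18; 90; 100; 149; 142; 96];
[::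
  2; 3; 5; 7; 11; 0; 16; 1; 20; 22; 26; 28; 25; 35; 37; 39; 41; 44; 47; 49;
  51; 55; 56; 43; 60; 63; 65; 69; 58; 21; 61; 62; 77; 79; 81; 27; 84; 86; 87;
  89; 91; 88; 50; 94; 64; 93; 57; 98; 101; 102; 104; 100; 107; 108; 110; 112;
  23; 114; 75; 111; 116; 118; 72; 32; 24; 42; 106; 80; 122; 123; 124; 126;
  53; 54; 99; 119; 33; 103; 117; 67; 95; 68; 130; 71; 132; 90; 38; 134; 59;
  40; 96; 105; 78; 29; 9; 76; 85; 113; 48; 140; 52; 141; 66; 12; 10; 15; 144;
  8; 143; 115; 30; 6; 45; 146; 97; 139; 17; 121; 73; 4; 133; 128; 137; 125;
  129; 13; 36; 82; 138; 70; 127; 34; 83; 135; 14; 120; 147; 131; 92; 109; 74;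
  18; 145; 31; 19; 149; 46; 148; 136; 142];
[::
  0; 4; 6; 8; 12; 13; 14; 17; 18; 23; 27; 29; 32; 33; 38; 40; 9; 45; 48; 50;
  52; 24; 57; 59; 7; 64; 66; 70; 71; 74; 37; 76; 58; 80; 82; 49; 85; 87; 88;
  90; 92; 61; 10; 95; 96; 21; 97; 99; 100; 41; 26; 105; 34; 109; 111; 93;
  102; 104; 1; 115; 117; 72; 46; 103; 116; 113; 120; 53; 36; 5; 125; 84; 35;
  124; 112; 11; 67; 127; 47; 22; 69; 55; 122; 131; 119; 83; 79; 73; 2; 107;
  91; 63; 136; 137; 56; 134; 60; 108; 132; 101; 3; 128; 142; 39; 86; 140;
  123; 51; 145; 31; 146; 106; 75; 43; 118; 16; 77; 138; 135; 147; 19; 15; 20;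
  143; 30; 42; 141; 25; 78; 129; 98; 68; 126; 133; 65; 110; 121; 148; 44;
  139; 89; 130; 144; 54; 94; 62; 114; 28; 81; 149]].

(** A spanning tree for this action, rooted at 0: the entry at position i - 1 is a pair (g, p) with
    p < i such that generator g sends block p to block i. *)
Definition par_tree : seq (nat * nat) := [::
  (1, 0); (2, 0); (2, 1); (3, 1); (2, 2); (3, 2); (2, 3); (3, 3); (0, 4);
  (1, 4); (2, 4); (3, 4); (3, 5); (0, 6); (1, 6); (2, 6); (3, 7); (0, 8);
  (1, 8); (2, 8); (1, 9); (2, 9); (3, 9); (0, 10); (1, 10); (2, 10); (3, 10);
  (2, 11); (3, 11); (0, 12); (1, 12); (3, 12); (0, 13); (1, 13); (2, 13);
  (1, 14); (2, 14); (3, 14); (2, 15); (3, 15); (2, 16); (0, 17); (1, 17);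
  (2, 17); (3, 17); (1, 18); (2, 18); (3, 18); (2, 19); (3, 19); (2, 20);
  (3, 20); (0, 21); (1, 21); (2, 21); (2, 22); (3, 22); (0, 23); (3, 23);
  (2, 24); (0, 25); (1, 25); (2, 25); (3, 25); (2, 26); (3, 26); (0, 27);
  (1, 27); (2, 27); (3, 27); (3, 28); (0, 29); (1, 29); (3, 29); (1, 31);
  (3, 31); (2, 32); (1, 33); (2, 33); (3, 33); (2, 34); (3, 34); (0, 36);
  (2, 36); (3, 36); (2, 37); (3, 37); (0, 38); (2, 39); (3, 39); (2, 40);
  (3, 40); (1, 43); (2, 43); (3, 43); (3, 44); (0, 46); (2, 47); (3, 47);
  (0, 48); (2, 48); (2, 49); (1, 50); (2, 50); (3, 51); (1, 52); (2, 52);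
  (2, 53); (3, 53); (2, 54); (3, 54); (2, 55); (0, 57); (2, 57); (3, 59);
  (2, 60); (3, 60); (2, 61); (1, 62); (3, 66); (1, 67); (2, 68); (2, 69);
  (2, 70); (3, 70); (2, 71); (0, 74); (0, 78); (1, 82); (2, 82); (3, 83);
  (2, 84); (0, 85); (2, 87); (0, 90); (3, 92); (3, 93); (1, 95); (1, 99);
  (2, 99); (2, 101); (3, 102); (1, 103); (2, 106); (3, 108); (3, 110);
  (3, 119); (1, 133); (0, 136)].

(** * Derived tables and the checks to be evaluated *)

Definition pull (l p : seq nat) := [seq nth 0 l x | x <- p].
Definition inv_perm (p : seq nat) := [seq index x p | x <- iota 0 (size p)].
Definition inverse_pair n (p q : seq nat) :=
  [&& size p == n, size q == n,
      all (fun x => (nth 0 p x < n) && (nth 0 q (nth 0 p x) == x)) (iota 0 n) &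
      all (fun x => (nth 0 q x < n) && (nth 0 p (nth 0 q x) == x)) (iota 0 n)].

Definition ptperm (m : m3) : seq nat := [seq ptindex (vmul x m) | x <- pts].
Definition gperms := [seq ptperm m | m <- gens].
Definition ginvs := [seq inv_perm p | p <- gperms].
Definition siginvs := [seq inv_perm p | p <- sig].

(** Propagates a row attached to block 0 to all 150 blocks along [par_tree]. It produces both the
    labellings [labs] and the table of types [tab]. *)
Definition grow (f : seq nat) (ps : seq (seq nat)) : seq (seq nat) :=
  foldl (fun acc gp => rcons acc (pull (nth [::] acc gp.2) (nth [::] ps gp.1))) [:: f] par_tree.

Definition labs := grow lab0 ginvs.

(** Only the partition of the points matters, not the names of the labels; [t] is the renaming from
    the labels of [l2] to those of [l1]. *)
Definition same_fibres (l1 l2 : seq nat) :=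
  let t := [seq nth 0 l1 (index l l2) | l <- iota 0 21] in
  [&& uniq t, all (fun b => b < 21) l2 & all2 (fun a b => nth 0 t b == a) l1 l2].

Definition check_perms :=
  [&& size pts == 126, all unitary25 (stabs ++ gens),
   all (fun p => inverse_pair 126 p (inv_perm p)) ([seq ptperm m | m <- stabs] ++ gperms),
   all (fun p => inverse_pair 150 p (inv_perm p)) sig &
   [&& size labs == 150, size gens == 4, size sig == 4,
       all (fun l => (size l == 126) && all (fun y => y < 21) l) labs &
       all (fun l => l \in lab0) (iota 0 21)]].
Definition check_tree :=
  all (fun i => let gp := nth (0, 0) par_tree i.-1 in
    [&& gp.1 < 4, gp.2 < i & nth 0 (nth [::] sig gp.1) gp.2 == i]) (iota 1 149).

Definition check_sig :=
  all (fun g => all (fun i =>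
    same_fibres (pull (nth [::] labs i) (nth [::] ginvs g))
                (nth [::] labs (nth 0 (nth [::] sig g) i))) (iota 0 150)) (iota 0 4).

(** One breadth-first step of an orbit computation on bit masks. The lists [qs] are the inverses of
    the acting permutations, so a point is reached when one of its preimages is. *)
Definition mask_step (qs : seq (seq nat)) (s : bitseq) : bitseq :=
  [seq nth false s y || has (fun q => nth false s (nth 0 q y)) qs | y <- iota 0 (size s)].
Definition reach (qs : seq (seq nat)) n x r : bitseq :=
  iter r (mask_step qs) [seq y == x | y <- iota 0 n].

Definition bvec25 n : v3 :=
  nth (zero25, zero25, one25) [seq (one25, (t, F0), (mul5 t t, F0)) | t <- all5] n.

Definition label_perm (m : m3) : seq nat :=
  let p := ptperm m in [seq nth 0 lab0 (nth 0 p (index l lab0)) | l <- iota 0 21].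
Definition nb_labels := iota 1 10.

(** The bound 11 says that each matrix of [stabs] sends the standard conic to itself or to one of
    its neighbours; this links the 21 conics inside [G]. *)
Definition check_base :=
  let lps := [seq label_perm m | m <- stabs] in
  [&& all (fun m => same_fibres (pull lab0 (inv_perm (ptperm m))) lab0) stabs,
   all (fun p => inverse_pair 21 p (inv_perm p) && (nth 0 p 0 < 11)) lps,
   all id (reach [seq inv_perm p | p <- lps] 21 0 20) &
   let bs := [seq ptindex (bvec25 n) | n <- iota 0 6] in
   all (fun x => (nth 0 lab0 x == 0) == (x \in bs)) (iota 0 126)].

Definition base_pairs := [seq ab <- [seq (a, b) | a <- iota 0 6, b <- iota 0 6] | ab.1 < ab.2].
Definition normal25 (ab : nat * nat) : v3 := cross (bvec25 ab.1) (bvec25 ab.2).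
Definition line_pts ab := [seq x <- iota 0 126 | is0 (dot (normal25 ab) (ptv x))].

(** The conic through five points: the member through the fifth of the pencil spanned by two line
    pairs through the first four. *)
Definition conic5 (p : seq nat) (y : v3) : f25 :=
  let q i := ptv (nth 0 p i) in
  let L i j := cross (q i) (q j) in
  sub25
    (mul25 (mul25 (dot (L 0 2) (q 4)) (dot (L 1 3) (q 4))) (mul25 (dot (L 0 1) y) (dot (L 2 3) y)))
    (mul25 (mul25 (dot (L 0 1) (q 4)) (dot (L 2 3) (q 4))) (mul25 (dot (L 0 2) y) (dot (L 1 3) y))).
Definition qmul (x y : v3) : seq f25 :=
  [:: mul25 x.1.1 y.1.1; add25 (mul25 x.1.1 y.1.2) (mul25 x.1.2 y.1.1);
      add25 (add25 (mul25 x.1.1 y.2) (mul25 x.1.2 y.1.2)) (mul25 x.2 y.1.1);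
      add25 (mul25 x.1.2 y.2) (mul25 x.2 y.1.2); mul25 x.2 y.2].
(** Coefficients of the restriction of [conic5 p] to (1, t, t^2), by increasing degree. The roots
    are the intersections with the standard conic. *)
Definition quartic (p : seq nat) : seq f25 :=
  let q i := ptv (nth 0 p i) in
  let L i j := cross (q i) (q j) in
  let a := mul25 (dot (L 0 2) (q 4)) (dot (L 1 3) (q 4)) in
  let b := mul25 (dot (L 0 1) (q 4)) (dot (L 2 3) (q 4)) in
  let u := qmul (L 0 1) (L 2 3) in
  let v := qmul (L 0 2) (L 1 3) in
  [seq sub25 (mul25 a (nth zero25 u i)) (mul25 b (nth zero25 v i)) | i <- iota 0 5].
Definition horner25 (c : seq f25) (t : f25) := foldr (fun a r => add25 a (mul25 t r)) zero25 c.
Definition deriv4 (c : seq f25) : seq f25 :=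
  let n i := nth zero25 c i in
  [:: n 1; mul25 (F2, F0) (n 2); mul25 (F3, F0) (n 3); mul25 (F4, F0) (n 4)].
(** Roots are taken on the projective line: a zero coefficient of t^4 is a root at infinity, and
    zero coefficients of t^4 and t^3 make it a double root. *)
Definition root_count (c : seq f25) :=
  count (fun t => is0 (horner25 c t)) all25 + is0 (nth zero25 c 4).
Definition double_root (c : seq f25) :=
  has (fun t => is0 (horner25 c t) && is0 (horner25 (deriv4 c) t)) all25 ||
  is0 (nth zero25 c 4) && is0 (nth zero25 c 3).

Definition common_lines (lps : seq (seq nat)) l :=
  count (fun lp => 1 < count (fun y => y == l) lp) lps.
Definition fibre (lab : seq nat) l := [seq x <- iota 0 126 | nth 0 lab x == l].
Definition check_conic (p : seq nat) (nb : bool) :=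
  [&& all (fun x => is0 (conic5 p (ptv x))) p,
      has (fun a => ~~ is0 a) (quartic p) &
      if nb then 4 <= root_count (quartic p) else double_root (quartic p)].
(** Every coded conic is compared with the standard one, and the intersection is examined only if
    exactly three secants are common. Four roots then certify a neighbour; a double root certifies
    fewer than four intersection points. *)
Definition check_nbr :=
  all (fun j => let lab := nth [::] labs j in
    let lps := [seq pull lab (line_pts ab) | ab <- base_pairs] in
    all (fun l => let nb := (j == 0) && (l \in nb_labels) in
      if common_lines lps l == 3 then check_conic (fibre lab l) nb else ~~ nb) (iota 0 21))
  (iota 0 150).

Definition omega25 : f25 := nth zero25 all25 7.
Definition pow25 (x : f25) n := iter n (mul25 x) one25.
(** The element [omega25] generates the multiplicative group of F_25, and 3 + 3 s, at position 18,
    the group of elements of norm 1. They are the entries of the two diagonal generators. *)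
Definition check_torus :=
  [&& all (fun x => is0 x || has (fun n => eqb25 x (pow25 omega25 n)) (iota 0 24)) all25 &
      all (fun x => ~~ eqb25 (mul25 x (conj25 x)) one25 ||
        has (fun n => eqb25 x (pow25 (nth zero25 all25 18) n)) (iota 0 24)) all25].

Definition check_lines :=
  all (fun ab => all (fun c => is0 (dot (normal25 ab) (bvec25 c)) == (c == ab.1) || (c == ab.2))
    (iota 0 6)) base_pairs.

Definition tcond (t : ttype) (m : nat -> nat) : bool :=
  match t with
  | t_alpha => (m 2 == 3) && (m 0 == 18)
  | t_beta => [&& m 2 == 1, m 1 == 4 & m 0 == 16]
  | t_gamma => (m 1 == 6) && (m 0 == 15)
  end.
Definition Tcond (T : Ttype) (ms : seq (nat -> nat)) : bool :=
  match T with
  | T_beta21 => all (tcond t_beta) ms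
  | T_gamma21 => all (tcond t_gamma) ms
  | T_alpha15_gamma6 => (count (tcond t_alpha) ms == 15) && (count (tcond t_gamma) ms == 6)
  | T_alpha3_gamma18 => (count (tcond t_alpha) ms == 3) && (count (tcond t_gamma) ms == 18)
  end.
Definition meets (lab blk : seq nat) : seq nat :=
  let ls := pull lab blk in [seq count (fun y => y == l) ls | l <- iota 0 21].
Definition profile lab blk : nat -> nat :=
  let ms := meets lab blk in
  let c0 := count (fun y => y == 0) ms in let c1 := count (fun y => y == 1) ms in
  let c2 := count (fun y => y == 2) ms in nth 0 [:: c0; c1; c2].
Definition all_T := [:: T_beta21; T_gamma21; T_alpha15_gamma6; T_alpha3_gamma18].
Definition Tflags j :=
  let ms := [seq profile (nth [::] labs j) (fibre lab0 l) | l <- iota 0 21] in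
  [seq Tcond T ms | T <- all_T].
(** Types from block 0, as positions in [all_T]. The default 4, for no type, occurs only at block 0
    itself. *)
Definition row0 := [seq index true (Tflags j) | j <- iota 0 150].
Definition tab := grow row0 siginvs.
Definition check_types :=
  all (fun j => count id (Tflags j) <= 1) (iota 0 150).

(** Transitivity of the generators on the 126 points, and of the three that fix point 0 on the other
    125. *)
Definition check_reach :=
  all id (reach ginvs 126 0 12) &&
  all id (behead (reach (behead ginvs) 126 125 12)).

Lemma check_permsT : check_perms. Proof. by vm_cast_no_check (erefl true). Qed.
Lemma check_treeT : check_tree. Proof. by vm_cast_no_check (erefl true). Qed.
Lemma check_sigT : check_sig. Proof. by vm_cast_no_check (erefl true). Qed.
Lemma check_baseT : check_base. Proof. by vm_cast_no_check (erefl true). Qed.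
Lemma check_linesT : check_lines. Proof. by vm_cast_no_check (erefl true). Qed.
Lemma check_torusT : check_torus. Proof. by vm_cast_no_check (erefl true). Qed.
Lemma check_nbrT : check_nbr. Proof. by vm_cast_no_check (erefl true). Qed.
Lemma check_typesT : check_types. Proof. by vm_cast_no_check (erefl true). Qed.
Lemma check_reachT : check_reach. Proof. by vm_cast_no_check (erefl true). Qed.


Local Open Scope ring_scope.
Local Open Scope classical_set_scope.
Local Open Scope card_scope.

Definition check_pts := uniq pts && all (fun x => eqb25 (pivot x) one25) pts.
Lemma check_ptsT : check_pts. Proof. by vm_cast_no_check (erefl true). Qed.

Lemma all25_mem x : x \in all25. Proof. by case: x => [[] []]. Qed.

(** * From vectors over F_25 to points of the plane *)

Section Bridge.

Variables (k : fieldType) (char5 : 5%N \in [pchar k]) (s : k).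
Hypothesis s2 : s ^+ 2 = 2%:R.

Local Notation em := (em s).

Definition rv (x : v3) : 'rV[k]_3 :=
  \row_i (if i == 0 then em x.1.1 else if i == 1 then em x.1.2 else em x.2).
Definition mx (m : m3) : 'M[k]_3 := rows3 (rv m.1.1) (rv m.1.2) (rv m.2).

Lemma rvE x : (rv x 0 0 = em x.1.1) * (rv x 0 1 = em x.1.2) * (rv x 0 2%:R = em x.2).
Proof. by rewrite !mxE. Qed.

Lemma row_mx0 m : row 0 (mx m) = rv m.1.1. Proof. by rewrite rowK. Qed.
Lemma row_mx1 m : row 1 (mx m) = rv m.1.2. Proof. by rewrite rowK. Qed.
Lemma row_mx2 m : row 2%:R (mx m) = rv m.2. Proof. by rewrite rowK. Qed.

Lemma rv_inj : injective rv.
Proof.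
move=> [[a b] c] [[a' b'] c'] /rowP e; have inj := em_inj char5 s2.
by have := (e 0, e 1, e 2%:R); rewrite !rvE /= => -[[/inj -> /inj ->] /inj ->].
Qed.

Lemma rv_vmul x m : rv (vmul x m) = rv x *m mx m.
Proof.
apply/rowP => i; rewrite [RHS]mxE sum3 !rvE; move: i; apply: ord3P;
by rewrite !mxE /= !(emD char5) !(emM char5 s2).
Qed.

Lemma rv_scale a x : rv (zscale a x) = em a *: rv x.
Proof.
by apply/rowP; apply: ord3P; rewrite !mxE /= (emM char5 s2).
Qed.

Lemma em_herm x y : em (herm25 x y) = hermP (rv x) (rv y).
Proof.
rewrite /hermP !rvE /herm25 !(emD char5) !(emM char5 s2) !(emconj char5 s2).
have -> : em (F3, F0) = - 2%:R.
  rewrite /em /= mul0r addr0; transitivity (- 2%:R + 5%:R : k); first by ring.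
  by rewrite (five0 char5) addr0.
ring.
Qed.

Lemma em_dot x y : em (dot x y) = (rv x *m (rv y)^T) 0 0.
Proof. by rewrite mxE sum3 !mxE /= !(emD char5) !(emM char5 s2). Qed.

Lemma mx_unitary m : unitary25 m -> unitary (mx m).
Proof.
have em3 : em (F3, F0) = - 2%:R.
  rewrite /em /= mul0r addr0; transitivity (- 2%:R + 5%:R : k); first by ring.
  by rewrite (five0 char5) addr0.
case/and5P=> h00 h01 h02 h10 /and5P [h11 h12 h20 h21 h22].
move=> a b; move: a b; do 2!apply: ord3P;
  rewrite ?row_mx0 ?row_mx1 ?row_mx2 -em_herm mxE /=.
- by move/eqb25P: h00 => ->; rewrite em0.
- by move/eqb25P: h01 => ->; rewrite em0.
- by move/eqb25P: h02 => ->; rewrite em1.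
- by move/eqb25P: h10 => ->; rewrite em0.
- by move/eqb25P: h11 => ->; rewrite em3.
- by move/eqb25P: h12 => ->; rewrite em0.
- by move/eqb25P: h20 => ->; rewrite em1.
- by move/eqb25P: h21 => ->; rewrite em0.
- by move/eqb25P: h22 => ->; rewrite em0.
Qed.

Lemma rv_pivot x : (em (pivot x) == 0) = (rv x == 0).
Proof.
rewrite /pivot -(em_eq0 char5 s2); apply/idP/eqP => [|e]; last first.
  have := (rvE x); rewrite e !mxE => -[[e0 e1] e2].
  by case: ifP; rewrite -?e0 ?eqxx //; case: ifP; rewrite -?(em_eq0 char5 s2) -?e1 -?e2 ?eqxx.
case: ifP => [/eqP e0|/negP //]; case: ifP => [|/negP h]; rewrite -?(em_eq0 char5 s2).
  move=> /eqP e1 /eqP e2; apply/rowP; apply: ord3P; rewrite rvE mxE //.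
by move: h; rewrite -(em_eq0 char5 s2).
Qed.

Lemma pivot_scale x y c : c != 0 -> rv x = c *: rv y -> em (pivot x) = c * em (pivot y).
Proof.
move=> c0 /rowP e; have [e0 e1 e2] : [/\ em x.1.1 = c * em y.1.1,
    em x.1.2 = c * em y.1.2 & em x.2 = c * em y.2].
  by move: (e 0) (e 1) (e 2%:R); rewrite !mxE.
rewrite /pivot -!(em_eq0 char5 s2) e0 e1 !mulf_eq0 (negPf c0) /=.
by case: ifP => // _; case: ifP.
Qed.

Lemma pts_pivot x : eqb25 (pivot (ptv x)) one25.
Proof.
have /andP [_ /allP h] := check_ptsT; rewrite /ptv.
have [lt|ge] := ltnP x (size pts); first by apply: h; exact: mem_nth.
by rewrite nth_default.
Qed.

Lemma ptv_neq0 x : rv (ptv x) != 0.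
Proof. by rewrite -rv_pivot; have /eqb25P -> := pts_pivot x; rewrite em1 oner_eq0. Qed.

Lemma size_pts : size pts = 126%N.
Proof. by have /and5P [/eqP] := check_permsT. Qed.

Lemma ptv_inj x y : (x < 126)%N -> (y < 126)%N -> ptv x = ptv y -> x = y.
Proof.
rewrite -size_pts => hx hy; have /andP [upts _] := check_ptsT.
by have h := nth_uniq p0 hx hy upts; move/eqP; rewrite h => /eqP.
Qed.

Lemma normalizeP x : rv x != 0 -> rv x = em (pivot x) *: rv (normalize x).
Proof.
rewrite -rv_pivot => h; rewrite /normalize rv_scale scalerA (emV char5 s2) mulfV //.
by rewrite scale1r.
Qed.

Lemma ptindexP x : rv x != 0 -> hermP (rv x) (rv x) = 0 ->
  (ptindex x < 126)%N /\ ptv (ptindex x) = normalize x.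
Proof.
move=> x0 hx.
have mem : normalize x \in pts.
  rewrite mem_filter; apply/andP; split.
    rewrite -(em_eq0 char5 s2) em_herm /normalize rv_scale hermP_scale hx mulr0 //.
  have hp : mul25 (inv25 (pivot x)) (pivot x) = one25.
    apply: (em_inj char5 s2); rewrite (emM char5 s2) (emV char5 s2) em1 mulVf //.
    by rewrite rv_pivot.
  have hz a : mul25 a zero25 = zero25 by apply: (em_inj char5 s2); rewrite (emM char5 s2) em0 mulr0.
  suff: [\/ exists a b, normalize x = (one25, a, b), exists a, normalize x = (zero25, one25, a)
      | normalize x = (zero25, zero25, one25)].
    rewrite mem_cat [X in _ || X]mem_cat => -[[a [b ->]]|[a ->]|->].
    - by rewrite (@allpairs_f _ _ _ (fun a b : f25 => (one25, a, b))) ?all25_mem.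
    - by rewrite map_f ?all25_mem ?orbT.
    - by rewrite mem_seq1 eqxx !orbT.
  move: hp; rewrite /normalize; case: x {x0 hx} => [[a b] c]; rewrite /pivot /zscale /=.
  case: ifP => [/eqb25P -> |_ ->]; last by constructor 1; do 2!eexists.
  case: ifP => [/eqb25P -> ->|_ ->]; rewrite !hz; first by constructor 3.
  by constructor 2; eexists.
have hh : has (eqbv (normalize x)) pts by apply/hasP; exists (normalize x) => //; exact/eqbvP.
split; first by rewrite -size_pts -has_find.
by have /eqbvP := nth_find p0 hh.
Qed.

(** Raise the Gram relations to the fifth power: since [Jmx] is symmetric over F_5, the row of 25th
    powers of a row has the same products with all rows as the row itself. Non-degeneracy makes the
    two equal, so every entry satisfies x^25 = x. *)
Lemma unitary_entries W : @unitary k W -> exists m, W = mx m.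
Proof.
move=> hW; have Wu := unitary_unit char5 hW.
have five := five0 char5.
have fix2 : (2%:R : k) ^+ 5 = 2%:R by apply/(prime_subfieldP char5); exists 2.
have Jfix a b : Jmx k a b ^+ 5 = Jmx k b a.
  by move: a b; do 2!apply: ord3P; rewrite !mxE /= ?(expr0n, expr1n) //= exprNn fix2; ring.
have X2 (u v : k) : (2%:R * (u * v ^+ 5)) ^+ 5 = 2%:R * (u ^+ 5 * v ^+ 25).
  by rewrite -[in RHS]fix2; ring.
have F i j : W i j ^+ 25 = W i j.
  pose d : 'rV[k]_3 := \row_l (W i l ^+ 25 - W i l).
  suff /rowP/(_ j) : d = 0 by rewrite !mxE => /eqP; rewrite subr_eq0 => /eqP.
  (* The product of the row of 25th powers with row [a] is the fifth power of the product of row [a]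
     with row [i]. *)
  have hd a : hermP d (row a W) = 0.
    have := Jfix a i; rewrite -!hW /hermP !mxE frob3 // => e.
    transitivity (W a 0 ^+ 5 * W i 2%:R ^+ 25 + W a 2%:R ^+ 5 * W i 0 ^+ 25 +
      (- (2%:R * (W a 1 ^+ 5 * W i 1 ^+ 25))) -
      (W i 0 * W a 2%:R ^+ 5 + W i 2%:R * W a 0 ^+ 5 - 2%:R * (W i 1 * W a 1 ^+ 5))); first by ring.
    by rewrite -e -X2; ring.
  pose z := d *m invmx W; have Ez : d = z *m W by rewrite mulmxKV.
  have hz a : hermP z (delta_mx 0 a) = 0.
    by rewrite -(herm_unitary char5 _ _ hW) -Ez -rowE hd.
  suff z0 : z = 0 by rewrite Ez z0 mul0mx.
  apply/rowP; apply: ord3P; rewrite [RHS]mxE.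
  - by have := hz 2%:R; rewrite /hermP !mxE /= !(expr1n, expr0n) /= !(mulr0, mulr1, addr0, subr0).
  - have := hz 1; rewrite /hermP !mxE /= !(expr1n, expr0n) /= !(mulr0, mulr1, addr0, add0r) => /eqP.
    by rewrite oppr_eq0 mulf_eq0 (negPf (nat_neq0 char5 (n := 2) isT)) => /eqP.
  - by have := hz 0; rewrite /hermP !mxE /= !(expr1n, expr0n) /= !(mulr0, mulr1, addr0, add0r, subr0).
have ex i j : exists z, W i j = em z := em_onto char5 s2 (F i j).
have [f hf] := choice (fun ij : 'I_3 * 'I_3 => ex ij.1 ij.2).
pose g i : v3 := (f (i, 0), f (i, 1), f (i, 2%:R)).
exists (g 0, g 1, g 2%:R); apply/row_matrixP; apply: ord3P;
  rewrite ?row_mx0 ?row_mx1 ?row_mx2; apply/rowP; apply: ord3P;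
  by rewrite rvE mxE -hf.
Qed.

Section Points.

Variables (E : 'M[k]_3).
Hypothesis Eu : E \in unitmx.

Definition pti x : ppoint k := pt (rv (ptv x) *m E).

Lemma pti_inj x y : (x < 126)%N -> (y < 126)%N -> pti x = pti y -> x = y.
Proof.
move=> x126 y126 /pt_inj []; rewrite ?mul_unit_neq0 ?ptv_neq0 // => c c0.
rewrite scalemxAl => /(can_inj (mulmxK Eu)) e; have := pivot_scale c0 e.
have /eqb25P -> := pts_pivot x; have /eqb25P -> := pts_pivot y.
by rewrite em1 mulr1 => c1; move: e; rewrite -c1 scale1r => /rv_inj /ptv_inj ->.
Qed.

Lemma pti_index v : rv v != 0 -> hermP (rv v) (rv v) = 0 -> pt (rv v *m E) = pti (ptindex v).
Proof.
move=> v0 hv; have [_ e] := ptindexP v0 hv; rewrite /pti e {1}(normalizeP v0).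
rewrite -scalemxAl pt_scale ?mul_unit_neq0 // ?rv_pivot //.
by apply/eqP => z; move: (v0); rewrite (normalizeP v0) z scaler0 eqxx.
Qed.

Lemma ptv_herm x : hermP (rv (ptv x)) (rv (ptv x)) = 0.
Proof.
rewrite -em_herm; suff /eqb25P -> : is0 (herm25 (ptv x) (ptv x)) by rewrite em0.
rewrite /ptv; have [lt|ge] := ltnP x (size pts); last by rewrite nth_default.
by have := mem_nth p0 lt; rewrite mem_filter => /andP [].
Qed.

End Points.

End Bridge.

(** * Contact points as indices, and conics determined by five points *)

Section Codes.

Variables (k : fieldType) (char5 : 5%N \in [pchar k]) (s : k).
Hypothesis s2 : s ^+ 2 = 2%:R.
Hypothesis closed_root : forall n (c : k), (0 < n)%N -> exists x : k, x ^+ n = c.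
Variables (F : {mpoly k[3]}) (c : k).
Implicit Types (E B V W M : 'M[k]_3) (Q : conic k) (P : ppoint k).

Local Notation rv := (rv s).
Local Notation mx := (mx s).
Local Notation pti := (pti s).
Local Notation frame E := (frame F E c).

Let two0 : 2%:R != 0 :> k := @nat_neq0 k char5 2 isT.

Lemma frame_mul E B : frame E -> unitary B -> frame (B *m E).
Proof.
move=> fr hB; have Eu := frame_unit fr; have Bu := unitary_unit char5 hB.
split; rewrite ?unitmx_mul ?Bu ?(frame_c fr) ?(frame_homog fr) //.
  move=> g; rewrite map_mxM mulmxA (frame_par fr); congr (_ * _).
  have fiveP : 5%:R = 0 :> {poly k} by rewrite -polyC_natr (five0 char5) polyC0.
  rewrite hermP_mul // !sum3 -!map_row !hermP_map !hB !mxE /= /hermP.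
  by rewrite polyC0 polyC1 polyCN polyC_natr; ring.
by move=> y y'; rewrite !mulmxA (frame_tangent fr) herm_unitary.
Qed.

Lemma rv_bvec n : (n < 6)%N -> rv (bvec25 n) = bvec k n.
Proof.
move=> n6; have e1 : em s one25 = 1 := em1 s; have e0 : em s zero25 = 0 := em0 s.
have e (a : f5) : em s (a, F0) = iota5 k a by rewrite /em /= mul0r addr0.
have t5 (a : f5) (m : nat) : iota5 k a = m%:R ->
    rv (one25, (a, F0), (mul5 a a, F0)) = cvec m%:R.
  move=> am; apply/rowP; apply: ord3P; rewrite !mxE /= ?e1 ?e ?expr0 ?expr1 //.
  by rewrite (iota5M char5) am expr2.
rewrite /bvec; case: n n6 => [|[|[|[|[|[|//]]]]]] _; rewrite /bvec25; try exact: t5.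
by apply/rowP; apply: ord3P; rewrite !mxE /= ?e0 ?e1.
Qed.

Lemma pti_mul E m x : E \in unitmx -> unitary25 m ->
  pti (mx m *m E) x = pti E (ptindex (vmul (ptv x) m)).
Proof.
move=> Eu hm; have mU := mx_unitary char5 s2 hm.
rewrite /pti mulmxA -(rv_vmul char5 s2) (pti_index char5 s2) //.
  by rewrite (rv_vmul char5 s2) mul_unit_neq0 ?ptv_neq0 // (unitary_unit char5).
by rewrite (rv_vmul char5 s2) herm_unitary // ptv_herm.
Qed.

Lemma contact_pti E Q P : frame E -> tangent_conics F Q -> (Q `&` zeros F) P ->
  exists2 x, (x < 126)%N & P = pti E x.
Proof.
move=> fr /(tangent_classify char5 closed_root fr) [W hW ->] /(contactP char5 fr P hW) [n n6 ->].
have [m Em] := unitary_entries char5 s2 hW.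
have b0 : rv (bvec25 n) *m mx m != 0.
  by rewrite rv_bvec // mul_unit_neq0 ?bvec_neq0 // -Em (unitary_unit char5 hW).
have hz : hermP (rv (vmul (bvec25 n) m)) (rv (vmul (bvec25 n) m)) = 0.
  rewrite (rv_vmul char5 s2); apply: (iffLR (zeros_frame fr b0)).
  rewrite -Em rv_bvec // -mulmxA.
  suff [] : (conicset (W *m E) `&` zeros F) (pt (bvec k n *m (W *m E))) by [].
  by apply/(contactP char5 fr _ hW); exists n.
exists (ptindex (vmul (bvec25 n) m)).
  by have [] := ptindexP char5 s2 _ hz; rewrite // (rv_vmul char5 s2).
rewrite -(pti_index char5 s2 (frame_unit fr) _ hz) (rv_vmul char5 s2) // -Em rv_bvec //.
by rewrite mulmxA.
Qed.

Lemma pti_zeros E x : frame E -> zeros F (pti E x).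
Proof.
move=> fr; apply: (iffRL (zeros_frame fr (ptv_neq0 char5 s2 x))).
exact: ptv_herm.
Qed.

Lemma quad_restrict V M (G := V *m M *m V^T) : par (conic_param k *m map_mx polyC V) (quad M) =
  (G 0 0)%:P + (G 0 1 + G 1 0)%:P * 'X + (G 0 2%:R + G 1 1 + G 2%:R 0)%:P * 'X^2 +
  (G 1 2%:R + G 2%:R 1)%:P * 'X^3 + (G 2%:R 2%:R)%:P * 'X^4.
Proof.
have -> : par (conic_param k *m map_mx polyC V) (quad M) = par (conic_param k) (quad G).
  by rewrite -linear_subst_quad par_linear_subst trmxK.
rewrite quadE !sum3 -!mul_mpolyC !(rmorphD (par (conic_param k))).
rewrite !(rmorphM (par (conic_param k))) /= !parC !parX !conic_paramE.
by rewrite !polyCD; ring.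
Qed.

Lemma quad_on_conic V M : V \in unitmx ->
  par (conic_param k *m map_mx polyC V) (quad M) = 0 ->
  exists alpha, quad M = alpha *: cform V.
Proof.
move=> Vu; rewrite quad_restrict; set G := V *m M *m V^T => e.
have z n := congr1 (fun p : {poly k} => p`_n) e.
have cX n m : ('X^n : {poly k})`_m = (m == n)%:R by exact: coefXn.
have g0 := z 0%N; have g1 := z 1%N; have g2 := z 2%N; have g3 := z 3%N; have g4 := z 4%N.
rewrite coef0 !(coefD, coefCM) !coefC !cX !coefX /= !(mulr0, mulr1, addr0, add0r) in g0 g1 g2 g3 g4.
exists (G 1 1); apply: cform_of_subst => //; rewrite linear_subst_quad -/G quadE !sum3.
have -> : G 1 0 = - G 0 1 by apply/eqP; rewrite -addr_eq0 addrC g1.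
have -> : G 2%:R 1 = - G 1 2%:R by apply/eqP; rewrite -addr_eq0 addrC g3.
have -> : G 2%:R 0 = - (G 0 2%:R + G 1 1) by apply/eqP; rewrite -addr_eq0 addrC g2.
rewrite g0 g4 -!mul_mpolyC !mpolyCN mpolyCD mpolyC0 /conic_form; ring.
Qed.

(** The restriction to the conic is a polynomial of degree at most 4 with five roots, hence zero. *)
Lemma conic_through V M : V \in unitmx ->
  (forall n, (n < 5)%N -> (quad M).@[(cvec (n%:R : k) *m V) 0] = 0) ->
  exists alpha, quad M = alpha *: cform V.
Proof.
move=> Vu h; apply: quad_on_conic => //; set p := par _ _.
have rp t : p.[t] = (quad M).@[(cvec t *m V) 0].
  rewrite /p horner_par; apply: meval_eq => i; rewrite !mxE !sum3 !mxE !hornerD !hornerM.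
  by rewrite !hornerXn !hornerC.
have sp : (size p <= 5)%N.
  rewrite /p quad_restrict; do !(apply: leq_trans (size_polyD _ _) _; rewrite geq_max; apply/andP; split);
  rewrite ?mul_polyC; (apply: leq_trans (size_polyC_leq1 _) _ || apply: leq_trans (size_scale_leq _ _) _);
  by rewrite ?size_polyXn ?size_polyX.
apply: contraTeq isT => p0.
have := @max_poly_roots _ p [seq (i%:R : k) | i <- iota 0 5] p0; rewrite size_map size_iota ltnNge sp.
apply.
  by apply/allP => _ /mapP [i + ->]; rewrite mem_iota /= => i5; rewrite /root rp h.
rewrite map_inj_in_uniq ?iota_uniq // => a b; rewrite !mem_iota /= => a5 b5.
exact: (natr5_inj char5).
Qed.

End Codes.

Lemma nth_pull l p x : (x < size p)%N -> nth 0%N (pull l p) x = nth 0%N l (nth 0%N p x).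
Proof. by move=> h; rewrite (nth_map 0%N). Qed.

Lemma all_iota n (a : pred nat) : all a (iota 0 n) -> forall x, (x < n)%N -> a x.
Proof. by move=> /allP h x xn; apply: h; rewrite mem_iota. Qed.

Lemma inverse_pairP n p q : inverse_pair n p q -> [/\ size p = n, size q = n,
  forall x, (x < n)%N -> (nth 0%N p x < n)%N /\ nth 0%N q (nth 0%N p x) = x &
  forall x, (x < n)%N -> (nth 0%N q x < n)%N /\ nth 0%N p (nth 0%N q x) = x].
Proof.
case/and4P=> /eqP sp /eqP sq /all_iota hp /all_iota hq; split=> // x xn.
  by have /andP [? /eqP] := hp x xn.
by have /andP [? /eqP] := hq x xn.
Qed.

Lemma same_fibresP l1 l2 : same_fibres l1 l2 -> forall x y,
  (x < size l2)%N -> (y < size l2)%N ->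
  (nth 0%N l1 x = nth 0%N l1 y) <-> (nth 0%N l2 x = nth 0%N l2 y).
Proof.
case/and3P; set t := map _ _ => ut /allP lt; rewrite all2E => /andP [/eqP sz /allP ht] x y xs ys.
have E z : (z < size l2)%N -> nth 0%N l1 z = nth 0%N t (nth 0%N l2 z).
  move=> zs; have := ht (nth (0%N, 0%N) (zip l1 l2) z); rewrite nth_zip //= => h.
  apply/esym/eqP; apply: h; rewrite -nth_zip //; apply: mem_nth.
  by rewrite size_zip sz minnn.
have st : size t = 21 by rewrite size_map size_iota.
rewrite !E //; split=> [/eqP|-> //].
by rewrite nth_uniq ?st ?lt ?mem_nth // => /eqP.
Qed.

(** * Sets of conics coded by labellings *)

Section DSets.

Variables (k : fieldType) (char5 : 5%N \in [pchar k]) (s : k).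
Hypothesis s2 : s ^+ 2 = 2%:R.
Hypothesis closed_root : forall n (c : k), (0 < n)%N -> exists x : k, x ^+ n = c.
Variables (F : {mpoly k[3]}) (c : k).
Implicit Types (E B V W M : 'M[k]_3) (Q : conic k) (P : ppoint k).

Local Notation rv := (rv s).
Local Notation mx := (mx s).
Local Notation pti := (pti s).
Local Notation frame E := (frame F E c).

Lemma conic_eq_of_contact W W' E : frame E -> unitary W -> unitary W' ->
  (forall n, (n < 5)%N -> conicset (W' *m E) (pt (bvec k n *m (W *m E)))) ->
  conicset (W' *m E) = conicset (W *m E).
Proof.
move=> fr hW hW' h; have Vu := unitary_frame_unit char5 fr hW.
have Vu' := unitary_frame_unit char5 fr hW'.
have [alpha Ea] : exists alpha, quad (cformM (W' *m E)) = alpha *: cform (W *m E).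
  apply: conic_through => // n n5; rewrite -(cform_quad char5).
  apply: (iffLR (zeros_pt (cform_homog (W' *m E)) _)); first by rewrite mul_unit_neq0 ?cvec_neq0.
  by have := h n n5; rewrite /bvec n5.
rewrite /conicset (cform_quad char5 (W' *m E)) Ea zeros_scale //.
apply/eqP => a0; have := linear_subst_cform Vu'.
rewrite (cform_quad char5) Ea a0 scale0r /linear_subst comp_mpoly0.
move/(congr1 (meval ((delta_mx 0 1 : 'rV[k]_3) 0))).
rewrite meval0 meval_conic_form !mxE /= expr1n mul0r subr0 => /esym/eqP.
by rewrite oner_eq0.
Qed.

Lemma code_inj E Q Q' : frame E -> tangent_conics F Q -> tangent_conics F Q' ->
  (forall x, (x < 126)%N -> Q (pti E x) -> Q' (pti E x)) -> Q = Q'.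
Proof.
move=> fr hQ hQ' h.
have [W hW EQ] := tangent_classify char5 closed_root fr hQ.
have [W' hW' EQ'] := tangent_classify char5 closed_root fr hQ'.
rewrite EQ EQ'; apply/esym/conic_eq_of_contact => // n n5.
have hn : (Q `&` zeros F) (pt (bvec k n *m (W *m E))).
  by rewrite EQ; apply/(contactP char5 fr _ hW); exists n; rewrite // ltnW.
have [x x126 e] := contact_pti char5 s2 closed_root fr hQ hn.
by rewrite -EQ' e; apply: h; rewrite // -e; case: hn.
Qed.

(** The block coded by [lab] in the frame [E]: the totally tangent conics whose points among the 126
    form one fibre of [lab]. *)
Definition dsetl E (lab : seq nat) : set (conic k) :=
  [set Q | tangent_conics F Q /\ exists2 x0, (x0 < 126)%N &
    forall x, (x < 126)%N -> Q (pti E x) <-> nth 0%N lab x = nth 0%N lab x0].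

(** Multiplying the frame by [m] permutes the 126 points, so the same conics are described by the
    labelling pulled back along the inverse permutation. *)
Lemma dsetl_perm E m q lab lab' : frame E -> unitary25 m -> size lab' = 126 ->
  inverse_pair 126 (ptperm m) q -> same_fibres (pull lab q) lab' ->
  dsetl (mx m *m E) lab = dsetl E lab'.
Proof.
move=> fr hm sl /inverse_pairP [sp sq hp hq] /same_fibresP; rewrite sl => hf.
have pE x : (x < 126)%N -> pti (mx m *m E) x = pti E (nth 0%N (ptperm m) x).
  move=> x126; rewrite (pti_mul char5 s2) ?(frame_unit fr) //.
  by rewrite /ptperm (nth_map p0) ?size_pts.
apply/seteqP; split=> Q [hQ [x0 x126 h]]; split=> //.
  exists (nth 0%N (ptperm m) x0); first by case: (hp _ x126).
  move=> x xl; have [ql qK] := hq _ xl; have [pl pK] := hp _ x126.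
  rewrite -hf // !nth_pull ?sq // pK; rewrite -h // pE // qK //.
exists (nth 0%N q x0); first by case: (hq _ x126).
move=> x xl; have [ql qK] := hq _ x126; have [pl pK] := hp _ xl.
by rewrite pE // h // -hf // !nth_pull ?sq // pK.
Qed.

End DSets.

Lemma size_mask_step qs m : size (mask_step qs m) = size m.
Proof. by rewrite size_map size_iota. Qed.

Lemma size_reach qs n x r : size (reach qs n x r) = n.
Proof.
by rewrite /reach; elim: r => [|r IH] /=; rewrite ?size_mask_step // size_map size_iota.
Qed.

(** Induction along an orbit computed by [reach]. *)
Lemma reachP (P : nat -> Prop) (ps qs : seq (seq nat)) n x r :
  (forall i, (i < size qs)%N -> inverse_pair n (nth [::] ps i) (nth [::] qs i)) ->
  (x < n)%N -> P x ->
  (forall i y, (i < size qs)%N -> (y < n)%N -> P y -> P (nth 0%N (nth [::] ps i) y)) ->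
  forall y, (y < n)%N -> nth false (reach qs n x r) y -> P y.
Proof.
move=> hpq xn Px step; rewrite /reach.
elim: r => [|r IH] y yn.
  by rewrite /= (nth_map 0%N) ?size_iota // nth_iota // add0n => /eqP ->.
rewrite iterS {1}/mask_step; set m := iter r _ _.
have sm : size m = n by exact: (size_reach qs n x r).
rewrite (nth_map 0%N) ?size_iota ?sm // nth_iota // add0n => /orP [|/hasP [q /(nthP [::]) [i iq <-]]].
  exact: IH.
have [_ _ _ hq] := inverse_pairP (hpq i iq); have [yq yK] := hq y yn.
by move=> /(IH _ yq)/(step i _ iq yq); rewrite yK.
Qed.

Lemma nthT_all (m : bitseq) y : all id m -> (y < size m)%N -> nth false m y.
Proof. by move=> /all_nthP h ym; exact: h. Qed.

(** * Every unitary matrix permutes the 150 blocks *)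

Section Generation.

Variables (k : fieldType) (char5 : 5%N \in [pchar k]) (s : k).
Hypothesis s2 : s ^+ 2 = 2%:R.
Hypothesis closed_root : forall n (c : k), (0 < n)%N -> exists x : k, x ^+ n = c.
Variables (F : {mpoly k[3]}) (c : k).
Implicit Types (E B V W M : 'M[k]_3) (Q : conic k) (P : ppoint k).

Local Notation rv := (rv s).
Local Notation mx := (mx s).
Local Notation pti := (pti s).
Local Notation frame E := (frame F E c).

Definition dset E i := dsetl s F E (nth [::] labs i).
Definition gen g := nth ((p0, p0), p0) gens g.

Lemma gen_facts g : (g < 4)%N ->
  unitary25 (gen g) /\ inverse_pair 126 (ptperm (gen g)) (nth [::] ginvs g) /\
  nth [::] gperms g = ptperm (gen g).
Proof.
have /and5P [_ /allP hu /allP hp _ /and5P [_ /eqP sg _ _ _]] := check_permsT.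
move=> g4; have gm : gen g \in gens by rewrite mem_nth ?sg.
have e : nth [::] gperms g = ptperm (gen g) by rewrite (nth_map ((p0, p0), p0)) ?sg.
split; first by apply: hu; rewrite mem_cat gm orbT.
split=> //; rewrite /ginvs (nth_map [::]) ?size_map ?sg // e.
by apply: hp; rewrite mem_cat /gperms (map_f ptperm gm) orbT.
Qed.

Lemma sig_facts g : (g < 4)%N -> inverse_pair 150 (nth [::] sig g) (nth [::] siginvs g).
Proof.
have /and5P [_ _ _ /allP hp /and5P [_ _ /eqP sg _ _]] := check_permsT.
move=> g4; rewrite /siginvs (nth_map [::]) ?sg //.
by apply: hp; rewrite mem_nth ?sg.
Qed.

Lemma size_lab i : (i < 150)%N -> size (nth [::] labs i) = 126%N.
Proof.
have /and5P [_ _ _ _ /and5P [/eqP sl _ _ /allP h _]] := check_permsT.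
by move=> i150; have /andP [/eqP] := h _ (mem_nth [::] (etrans (congr1 (leq i.+1) sl) i150)).
Qed.

Lemma lab_lt i x : (i < 150)%N -> (x < 126)%N -> (nth 0 (nth [::] labs i) x < 21)%N.
Proof.
have /and5P [_ _ _ _ /and5P [/eqP sl _ _ /allP h _]] := check_permsT.
move=> i150 x126; have /andP [/eqP sz /allP] := h _ (mem_nth [::] (etrans (congr1 (leq i.+1) sl) i150)).
by apply; rewrite mem_nth ?sz.
Qed.

Lemma dset_gen E g i : frame E -> (g < 4)%N -> (i < 150)%N ->
  dset (mx (gen g) *m E) i = dset E (nth 0%N (nth [::] sig g) i).
Proof.
move=> fr g4 i150; have [hu [hp _]] := gen_facts g4.
have [_ _ hs _] := inverse_pairP (sig_facts g4); have [si _] := hs i i150.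
apply: (dsetl_perm char5 s2 fr hu (size_lab si) hp).
exact: (all_iota (all_iota check_sigT g4) i150).
Qed.

(** Quantifying over all frames makes the property stable under products, and asking for both
    inclusions makes it stable under inverses. *)
Definition permutes B := unitary B /\ forall E, frame E ->
  (forall i, (i < 150)%N -> exists2 j, (j < 150)%N & dset (B *m E) i = dset E j) /\
  (forall j, (j < 150)%N -> exists2 i, (i < 150)%N & dset (B *m E) i = dset E j).

Lemma permutesM B B' : permutes B -> permutes B' -> permutes (B *m B').
Proof.
move=> [hB h] [hB' h']; split; first exact: unitaryM.
move=> E fr; have fr' := frame_mul char5 fr hB'.
have [h1 h2] := h _ fr'; have [h1' h2'] := h' _ fr; rewrite -mulmxA; split.
  by move=> i /h1 [j /h1' [l l150 e'] e]; exists l; rewrite // e.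
by move=> j /h2' [i /h2 [l l150 e] e']; exists l; rewrite // e.
Qed.

Lemma permutesV B : permutes B -> permutes (invmx B).
Proof.
move=> [hB h]; split; first exact: unitaryV.
move=> E fr; have frV := frame_mul char5 fr (unitaryV char5 hB).
have := h _ frV; rewrite mulKVmx ?(unitary_unit char5) // => -[h1 h2]; split.
  by move=> i /h2 [j j150 e]; exists j.
by move=> j /h1 [i i150 e]; exists i.
Qed.

Lemma permutes1 : permutes 1%:M.
Proof.
split; first exact: unitary1.
by move=> E fr; rewrite mul1mx; split=> i i150; exists i.
Qed.

Lemma permutes_gen g : (g < 4)%N -> permutes (mx (gen g)).
Proof.
move=> g4; have [hu _] := gen_facts g4; split; first exact: mx_unitary.
have [_ _ hs hs'] := inverse_pairP (sig_facts g4).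
move=> E fr; split=> i i150.
  by exists (nth 0%N (nth [::] sig g) i); [case: (hs i i150)|rewrite dset_gen].
have [si sK] := hs' i i150.
by exists (nth 0%N (nth [::] siginvs g) i); rewrite // dset_gen // sK.
Qed.

Local Notation e0 := (rv (ptv 0)).
Local Notation e2 := (rv (ptv 125)).

Lemma rv_e0 : e0 = delta_mx 0 0.
Proof.
have -> : ptv 0 = (one25, zero25, zero25) by vm_cast_no_check (erefl (one25, zero25, zero25)).
by apply/rowP; apply: ord3P; rewrite !mxE /= ?em1 ?em0.
Qed.

Lemma rv_e2 : e2 = delta_mx 0 2%:R.
Proof.
have -> : ptv 125 = (zero25, zero25, one25) by vm_cast_no_check (erefl (zero25, zero25, one25)).
by apply/rowP; apply: ord3P; rewrite !mxE /= ?em1 ?em0.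
Qed.

Lemma ptv_gen g x : (g < 4)%N -> (x < 126)%N -> exists2 a, a != 0 &
  rv (ptv x) *m mx (gen g) = a *: rv (ptv (nth 0%N (nth [::] gperms g) x)).
Proof.
move=> g4 x126; have [hu [_ ->]] := gen_facts g4; have hU := mx_unitary char5 s2 hu.
rewrite (nth_map p0) ?size_pts // -/(ptv x) -(rv_vmul char5 s2).
have v0 : rv (vmul (ptv x) (gen g)) != 0.
  by rewrite (rv_vmul char5 s2) mul_unit_neq0 ?ptv_neq0 ?(unitary_unit char5).
have vh : hermP (rv (vmul (ptv x) (gen g))) (rv (vmul (ptv x) (gen g))) = 0.
  by rewrite (rv_vmul char5 s2) herm_unitary // ptv_herm.
have [_ ->] := ptindexP char5 s2 v0 vh.
exists (em s (pivot (vmul (ptv x) (gen g)))); last exact: normalizeP.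
by rewrite (rv_pivot char5 s2).
Qed.

Lemma size_gperms : size gperms = 4%N /\ size ginvs = 4%N.
Proof.
by have /and5P [_ _ _ _ /and5P [_ /eqP sg _ _ _]] := check_permsT; rewrite !size_map.
Qed.

Opaque gperms ginvs ptv gen pts.

Lemma move_from_e0 x : (x < 126)%N ->
  exists2 B, permutes B & exists2 a, a != 0 & e0 *m B = a *: rv (ptv x).
Proof.
move=> x126; have := check_reachT; rewrite /check_reach => /andP [h _].
have [_ sg] := size_gperms.
apply: (@reachP (fun y => exists2 B, permutes B & exists2 a, a != 0 & e0 *m B = a *: rv (ptv y))
  gperms ginvs 126 0 12 _ isT _ _ _ x126 _).
- by rewrite sg => i i4; have [_ [+ ->]] := gen_facts i4.
- by exists 1%:M; [exact: permutes1|exists 1; [exact: oner_neq0|rewrite mulmx1 scale1r]].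
- rewrite sg => g y g4 y126 [B hB [a a0 e]].
  exists (B *m mx (gen g)); first exact: permutesM hB (permutes_gen g4).
  have [b b0 e'] := ptv_gen g4 y126; exists (a * b); first exact: mulf_neq0.
  by rewrite mulmxA e -scalemxAl e' scalerA.
by apply: nthT_all h _; rewrite size_reach.
Qed.

Lemma move_from_e2 x : (0 < x < 126)%N ->
  exists2 B, permutes B & (exists2 a, a != 0 & e0 *m B = a *: e0) /\
    exists2 a, a != 0 & e2 *m B = a *: rv (ptv x).
Proof.
move=> /andP [x0 x126]; have := check_reachT; rewrite /check_reach => /andP [_ h].
have sg : size (behead ginvs) = 3%N.
  by rewrite size_behead (size_gperms).2.
have bh (l : seq (seq nat)) i : nth [::] (behead l) i = nth [::] l i.+1 by rewrite nth_behead.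
apply: (@reachP (fun y => exists2 B, permutes B & (exists2 a, a != 0 & e0 *m B = a *: e0) /\
    exists2 a, a != 0 & e2 *m B = a *: rv (ptv y)) (behead gperms) (behead ginvs) 126 125 12 _ isT _ _ _ x126 _).
- by rewrite sg => i i3; rewrite !bh; have [_ [+ ->]] := gen_facts (i3 : (i.+1 < 4)%N).
- exists 1%:M; first exact: permutes1.
  by split; (exists 1; [exact: oner_neq0|rewrite mulmx1 scale1r]).
- rewrite sg => g y g3 y126 [B hB [[a a0 e] [b b0 e']]]; have g4 : (g.+1 < 4)%N := g3.
  exists (B *m mx (gen g.+1)); first exact: permutesM hB (permutes_gen g4).
  rewrite bh; have [d d0 ed] := ptv_gen g4 y126; split; last first.
    by exists (b * d); [exact: mulf_neq0|rewrite mulmxA e' -scalemxAl ed scalerA].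
  have [f f0 ef] := ptv_gen g4 (isT : (0 < 126)%N).
  exists (a * f); first exact: mulf_neq0.
  rewrite mulmxA e -scalemxAl ef scalerA; congr (_ *: rv (ptv _)).
  (* The generators other than the swap fix point 0. *)
  have : all (fun p => nth 0%N p 0 == 0%N) (behead gperms).
    by vm_cast_no_check (erefl true).
  move=> /allP /(_ (nth [::] (behead gperms) g)); rewrite bh => hh; apply/eqP; apply: hh.
  by rewrite -bh mem_nth // size_behead (size_gperms).1.
move: h; set m := reach _ _ _ _; have sm : size m = 126%N by rewrite size_reach.
clearbody m; case: x x0 x126 => [//|x _ x126 hm]; rewrite -nth_behead.
by apply: nthT_all hm _; rewrite size_behead sm.
Qed.

Definition dg (a b d : k) : 'M[k]_3 := mx3 [:: [:: a; 0; 0]; [:: 0; b; 0]; [:: 0; 0; d]].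

Lemma dgM a b d a' b' d' : dg a b d *m dg a' b' d' = dg (a * a') (b * b') (d * d').
Proof.
by apply/matrixP; do 2!apply: ord3P; rewrite !mxE sum3 !mxE /=; ring.
Qed.

Lemma dg1 : dg 1 1 1 = 1%:M.
Proof. by apply/matrixP; do 2!apply: ord3P; rewrite !mxE. Qed.

Lemma em_pow25 x n : em s (pow25 x n) = em s x ^+ n.
Proof.
elim: n => [|n IH]; first by rewrite expr0; exact: em1.
by rewrite exprS -IH -(emM char5 s2).
Qed.

Lemma permutes_dgX a b d n : permutes (dg a b d) -> permutes (dg (a ^+ n) (b ^+ n) (d ^+ n)).
Proof.
move=> h; elim: n => [|n IH]; first by rewrite !expr0 dg1; exact: permutes1.
by rewrite !exprS -dgM; exact: permutesM.
Qed.

Lemma torus_gens (w := em s omega25) (nu := em s (nth zero25 all25 18)) :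
  permutes (dg w 1 (w ^- 5)) /\ permutes (dg 1 nu 1).
Proof.
have h1 : mx (gen 1) = dg w 1 (w ^- 5).
  have -> : gen 1 = ((omega25, zero25, zero25), (zero25, one25, zero25),
      (zero25, zero25, inv25 (conj25 omega25))).
    by vm_cast_no_check (erefl (gen 1)).
  apply/matrixP; do 2!apply: ord3P; rewrite !mxE /= ?mxE /= ?em0 ?em1 //.
  by rewrite (emV char5 s2) (emconj char5 s2).
have h2 : mx (gen 2) = dg 1 nu 1.
  have -> : gen 2 = ((one25, zero25, zero25), (zero25, nth zero25 all25 18, zero25),
      (zero25, zero25, one25)).
    by vm_cast_no_check (erefl (gen 2)).
  by apply/matrixP; do 2!apply: ord3P; rewrite !mxE /= ?mxE /= ?em0 ?em1.
by rewrite -h1 -h2; split; exact: permutes_gen.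
Qed.

(** Orthogonality makes [W] diagonal with entries a, b, a^-5 where b^6 = 1. By [check_torus] it is a
    product of powers of the two diagonal generators. *)
Lemma permutes_torus W a d : unitary W -> row 0 W = a *: delta_mx 0 0 ->
  row 2%:R W = d *: delta_mx 0 2%:R -> permutes W.
Proof.
move=> hW r0 r2; have [m Em] := unitary_entries char5 s2 hW.
have two0 : 2%:R != 0 :> k := @nat_neq0 k char5 2 isT.
have w00 : W 0 0 = a by have /rowP/(_ 0) := r0; rewrite !mxE /= mulr1.
have w01 : W 0 1 = 0 by have /rowP/(_ 1) := r0; rewrite !mxE /= mulr0.
have w02 : W 0 2%:R = 0 by have /rowP/(_ 2%:R) := r0; rewrite !mxE /= mulr0.
have w20 : W 2%:R 0 = 0 by have /rowP/(_ 0) := r2; rewrite !mxE /= mulr0.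
have w21 : W 2%:R 1 = 0 by have /rowP/(_ 1) := r2; rewrite !mxE /= mulr0.
have w22 : W 2%:R 2%:R = d by have /rowP/(_ 2%:R) := r2; rewrite !mxE /= mulr1.
have z5 : 0 ^+ 5 = 0 :> k by rewrite expr0n.
have ad : a * d ^+ 5 = 1.
  by have := hW 0 2%:R; rewrite /hermP !mxE /= w00 w01 w02 w20 w21 w22 !mul0r !mulr0 subr0 addr0.
have da : d * a ^+ 5 = 1.
  by have := hW 2%:R 0; rewrite /hermP !mxE /= w00 w01 w02 w20 w21 w22 !mul0r !mulr0 subr0 add0r.
have a0 : a != 0 by apply: contra_eq_neq ad => ->; rewrite mul0r eq_sym oner_eq0.
have d0 : d != 0 by apply: contra_eq_neq da => ->; rewrite mul0r eq_sym oner_eq0.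
have w12 : W 1 2%:R = 0.
  have := hW 1 0; rewrite /hermP !mxE /= w00 w01 w02 z5 !mulr0 add0r subr0 => /eqP.
  by rewrite mulf_eq0 expf_eq0 (negPf a0) orbF => /eqP.
have w10 : W 1 0 = 0.
  have := hW 1 2%:R; rewrite /hermP !mxE /= w20 w21 w22 z5 !mulr0 addr0 subr0 => /eqP.
  by rewrite mulf_eq0 expf_eq0 (negPf d0) orbF => /eqP.
have b6 : W 1 1 * W 1 1 ^+ 5 = 1.
  have := hW 1 1; rewrite /hermP !mxE /= w10 w12 !mul0r add0r sub0r => /eqP.
  by rewrite eqr_opp -subr_eq0 -{2}[2%:R]mulr1 -mulrBr mulf_eq0 (negPf two0) subr_eq0 => /eqP.
have EW : W = dg a (W 1 1) (a ^- 5).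
  have -> : a ^- 5 = d by rewrite -[LHS]mul1r -da mulfK // expf_neq0.
  by apply/matrixP; do 2!apply: ord3P; rewrite [RHS]mxE.
have [al Eal] : exists al, a = em s al by exists m.1.1.1.1; rewrite -w00 Em !mxE.
have [be Ebe] : exists be, W 1 1 = em s be by exists m.1.2.1.2; rewrite Em !mxE.
have := check_torusT; rewrite /check_torus => /andP [ht1 ht2].
have := all25P ht1 al; rewrite -(em_eq0 char5 s2) -Eal (negPf a0) orFb => /hasP [n _ /eqb25P En].
have := all25P ht2 be; rewrite (_ : eqb25 _ one25 = true) -?[~~ true]/false ?orFb; last first.
  apply/eqb25P; apply: (em_inj char5 s2).
  by rewrite (emM char5 s2) (emconj char5 s2) em1 -Ebe.
move=> /hasP [l _ /eqb25P El].
have hw : em s omega25 ^+ n = a by rewrite -em_pow25 -En -Eal.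
have hnu : em s (nth zero25 all25 18) ^+ l = W 1 1 by rewrite -em_pow25 -El -Ebe.
have [h1 h2] := torus_gens; have := permutesM (permutes_dgX n h1) (permutes_dgX l h2).
by rewrite dgM !expr1n !mul1r !mulr1 exprVn exprAC hw hnu -EW.
Qed.

Lemma mul_invmx_scale (u v : 'rV[k]_3) B b : B \in unitmx -> b != 0 -> u *m B = b *: v ->
  v *m invmx B = b^-1 *: u.
Proof.
move=> hB b0 e; have -> : v = b^-1 *: (u *m B) by rewrite e scalerA mulVf // scale1r.
by rewrite -scalemxAl mulmxK.
Qed.

(** Divide [W] by a product of generators with the same image of (1, 0, 0), then by one fixing (1,
    0, 0) with the same image of (0, 0, 1). What remains fixes both points and is covered by
    [permutes_torus]. *)
Lemma unitary_permutes W : unitary W -> permutes W.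
Proof.
move=> hW; have Wu := unitary_unit char5 hW.
have pt_of (v : v3) : rv v != 0 -> hermP (rv v) (rv v) = 0 ->
    exists2 x, (x < 126)%N & exists2 a, a != 0 & rv v = a *: rv (ptv x).
  move=> v0 hv; have [x126 e] := ptindexP char5 s2 v0 hv; exists (ptindex v) => //.
  by exists (em s (pivot v)); rewrite ?(rv_pivot char5 s2) // e -(normalizeP char5 s2).
have [m Em] := unitary_entries char5 s2 hW.
have [x x126 [a a0 ea]] : exists2 x, (x < 126)%N & exists2 a, a != 0 & row 0 W = a *: rv (ptv x).
  rewrite Em row_mx0; apply: pt_of; rewrite -row_mx0 -Em ?row_neq0 // hW !mxE //.
have [B1 hB1 [b b0 eb]] := move_from_e0 x126.
have B1u := unitary_unit char5 hB1.1.
pose W1 := W *m invmx B1.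
have hW1 : unitary W1 by apply: unitaryM => //; exact: unitaryV hB1.1.
have r0 : row 0 W1 = (a / b) *: e0.
  by rewrite row_mul ea -scalemxAl (mul_invmx_scale B1u b0 eb) scalerA.
have [m1 Em1] := unitary_entries char5 s2 hW1.
have W1u := unitary_unit char5 hW1.
have [y y126 [d d0 ed]] : exists2 x, (x < 126)%N & exists2 a, a != 0 & row 2%:R W1 = a *: rv (ptv x).
  rewrite Em1 row_mx2; apply: pt_of; rewrite -row_mx2 -Em1 ?row_neq0 // hW1 !mxE //.
(* Rows 0 and 2 have product 1, so they cannot both be multiples of the isotropic vector (1, 0,
   0). *)
have y0 : (0 < y)%N.
  rewrite lt0n; apply/eqP => y0; have := hW1 0 2%:R.
  rewrite r0 ed y0 hermP_scale (ptv_herm char5 s2) mulr0 mxE /= => /esym/eqP.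
  by rewrite oner_eq0.
have [B2 hB2 [[f f0 ef] [g g0 eg]]] := move_from_e2 (introT andP (conj y0 y126)).
have B2u := unitary_unit char5 hB2.1.
pose W2 := W1 *m invmx B2.
have hW2 : unitary W2 by apply: unitaryM => //; exact: unitaryV hB2.1.
have h2 : permutes W2.
  apply: (@permutes_torus _ (a / b / f) (d / g)) => //.
    by rewrite row_mul r0 -scalemxAl (mul_invmx_scale B2u f0 ef) scalerA rv_e0.
  by rewrite row_mul ed -scalemxAl (mul_invmx_scale B2u g0 eg) scalerA rv_e2.
have -> : W = W2 *m B2 *m B1 by rewrite /W2 /W1 !mulmxKV.
exact: permutesM (permutesM h2 hB2) hB1.
Qed.

End Generation.

(** * Lines, special secants and common secants *)

Section Lines.

Variables (k : fieldType).
Implicit Types (P : ppoint k) (L : pline k) (n : 'cV[k]_3) (u v : 'rV[k]_3).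

Definition lform n : 'Hom('rV[k]_3, 'rV[k]_1) := linfun (mulmxr n).

Lemma lformE n u : lform n u = u *m n.
Proof. by rewrite lfunE. Qed.

Lemma dim_lker_lform n : n != 0 -> \dim (lker (lform n)) == 2%N.
Proof.
move=> n0; have := limg_ker_dim (lform n) fullv; rewrite capfv !dimvf /= => h.
have d3 : dim 'rV[k]_3 = 3%N by rewrite /dim /= mul1n.
have d1 : dim 'rV[k]_1 = 1%N by rewrite /dim /= mul1n.
rewrite d3 in h; have le1 : (\dim (lform n @: fullv) <= 1)%N.
  by rewrite -[X in (_ <= X)%N]d1 -dimvf dimvS ?subvf.
suff : (\dim (lform n @: fullv) != 0)%N by move: h le1; case: (\dim (lform n @: _)) => [|[|]] //; rewrite addn1 => -[->].
rewrite dimv_eq0; apply: contraNneq n0 => z.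
have f0 u : u *m n = 0.
  by apply/eqP; rewrite -lformE -memv0 -z memv_img ?memvf.
apply/eqP/matrixP => i j; have /matrixP/(_ 0 j) := f0 (delta_mx 0 i).
by rewrite -rowE !mxE ord1.
Qed.

Lemma delta_col_neq0 : delta_mx 0 0 != 0 :> 'cV[k]_3.
Proof. by apply/eqP => /matrixP/(_ 0 0)/eqP; rewrite !mxE !eqxx oner_eq0. Qed.

Definition pl0 : pline k :=
  exist (fun U : {vspace 'rV[k]_3} => \dim U == 2%N) _ (dim_lker_lform delta_col_neq0).

(* The line with equation [u *m n = 0]; junk for [n = 0]. *)
Definition pl n : pline k := insubd pl0 (lker (lform n)).

Lemma val_pl n : n != 0 -> val (pl n) = lker (lform n).
Proof. by move=> n0; rewrite val_insubd dim_lker_lform. Qed.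

Lemma incident_pl n u : n != 0 -> u != 0 -> incident (pt u) (pl n) = (u *m n == 0).
Proof.
by move=> n0 u0; rewrite /incident val_pt // val_pl // -memvE memv_ker lformE.
Qed.

Lemma line_eq P P' L L' : P <> P' -> incident P L -> incident P' L ->
  incident P L' -> incident P' L' -> L = L'.
Proof.
move=> ne PL PL' P'L P'L'; have [dP dP'] := (eqP (valP P), eqP (valP P')).
have dj : \dim (val P + val P')%VS = 2%N.
  have := dimv_sum_cap (val P) (val P'); rewrite dP dP' => /eqP.
  have le1 : (\dim (val P :&: val P')%VS <= 1)%N.
    by apply: leq_trans (dimvS (capvSl _ _)) _; rewrite dP.
  suff : \dim (val P :&: val P')%VS != 1%N.
    by move: le1; case: (\dim (val P :&: val P')%VS) => [|[|//]] // _ _; rewrite addn0 => /eqP.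
  apply/eqP => d1; apply: ne; apply: val_inj; apply/eqP.
  have e1 : (val P :&: val P')%VS = val P by apply/eqP; rewrite eqEdim capvSl d1 dP.
  have e2 : (val P :&: val P')%VS = val P' by apply/eqP; rewrite eqEdim capvSr d1 dP'.
  by rewrite -[X in X == _]e1 e2.
have E (K : pline k) : incident P K -> incident P' K -> (val P + val P')%VS = val K.
  move=> h h'; apply/eqP; rewrite eqEdim dj (eqP (valP K)) leqnn andbT.
  by rewrite subv_add; apply/andP.
by apply: val_inj; rewrite -(E L) // -(E L').
Qed.

End Lines.

Section Secants.

Variables (k : fieldType) (char5 : 5%N \in [pchar k]) (s : k).
Hypothesis s2 : s ^+ 2 = 2%:R.
Hypothesis closed_root : forall n (c : k), (0 < n)%N -> exists x : k, x ^+ n = c.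
Variables (F : {mpoly k[3]}) (c : k).
Implicit Types (E B V W M : 'M[k]_3) (Q : conic k) (P : ppoint k) (L : pline k).

Local Notation rv := (rv s).
Local Notation mx := (mx s).
Local Notation pti := (pti s).
Local Notation frame E := (frame F E c).

Lemma contact_weierstrass E Q P : frame E -> tangent_conics F Q ->
  (Q `&` zeros F) P -> weierstrass F P.
Proof.
move=> fr hQ; have [W hW ->] := tangent_classify char5 closed_root fr hQ.
move=> /(contactP char5 fr _ hW) [n n6 ->].
have [W' hW' [<- _]] := bvec_unitary char5 fr n hW.
exact: (weierstrass_unitary char5 fr hW').
Qed.

Lemma secants_ofP E Q L : frame E -> tangent_conics F Q -> secants_of F Q L <->
  exists x y, [/\ (x < 126)%N, (y < 126)%N, x <> y, Q (pti E x) /\ Q (pti E y) &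
    incident (pti E x) L /\ incident (pti E y) L].
Proof.
move=> fr hQ; split.
  move=> [_ [P [P' [hP hP' ne PL P'L]]]].
  have [x xl ex] := contact_pti char5 s2 closed_root fr hQ hP.
  have [y yl ey] := contact_pti char5 s2 closed_root fr hQ hP'.
  exists x, y; split=> //; first by move=> e; apply: ne; rewrite ex ey e.
    by rewrite -ex -ey; split; [case: hP|case: hP'].
  by rewrite -ex -ey.
move=> [x [y [xl yl ne [Qx Qy] [xL yL]]]].
have hx : (Q `&` zeros F) (pti E x) by split=> //; exact: (pti_zeros char5 s2 _ fr).
have hy : (Q `&` zeros F) (pti E y) by split=> //; exact: (pti_zeros char5 s2 _ fr).
have nxy : pti E x <> pti E y by move/(pti_inj char5 s2 (frame_unit fr) xl yl).
split; last by exists (pti E x), (pti E y).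
by exists (pti E x), (pti E y); split=> //; apply: contact_weierstrass fr hQ _.
Qed.

Lemma base_contact E P : frame E ->
  (conicset E `&` zeros F) P <-> exists2 n, (n < 6)%N & P = pt (bvec k n *m E).
Proof.
move=> fr; have h := contactP char5 fr P (unitary1 k); rewrite mul1mx in h.
exact: h.
Qed.

Lemma base_tangent E : frame E -> tangent_conics F (conicset E).
Proof.
by move=> fr; have := tangent_conicset char5 fr (unitary1 k); rewrite mul1mx.
Qed.

Lemma base_bvec_inj E n m : frame E -> (n < 6)%N -> (m < 6)%N ->
  pt (bvec k n *m E) = pt (bvec k m *m E) -> n = m.
Proof.
by move=> fr n6 m6 e; apply: (bvec_inj char5 fr (unitary1 k) n6 m6); rewrite mul1mx.
Qed.

Definition normal E (ab : nat * nat) : 'cV[k]_3 := invmx E *m (rv (normal25 ab))^T.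

Lemma normal_incident E ab v : frame E -> rv v *m E *m normal E ab = 0 <->
  is0 (dot (normal25 ab) v).
Proof.
move=> fr; rewrite /normal mulmxA mulmxK ?(frame_unit fr) //.
have -> : (rv v *m (rv (normal25 ab))^T) = (em s (dot (normal25 ab) v))%:M.
  rewrite [LHS]mx11_scalar; congr (_%:M); rewrite (em_dot char5 s2) !mxE.
  by apply: eq_bigr => i _; rewrite !mxE mulrC.
rewrite -(em_eq0 char5 s2); split=> [/matrixP/(_ 0 0)|/eqP ->]; last by rewrite raddf0.
by rewrite !mxE eqxx mulr1n => ->.
Qed.

Lemma base_pairsP ab : ab \in base_pairs -> [/\ (ab.1 < 6)%N, (ab.2 < 6)%N & (ab.1 < ab.2)%N].
Proof.
case: ab => a b; rewrite mem_filter => /andP [lt /allpairsP [[a' b'] [ha hb [ea eb]]]].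
by move: ha hb; rewrite -[(_, _).1]ea -[(_, _).2]eb !mem_iota !add0n => /andP [_ ?] /andP [_ ?].
Qed.

Lemma base_line ab n : ab \in base_pairs -> (n < 6)%N ->
  is0 (dot (normal25 ab) (bvec25 n)) = (n == ab.1) || (n == ab.2).
Proof. move=> hab n6; have /allP/(_ _ hab) h := check_linesT.
by apply/eqP; exact: (all_iota h n6). Qed.

Lemma normal_neq0 E ab : frame E -> ab \in base_pairs -> normal E ab != 0.
Proof.
move=> fr hab; have [a6 b6 ab6] := base_pairsP hab.
have [n n6 hn] : exists2 n, (n < 6)%N & (n == ab.1) || (n == ab.2) = false.
  move: a6 b6 ab6; case: (ab) => -[|a] [|[|b]] // _ _ _.
  - by exists 2%N.
  - by exists 1%N.
  - by exists 0%N.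
apply/eqP => z; have := normal_incident ab (bvec25 n) fr; rewrite z mulmx0 base_line // hn.
by case=> /(_ erefl).
Qed.

Lemma incident_base E ab n : frame E -> ab \in base_pairs -> (n < 6)%N ->
  incident (pt (bvec k n *m E)) (pl (normal E ab)) = (n == ab.1) || (n == ab.2).
Proof.
move=> fr hab n6; rewrite incident_pl ?(normal_neq0 fr) ?mul_unit_neq0 ?bvec_neq0 ?(frame_unit fr) //.
rewrite -base_line // -(rv_bvec char5 s n6); apply/eqP/idP.
  by move/(normal_incident _ _ fr).
by move/(normal_incident _ _ fr).
Qed.

Lemma incident_pti E ab x : frame E -> ab \in base_pairs ->
  incident (pti E x) (pl (normal E ab)) = is0 (dot (normal25 ab) (ptv x)).
Proof.
move=> fr hab; rewrite incident_pl ?(normal_neq0 fr) ?mul_unit_neq0 ?(ptv_neq0 char5 s2) ?(frame_unit fr) //.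
by apply/eqP/idP; move/(normal_incident _ _ fr).
Qed.

Lemma base_secants E L : frame E -> secants_of F (conicset E) L <->
  exists2 ab, ab \in base_pairs & L = pl (normal E ab).
Proof.
move=> fr; have hb := base_tangent fr; split.
  move=> [_ [P [P' [/(base_contact _ fr) [n n6 ->] /(base_contact _ fr) [m m6 ->] ne PL P'L]]]].
  wlog nm : n m n6 m6 ne PL P'L / (n < m)%N.
    move=> H; have [lt|gt|e] := ltngtP n m; first exact: (H n m).
      by apply: (H m n) => // e; apply: ne.
    by case: ne; rewrite e.
  have hab : (n, m) \in base_pairs.
    rewrite mem_filter; apply/andP; split; first exact: nm.
    by apply/allpairsP; exists (n, m); split=> //; rewrite mem_iota.
  exists (n, m) => //; apply: (line_eq ne) => //; rewrite incident_base ?eqxx ?orbT //.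
move=> [ab hab ->]; have [a6 b6 lt] := base_pairsP hab.
have hz n : (n < 6)%N -> (conicset E `&` zeros F) (pt (bvec k n *m E)).
  by move=> n6; apply/(base_contact _ fr); exists n.
have ne : pt (bvec k ab.1 *m E) <> pt (bvec k ab.2 *m E).
  by move/(base_bvec_inj fr a6 b6) => e; move: lt; rewrite e ltnn.
split; last first.
  by exists (pt (bvec k ab.1 *m E)), (pt (bvec k ab.2 *m E)); split=> //; try exact: hz;
    rewrite incident_base ?eqxx ?orbT.
exists (pt (bvec k ab.1 *m E)), (pt (bvec k ab.2 *m E)); split=> //;
  rewrite ?incident_base ?eqxx ?orbT //; exact: contact_weierstrass fr hb (hz _ _).
Qed.

Lemma pl_inj E ab ab' : frame E -> ab \in base_pairs -> ab' \in base_pairs ->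
  pl (normal E ab) = pl (normal E ab') -> ab = ab'.
Proof.
move=> fr h h' e; have [a6 b6 lt] := base_pairsP h; have [a6' b6' lt'] := base_pairsP h'.
have := incident_base fr h a6; rewrite eqxx e incident_base // => e1.
have := incident_base fr h b6; rewrite eqxx orbT e incident_base // => e2.
move: lt lt' e1 e2; case: (ab) (ab') => [a b] [a' b'] /=; clear.
move=> lt lt' /orP [] /eqP e1 /orP [] /eqP e2; rewrite -?e1 -?e2 //; move: lt lt'; rewrite ?e1 ?e2; lia.
Qed.

(** The secants of the standard conic are its fifteen chords, and such a chord is a secant of [Q]
    exactly when it carries at least two of the points coded by [l]. *)
Lemma common_secants E Q lab l : frame E -> tangent_conics F Q ->
  size lab = 126 -> (forall x, (x < 126)%N -> Q (pti E x) <-> nth 0%N lab x = l) ->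
  forall m, (secants_of F (conicset E) `&` secants_of F Q #= `I_m) <->
    (common_lines [seq pull lab (line_pts ab) | ab <- base_pairs] l == m).
Proof.
move=> fr hQ sl hl m.
pose test ab := (1 < count (fun y => y == l) (pull lab (line_pts ab)))%N.
have testP ab : ab \in base_pairs -> test ab <-> secants_of F Q (pl (normal E ab)).
  move=> hab; rewrite (secants_ofP _ fr hQ) /test count_map.
  set a := preim _ _; rewrite -size_filter.
  have mem x : (x \in filter a (line_pts ab)) = [&& (x < 126)%N, is0 (dot (normal25 ab) (ptv x)) & nth 0%N lab x == l].
    by rewrite !mem_filter mem_iota /= /a /=; case: (x < 126)%N; rewrite ?andbT ?andbF // andbC.
  have uf : uniq (filter a (line_pts ab)) by rewrite !filter_uniq ?iota_uniq.
  split.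
    move: uf mem; case: (filter _ _) => [|x [|y r]] // /andP [nx _] mem _.
    have := mem x; rewrite mem_head => /esym/and3P [x126 dx /eqP ex].
    have := mem y; rewrite inE mem_head orbT => /esym/and3P [y126 dy /eqP ey].
    exists x, y; split=> //; [|by split; apply/hl|by rewrite !incident_pti].
    by move=> e; move: nx; rewrite e mem_head.
  move=> [x [y [x126 y126 ne [Qx Qy] []]]]; rewrite !incident_pti // => dx dy.
  have hx : x \in filter a (line_pts ab) by rewrite mem x126 dx; apply/eqP/hl.
  have hy : y \in filter a (line_pts ab) by rewrite mem y126 dy; apply/eqP/hl.
  move: hx hy; case: (filter _ _) => [|z [|? ?]] //.
  by rewrite !mem_seq1 => /eqP ex /eqP ey; case: ne; rewrite ex ey.
have -> : common_lines [seq pull lab (line_pts ab) | ab <- base_pairs] l =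
    size [seq i <- iota 0 15 | test (nth (0, 0)%N base_pairs i)].
  have Eb : base_pairs = [seq nth (0, 0)%N base_pairs i | i <- iota 0 15].
    by vm_cast_no_check (erefl base_pairs).
  by rewrite /common_lines count_map [in LHS]Eb count_map size_filter.
have nb i : (i < 15)%N -> nth (0, 0)%N base_pairs i \in base_pairs.
  by move=> i15; apply: mem_nth.
apply: (@card_seqP _ (fun i => pl (normal E (nth (0, 0)%N base_pairs i)))).
- by rewrite filter_uniq ?iota_uniq.
- move=> i j; rewrite !mem_filter !mem_iota /= => /andP [_ i15] /andP [_ j15].
  move/(pl_inj fr (nb i i15) (nb j j15)) => /eqP; rewrite nth_uniq // => /eqP //.
move=> L; split.
  move=> [/(base_secants _ fr) [ab hab ->] hs]; have := nth_index (0, 0)%N hab => e.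
  exists (index ab base_pairs); last by rewrite e.
  rewrite mem_filter e (iffRL (testP ab hab) hs) mem_iota add0n.
  by have := hab; rewrite -index_mem.
move=> [i]; rewrite mem_filter mem_iota /= => /andP [ht i15] ->.
split; last by apply/testP => //; exact: nb.
by apply/(base_secants _ fr); eexists; first exact: (nb i i15).
Qed.

End Secants.

(** Roots on the projective line, with [None] for infinity; a root at infinity is paid for by a drop
    of the degree. *)
Lemma card_optional_roots (k : fieldType) (q : {poly k}) (S : seq (option k)) n :
  q != 0 -> (size q + (None \in S) <= n)%N -> uniq S ->
  (forall t, Some t \in S -> root q t) -> (size S < n)%N.
Proof.
move=> q0 hn uS hS; apply: leq_trans hn.
have -> : size S = (size (pmap id S) + (None \in S))%N.
  rewrite size_pmap -(count_predC (pred1 None) S) addnC; congr (_ + _)%N.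
    by apply: eq_count => -[].
  by rewrite count_uniq_mem.
rewrite -addSn leq_add2r; apply: max_poly_roots q0 _ _.
  by apply/allP => t; rewrite mem_pmap => /mapP [o oS e]; apply: hS; rewrite e.
by apply: (pmap_uniq (g := Some)) uS => -[].
Qed.

Lemma deriv_Poly5 (R : comNzRingType) (b0 b1 b2 b3 b4 u : R) :
  (Poly [:: b0; b1; b2; b3; b4])^`().[u] =
  b1 + u * (2%:R * b2 + u * (3%:R * b3 + u * (4%:R * b4))).
Proof. by rewrite /= !cons_poly_def mul0r add0r !(derivE, hornerE) /=; ring. Qed.

Lemma quad_two_pairs (k : fieldType) (E : 'M[k]_3) (l1 l2 l3 l4 : 'cV[k]_3) a b
    (y : 'rV[k]_3) : E \in unitmx ->
  (quad (invmx E *m (a *: (l1 *m l2^T) - b *: (l3 *m l4^T)) *m (invmx E)^T)).@[(y *m E) 0] =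
  a * ((y *m l1) 0 0 * (y *m l2) 0 0) - b * ((y *m l3) 0 0 * (y *m l4) 0 0).
Proof.
move=> Eu; rewrite meval_quad.
rewrite trmx_mul !mulmxA mulmxK // -[_ *m _ *m E^T]mulmxA -trmx_mul mulmxV // trmx1 mulmx1.
have h (u v : 'cV[k]_3) : (y *m (u *m v^T) *m y^T) 0 0 = (y *m u) 0 0 * (y *m v) 0 0.
  have -> : y *m (u *m v^T) *m y^T = (y *m u) *m (y *m v)^T by rewrite trmx_mul !mulmxA.
  by rewrite [LHS]mxE big_ord1 [X in _ * X]mxE.
rewrite mulmxBr mulmxBl -!scalemxAr -!scalemxAl.
by rewrite [LHS]mxE [X in X + _]mxE [X in _ + X]mxE [X in _ - X]mxE !h.
Qed.

(** * Counting the intersection of a coded conic with the standard one *)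

Section Quartic.

Variables (k : fieldType) (char5 : 5%N \in [pchar k]) (s : k).
Hypothesis s2 : s ^+ 2 = 2%:R.
Hypothesis closed_root : forall n (c : k), (0 < n)%N -> exists x : k, x ^+ n = c.
Variables (F : {mpoly k[3]}) (c : k).
Implicit Types (E B V W M : 'M[k]_3) (Q : conic k) (P : ppoint k).

Local Notation em := (em s).
Local Notation rv := (rv s).
Local Notation pti := (pti s).
Local Notation frame E := (frame F E c).

Opaque pts ptv.

Definition conicpt E (o : option k) : ppoint k :=
  pt ((if o is Some t then cvec t else cinf k) *m E).

Lemma conicpt_inj E : E \in unitmx -> injective (conicpt E).
Proof.
move=> Eu [t|] [t'|] /pt_inj []; rewrite ?mul_unit_neq0 ?cvec_neq0 ?cinf_neq0 // => d d0;
  rewrite scalemxAl => /(can_inj (mulmxK Eu)) /rowP e.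
- have := e 0; rewrite !mxE !expr0 mulr1 => d1; have := e 1.
  by rewrite !mxE -d1 mul1r !expr1 => ->.
- by have /eqP := e 0; rewrite !mxE expr0 mulr0 oner_eq0.
- by have /esym/eqP := e 0; rewrite !mxE expr0 mulr1 (negPf d0).
Qed.

Definition poly_of (cs : seq f25) : {poly k} := Poly [seq em a | a <- cs].

Lemma horner_poly_of cs t : (poly_of cs).[em t] = em (horner25 cs t).
Proof.
rewrite /poly_of horner_Poly; elim: cs => [|a cs IH] /=; first by rewrite em0.
by rewrite IH (emD char5) (emM char5 s2) addrC mulrC.
Qed.

Lemma poly_of_deriv a0 a1 a2 a3 a4 t (cs := [:: a0; a1; a2; a3; a4]) :
  (poly_of cs)^`().[em t] = em (horner25 (deriv4 cs) t).
Proof.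
have e2 : em (F2, F0) = 2%:R by rewrite /em /= mul0r addr0.
have e3 : em (F3, F0) = 3%:R by rewrite /em /= mul0r addr0.
have e4 : em (F4, F0) = 4%:R by rewrite /em /= mul0r addr0.
rewrite /poly_of /cs ![map _ _]/= deriv_Poly5.
rewrite [horner25 _ _](_ : _ = add25 a1 (mul25 t (add25 (mul25 (F2, F0) a2) (mul25 t (add25 (mul25 (F3, F0) a3)
  (mul25 t (add25 (mul25 (F4, F0) a4) (mul25 t zero25)))))))) //.
rewrite !(emD char5, emM char5 s2) e2 e3 e4 em0.
ring.
Qed.

Lemma size_quartic p : size (quartic p) = 5%N. Proof. by rewrite size_map size_iota. Qed.

(** A nonzero binary quartic has at most four roots: four known ones are therefore all, and a double
    root leaves at most three. *)
Lemma card_roots E cs (A : set (ppoint k)) (q := poly_of cs) nb : size cs = 5%N -> E \in unitmx ->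
  (forall P, A P <-> exists2 o : option k,
     (if o is Some t then q.[t] = 0 else q`_4 = 0) & P = conicpt E o) ->
  q != 0 -> (if nb then (4 <= root_count cs)%N else double_root cs) ->
  A #= `I_4 <-> nb.
Proof.
move=> scs Eu hA q0.
have sq : (size q <= 5)%N by rewrite (leq_trans (size_Poly _)) // size_map scs.
have ci i : (i < 5)%N -> q`_i = em (nth zero25 cs i).
  by move=> i5; rewrite /q /poly_of coef_Poly (nth_map zero25) ?scs.
have c4 := ci 4%N isT; have c3 := ci 3%N isT.
have sz4 n : (size q <= n.+1)%N -> q`_n = 0 -> (size q <= n)%N.
  move=> le z; rewrite leqNgt; apply/negP => lt.
  have en : size q = n.+1 by apply/eqP; rewrite eqn_leq le lt.
  by move/eqP: q0; apply; apply/eqP; rewrite -lead_coef_eq0 lead_coefE en z.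
pose rt (o : option k) := if o is Some t then q.[t] = 0 else q`_4 = 0.
have rt_size (S : seq (option k)) : (forall o, o \in S -> rt o) -> (size q + (None \in S) <= 5)%N.
  move=> h; case hN: (None \in S); last by rewrite addn0.
  by rewrite addn1 ltnS; apply: sz4 sq (h None hN).
have bound (S : seq (option k)) : uniq S -> (forall o, o \in S -> rt o) -> (size S <= 4)%N.
  move=> uS h; apply: card_optional_roots q0 (rt_size S h) uS _ => t /h e; exact/eqP.
case: nb => [rc|dr].
  split=> // _.
  pose S := [seq Some (em t) | t <- all25 & is0 (horner25 cs t)] ++
    (if is0 (nth zero25 cs 4) then [:: None] else [::]).
  have hS o : o \in S -> rt o.
    rewrite mem_cat => /orP [/mapP [t]|].
      by rewrite mem_filter -(em_eq0 char5 s2) -horner_poly_of => /andP [/eqP e _] ->.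
    by case: ifP => // z; rewrite mem_seq1 => /eqP -> /=; rewrite c4; apply/eqP; rewrite (em_eq0 char5 s2).
  have uS : uniq S.
    have u25 : uniq all25 by [].
    rewrite cat_uniq map_inj_uniq; last by move=> t t' [/(em_inj char5 s2)].
    apply/and3P; split; [exact: filter_uniq u25| |by case: ifP].
    apply/hasPn => o; case: ifP => // _; rewrite mem_seq1 => /eqP ->.
    by apply/mapP => -[].
  have sS : size S = 4%N.
    apply/eqP; rewrite eqn_leq bound //= size_cat size_map size_filter.
    by apply: leq_trans rc _; rewrite leq_add2l; case: is0.
  clearbody S; apply/card_ordP; exists (fun i : 'I_4 => conicpt E (nth None S i)); split.
    move=> i j /(conicpt_inj Eu)/eqP; rewrite nth_uniq ?sS // => /eqP; exact: val_inj.
  move=> P; rewrite hA; split=> [[o ho ->]|[i ->]]; last first.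
    by exists (nth None S i) => //; apply: hS; rewrite mem_nth ?sS.
  have oS : o \in S.
    apply: contraT => oS; suff : (size (o :: S) <= 4)%N by rewrite /= sS.
    by apply: bound; rewrite /= ?oS // => o'; rewrite inE => /orP [/eqP ->|/hS].
  have io : (index o S < 4)%N by rewrite -sS index_mem.
  by exists (Ordinal io); rewrite /= nth_index.
split=> // /card_ordP [f [fi fA]].
have ex i : exists o, rt o /\ f i = conicpt E o.
  by have [o ho e] := iffLR (hA _) (iffRL (fA (f i)) (ex_intro _ i erefl)); exists o.
have [g hg] := boolp.choice ex.
pose S := [seq g i | i <- enum 'I_4].
have uS : uniq S.
  rewrite map_inj_uniq ?enum_uniq // => i j e; apply: fi.
  by have [_ ->] := hg i; have [_ ->] := hg j; rewrite e.
have hS o : o \in S -> rt o by move=> /mapP [i _ ->]; case: (hg i).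
suff : (size S < 4)%N by rewrite size_map size_enum_ord.
case/orP: dr => [/hasP [t _ /andP [h1 h2]]|/andP [h1 h2]]; last first.
  have z4 : q`_4 = 0 by rewrite c4; apply/eqP; rewrite (em_eq0 char5 s2).
  have z3 : q`_3 = 0 by rewrite c3; apply/eqP; rewrite (em_eq0 char5 s2).
  have sq3 := sz4 3%N (sz4 4%N sq z4) z3.
  apply: card_optional_roots q0 _ uS _; last by move=> u /hS e; exact/eqP.
  by case: (None \in S); rewrite ?addn1 ?addn0 // ltnW.
have r1 : root q (em t) by rewrite /root horner_poly_of (em_eq0 char5 s2).
(* The root being double, the cofactor [q1] keeps all finite roots of [q] with one degree less. *)
have [q1 Eq1] := factor_theorem q (em t) r1.
have q10 : q1 != 0 by apply: contraNneq q0 => z; rewrite Eq1 z mul0r.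
have r2 : q1.[em t] = 0.
  have : q^`().[em t] = 0.
    move: h2; rewrite -(em_eq0 char5 s2) /q; move: scs.
    case: (cs) => [|a0 [|a1 [|a2 [|a3 [|a4 [|]]]]]] // _ /eqP <-; exact: poly_of_deriv.
  by rewrite Eq1 derivM derivXsubC !hornerE subrr mulr0 add0r.
have sq1 : size q = (size q1).+1.
  by rewrite Eq1 size_Mmonic ?monicXsubC // size_XsubC addn2.
apply: card_optional_roots q10 _ uS _; first by have := rt_size S hS; rewrite sq1 addSn.
move=> u /hS /= e; have : root q u by exact/eqP.
rewrite Eq1 rootM root_XsubC => /orP [//|/eqP ->]; exact/eqP.
Qed.

Definition conic5_mx E p : 'M[k]_3 :=
  let q i := ptv (nth 0%N p i) in
  let L i j := cross (q i) (q j) in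
  let a := em (mul25 (dot (L 0 2) (q 4)) (dot (L 1 3) (q 4)))%N in
  let b := em (mul25 (dot (L 0 1) (q 4)) (dot (L 2 3) (q 4)))%N in
  let l i j : 'cV[k]_3 := (rv (L i j))^T in
  invmx E *m (a *: (l 0 1 *m (l 2 3)^T)%N - b *: (l 0 2 *m (l 1 3)^T)%N) *m (invmx E)^T.

Lemma conic5_eval E p (y : 'rV[k]_3)
    (q := fun i => ptv (nth 0%N p i)) (L := fun i j => cross (q i) (q j))
    (l := fun i j => (y *m (rv (L i j))^T) 0 0)
    (d := fun i j => em (dot (L i j) (q 4%N))) : E \in unitmx ->
  (quad (conic5_mx E p)).@[(y *m E) 0] =
  d 0%N 2%N * d 1%N 3%N * (l 0%N 1%N * l 2%N 3%N) -
  d 0%N 1%N * d 2%N 3%N * (l 0%N 2%N * l 1%N 3%N).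
Proof.
move=> Eu; rewrite /conic5_mx (quad_two_pairs _ _ _ _ _ _ _ Eu).
by congr (_ * _ - _ * _); rewrite (emM char5 s2).
Qed.

Lemma cvec_lform t (L : v3) : (cvec t *m (rv L)^T) 0 0 = em L.1.1 + t * em L.1.2 + t ^+ 2 * em L.2.
Proof. by rewrite mxE sum3 !mxE /= expr0 mul1r. Qed.

Lemma cinf_lform (L : v3) : (cinf k *m (rv L)^T) 0 0 = em L.2.
Proof. by rewrite mxE sum3 !mxE /= !mul0r !add0r mul1r. Qed.

Definition quartic_of a b (L1 L2 L3 L4 : v3) : seq f25 :=
  [seq sub25 (mul25 a (nth zero25 (qmul L1 L2) i)) (mul25 b (nth zero25 (qmul L3 L4) i)) | i <- iota 0 5].

Lemma quartic_of_eval a b L1 L2 L3 L4 t (l := fun L => (cvec t *m (rv L)^T) 0 0) :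
  em a * (l L1 * l L2) - em b * (l L3 * l L4) = (poly_of (quartic_of a b L1 L2 L3 L4)).[t].
Proof.
rewrite /l !cvec_lform /poly_of /quartic_of -[iota 0 5]/[:: 0; 1; 2; 3; 4]%N /qmul.
rewrite ![map _ _]/= horner_Poly /=.
rewrite !(emB char5, emD char5, emM char5 s2); ring.
Qed.

Lemma quartic_of_inf a b L1 L2 L3 L4 (l := fun L => (cinf k *m (rv L)^T) 0 0) :
  em a * (l L1 * l L2) - em b * (l L3 * l L4) = (poly_of (quartic_of a b L1 L2 L3 L4))`_4.
Proof.
rewrite /l !cinf_lform /poly_of /quartic_of coef_Poly (nth_map zero25) ?size_map ?size_iota //.
rewrite (nth_map 0%N) ?size_iota // nth_iota // /qmul add0n ![nth _ _ 4]/=.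
by rewrite !(emB char5, emM char5 s2).
Qed.

Lemma quartic_eval E p t : E \in unitmx ->
  (quad (conic5_mx E p)).@[(cvec t *m E) 0] = (poly_of (quartic p)).[t].
Proof.
move=> Eu; rewrite /conic5_mx (quad_two_pairs _ _ _ _ _ _ _ Eu); exact: quartic_of_eval.
Qed.

Lemma quartic_inf E p : E \in unitmx ->
  (quad (conic5_mx E p)).@[(cinf k *m E) 0] = (poly_of (quartic p))`_4.
Proof.
move=> Eu; rewrite /conic5_mx (quad_two_pairs _ _ _ _ _ _ _ Eu); exact: quartic_of_inf.
Qed.

Lemma em_two_pairs a b L1 L2 L3 L4 y (l := fun L => (rv y *m (rv L)^T) 0 0) :
  em a * (l L1 * l L2) - em b * (l L3 * l L4) =
  em (sub25 (mul25 a (mul25 (dot L1 y) (dot L2 y))) (mul25 b (mul25 (dot L3 y) (dot L4 y)))).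
Proof.
have dl L : l L = em (dot L y) by rewrite (em_dot char5 s2) /l !mxE; apply: eq_bigr => i _; rewrite !mxE mulrC.
by rewrite (emB char5) !(emM char5 s2) !dl.
Qed.

Lemma conic5_pti E p v : E \in unitmx ->
  (quad (conic5_mx E p)).@[(rv v *m E) 0] = em (conic5 p v).
Proof.
move=> Eu; rewrite /conic5_mx (quad_two_pairs _ _ _ _ _ _ _ Eu); exact: em_two_pairs.
Qed.

(** The conic constructed from [p] vanishes at all contact points of [Q], hence its equation is a
    multiple of that of [Q]. Intersections with the standard conic are then roots of [quartic p]. *)
Lemma check_conicP E Q p nb : frame E -> tangent_conics F Q ->
  (forall x, (x < 126)%N -> Q (pti E x) -> x \in p) -> check_conic p nb ->
  conicset E `&` Q #= `I_4 <-> nb.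
Proof.
move=> fr hQ hp /and3P [/allP hz hne hr]; have Eu := frame_unit fr.
have [W hW EQ] := tangent_classify char5 closed_root fr hQ.
have Vu := unitary_frame_unit char5 fr hW.
have q0 : poly_of (quartic p) != 0.
  case/(has_nthP zero25): hne => i; rewrite size_quartic => i5 ni.
  apply: contraNneq ni => /(congr1 (fun r : {poly k} => r`_i)).
  rewrite coef0 /poly_of coef_Poly (nth_map zero25) ?size_quartic // => /eqP.
  by rewrite (em_eq0 char5 s2).
have zq := zeros_pt (quad_homog (conic5_mx E p)).
have [alpha Ea] : exists alpha, quad (conic5_mx E p) = alpha *: cform (W *m E).
  apply: conic_through => // n n5.
  have hn : (Q `&` zeros F) (pt (bvec k n *m (W *m E))).
    by rewrite EQ; apply/(contactP char5 fr _ hW); exists n; rewrite // ltnW.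
  have [x x126 e] := contact_pti char5 s2 closed_root fr hQ hn.
  have xp : x \in p by apply: hp x126 _; rewrite -e; case: hn.
  have e' : zeros (quad (conic5_mx E p)) (pti E x).
    apply/zq; first by rewrite mul_unit_neq0 ?(ptv_neq0 char5 s2).
    by rewrite conic5_pti //; apply/eqP; rewrite (em_eq0 char5 s2); exact: hz.
  rewrite -e in e'; have := iffLR (zq _ (mul_unit_neq0 Vu (bvec_neq0 k n))) e'.
  by rewrite /bvec n5.
have a0 : alpha != 0.
  (* Otherwise the nonzero quartic would vanish at all 25 elements of F_25. *)
  apply/eqP => z; rewrite z scale0r in Ea.
  have rt t : root (poly_of (quartic p)) t.
    by apply/eqP; rewrite -(quartic_eval p t Eu) Ea meval0.
  have u25 : uniq [seq Some (em t) | t <- all25].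
    by rewrite map_inj_uniq // => t t' [/(em_inj char5 s2)].
  have := @card_optional_roots _ _ _ 6 q0 _ u25 (fun t _ => rt t).
  rewrite size_map => h; suff : (25 < 6)%N by []; apply: h.
  rewrite -[6%N]/(5 + 1)%N leq_add ?leq_b1 //.
  by rewrite (leq_trans (size_Poly _)) // size_map size_quartic.
have EQ' : Q = zeros (quad (conic5_mx E p)) by rewrite Ea zeros_scale.
apply: (card_roots (size_quartic p) Eu _ q0 hr) => P; rewrite EQ'; split.
  move=> [/(conicsetP _ Eu) [[t ->]|->] /zq]; rewrite mul_unit_neq0 ?cvec_neq0 ?cinf_neq0 //.
    by rewrite quartic_eval // => /(_ isT) e; exists (Some t).
  by rewrite quartic_inf // => /(_ isT) e; exists None.
move=> [[t|] h ->]; split.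
- by apply/(conicsetP _ Eu); left; exists t.
- by apply/zq; rewrite ?mul_unit_neq0 ?cvec_neq0 ?quartic_eval.
- by apply/(conicsetP _ Eu); right.
- by apply/zq; rewrite ?mul_unit_neq0 ?cinf_neq0 ?quartic_inf.
Qed.

End Quartic.

Section Components.

Variables (T : Type) (V : set T) (adj : T -> T -> Prop).

Lemma connected_in_closed (D : set T) : (forall x y, V x -> V y -> adj x y -> D x <-> D y) ->
  forall x y, connected_in V adj x y -> D x <-> D y.
Proof.
move=> h x y; elim=> {x y} [x y [Vx Vy xy]|x|x y _ [IH IH']|x y z _ [h1 h1'] _ [h2 h2']] //.
- exact: h.
- by split=> [/h1/h2|/h2'/h1'].
Qed.

Lemma component_eq (D : set T) x : D `<=` V -> D x ->
  (forall y z, V y -> V z -> adj y z -> D y <-> D z) ->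
  (forall y, D y -> connected_in V adj x y) ->
  [set y | V y /\ connected_in V adj x y] = D.
Proof.
move=> DV Dx hD hc; apply/seteqP; split=> y /= => [[Vy /(connected_in_closed hD)]|Dy].
  by move=> [h _]; exact: h.
by split; [exact: DV|exact: hc].
Qed.

End Components.

(** * The connected components of [G] are the 150 blocks *)

Section BaseComponent.

Variables (k : fieldType) (char5 : 5%N \in [pchar k]) (s : k).
Hypothesis s2 : s ^+ 2 = 2%:R.
Hypothesis closed_root : forall n (c : k), (0 < n)%N -> exists x : k, x ^+ n = c.
Variables (F : {mpoly k[3]}) (c : k).
Implicit Types (E B V W M : 'M[k]_3) (Q : conic k) (P : ppoint k).

Local Notation em := (em s).
Local Notation rv := (rv s).
Local Notation mx := (mx s).
Local Notation pti := (pti s).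
Local Notation dset := (dset s F).
Local Notation frame E := (frame F E c).
Local Notation linked := (connected_in (tangent_conics F) (adjG F)).

Opaque pts ptv lab0 labs ptindex gens stabs ptperm.

Definition coded E lab l Q := tangent_conics F Q /\
  forall x, (x < 126)%N -> Q (pti E x) <-> nth 0%N lab x = l.

Lemma coded_inj E lab l Q Q' : frame E -> coded E lab l Q -> coded E lab l Q' -> Q = Q'.
Proof.
move=> fr [hQ h] [hQ' h']; apply: (code_inj char5 s2 closed_root fr hQ hQ') => x x126.
by move/(h _ x126)/(h' _ x126).
Qed.

Lemma dsetP E i Q : dset E i Q <->
  exists2 x, (x < 126)%N & coded E (nth [::] labs i) (nth 0%N (nth [::] labs i) x) Q.
Proof.
by split=> [[hQ [x x126 h]]|[x x126 [hQ h]]]; [exists x|split=> //; exists x].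
Qed.

Lemma labs0 : nth [::] labs 0 = lab0.
Proof. by vm_cast_no_check (erefl lab0). Qed.

Lemma lab0_onto l : (l < 21)%N -> exists2 x, (x < 126)%N & nth 0%N lab0 x = l.
Proof.
have /and5P [_ _ _ _ /and5P [_ _ _ _ /all_iota h]] := check_permsT.
move=> /h hl; exists (index l lab0); last exact: nth_index.
by rewrite -(size_lab (i := 0)) // labs0 index_mem.
Qed.

Lemma base_coded E : frame E -> coded E lab0 0%N (conicset E).
Proof.
move=> fr; split=> [|x x126]; first exact: (base_tangent char5 fr).
have [_ _ _ hb] := and4P check_baseT; have /eqP h := all_iota hb x126.
have bi n : (n < 6)%N -> (ptindex (bvec25 n) < 126)%N /\
    pt (bvec k n *m E) = pti E (ptindex (bvec25 n)).
  move=> n6; rewrite -(rv_bvec char5 s n6).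
  have b0 : rv (bvec25 n) != 0 by rewrite (rv_bvec char5 s n6); exact: bvec_neq0.
  have bz : hermP (rv (bvec25 n)) (rv (bvec25 n)) = 0.
    rewrite (rv_bvec char5 s n6).
    apply: (iffLR (zeros_frame fr (bvec_neq0 k n))).
    suff [] : (conicset E `&` zeros F) (pt (bvec k n *m E)) by [].
    by apply/(base_contact char5 _ fr); exists n.
  split; first by case: (ptindexP char5 s2 b0 bz).
  by rewrite (pti_index char5 s2 (frame_unit fr) b0 bz).
transitivity (nth 0%N lab0 x == 0%N : Prop); last by split=> /eqP.
rewrite h; split.
  move=> hx; have : (conicset E `&` zeros F) (pti E x) 
    by split; [exact: hx|exact: (pti_zeros char5 s2 _ fr)].
  move=> /(base_contact char5 _ fr) [n n6]; have [b126 ->] := bi n n6.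
  move=> /(pti_inj char5 s2 (frame_unit fr) x126 b126) ->.
  by apply/mapP; exists n; first by rewrite mem_iota.
move=> /mapP [n]; rewrite mem_iota => /andP [_ n6] ->.
have [_ <-] := bi n n6.
suff [] : (conicset E `&` zeros F) (pt (bvec k n *m E)) by [].
by apply/(base_contact char5 _ fr); exists n.
Qed.

Definition stab i := nth ((p0, p0), p0) stabs i.

Lemma stab_facts i : (i < 2)%N -> [/\ unitary25 (stab i),
  inverse_pair 126 (ptperm (stab i)) (inv_perm (ptperm (stab i))),
  same_fibres (pull lab0 (inv_perm (ptperm (stab i)))) lab0 &
  inverse_pair 21 (label_perm (stab i)) (inv_perm (label_perm (stab i))) /\
  (nth 0%N (label_perm (stab i)) 0 < 11)%N].
Proof.
have ss : size stabs = 2%N by vm_cast_no_check (erefl 2%N).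
move=> i2; have im : stab i \in stabs by rewrite mem_nth ?ss.
have /and5P [_ /allP hu /allP hp _ _] := check_permsT.
have /and4P [/allP hs /allP hl _ _] := check_baseT.
split; first by apply: hu; rewrite mem_cat im.
- by apply: hp; rewrite mem_cat map_f.
- exact: hs.
- by have /andP [] := hl _ (map_f label_perm im).
Qed.

Lemma stab_coded E i l Q : frame E -> (i < 2)%N -> (l < 21)%N ->
  coded (mx (stab i) *m E) lab0 l Q -> coded E lab0 (nth 0%N (label_perm (stab i)) l) Q.
Proof.
move=> fr i2 l21 [hQ h]; have [hu /inverse_pairP [sp sq hp hq] /same_fibresP hf _] := stab_facts i2.
have sl : size lab0 = 126%N by rewrite -labs0 size_lab.
rewrite sl in hf; split=> // y y126; have [qy qK] := hq y y126.
have /and5P [_ _ _ _ /and5P [_ _ _ _ /all_iota hin]] := check_permsT.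
have z126 : (index l lab0 < 126)%N by rewrite -sl index_mem hin.
have [pz pK] := hp _ z126.
have -> : nth 0%N (label_perm (stab i)) l = nth 0%N lab0 (nth 0%N (ptperm (stab i)) (index l lab0)).
  by rewrite (nth_map 0%N) ?size_iota // nth_iota.
rewrite -hf // !nth_pull ?sq // pK nth_index ?hin // -h //.
rewrite (pti_mul char5 s2) ?(frame_unit fr) //.
have -> : ptindex (vmul (ptv (nth 0%N (inv_perm (ptperm (stab i))) y)) (stab i)) =
    nth 0%N (ptperm (stab i)) (nth 0%N (inv_perm (ptperm (stab i))) y).
  by rewrite [in RHS](nth_map p0) ?size_pts.
by rewrite qK.
Qed.

Lemma dset_stab E i : frame E -> (i < 2)%N -> dset (mx (stab i) *m E) 0 = dset E 0.
Proof.
move=> fr i2; have [hu hp hf _] := stab_facts i2.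
rewrite -labs0 in hf; exact: (dsetl_perm char5 s2 fr hu (size_lab (isT : (0 < 150)%N)) hp hf).
Qed.

Lemma adjG_sym Q Q' : adjG F Q Q' -> adjG F Q' Q.
Proof.
by move=> [ne h1 h2]; split; [move=> e; apply: ne|rewrite setIC|rewrite setIC].
Qed.

(** The conic is the standard conic of the frame [W *m E], hence lies in block 0 of that frame, and
    [W] permutes the blocks. *)
Lemma cover E Q : frame E -> tangent_conics F Q -> exists2 i, (i < 150)%N & dset E i Q.
Proof.
move=> fr hQ; have [W hW ->] := tangent_classify char5 closed_root fr hQ.
have [_ h] := unitary_permutes char5 s2 F c hW.
have [j j150 ej] := (h E fr).1 0%N isT; exists j => //; rewrite -ej.
have [x x126 e] := lab0_onto (isT : (0 < 21)%N).
apply/dsetP; exists x; rewrite // labs0 e; exact: base_coded (frame_mul char5 fr hW).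
Qed.

(** By [cover] each candidate is a coded conic, and [check_nbr] has decided all of these. *)
Lemma neighbours E Q : frame E -> tangent_conics F Q ->
  adjG F (conicset E) Q <-> exists2 l, l \in nb_labels & coded E lab0 l Q.
Proof.
move=> fr hQ.
have check j x : (j < 150)%N -> (x < 126)%N -> let lab := nth [::] labs j in
    let l := nth 0%N lab x in coded E lab l Q ->
    (conicset E `&` Q #= `I_4 /\ secants_of F (conicset E) `&` secants_of F Q #= `I_3) <->
    (j == 0) && (l \in nb_labels).
  move=> j150 x126 lab l [_ hl].
  have l21 : (l < 21)%N := lab_lt j150 x126.
  have sl : size lab = 126%N := size_lab j150.
  have hall := all_iota check_nbrT j150; lazy beta zeta in hall.
  have := all_iota hall l21; clear hall; lazy beta zeta; rewrite -/lab.
  have := common_secants char5 s2 closed_root fr hQ sl hl 3 => hs.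
  case: ifP => [h3 hc|h3 /negbTE ->].
    have hf y : (y < 126)%N -> Q (pti E y) -> y \in fibre lab l.
      by move=> y126 /(hl y y126) /eqP e; rewrite mem_filter e mem_iota.
    have h4 := check_conicP char5 s2 closed_root fr hQ hf hc.
    by split=> [[/h4]|/h4 ?] //; split=> //; apply/hs.
  by split=> // -[_ /hs]; rewrite h3.
split=> [[_ h4 h3]|[l hl hc]].
  have [j j150 /dsetP [x x126 hc]] := cover fr hQ.
  have /andP [/eqP j0 hl] := iffLR (check j x j150 x126 hc) (conj h4 h3).
  by move: hc hl; rewrite j0 labs0; exists (nth 0%N lab0 x).
have /andP [l0 l11] : (0 < l < 11)%N by move: hl; rewrite mem_iota.
have [x x126 e] := lab0_onto (leq_trans l11 (isT : (11 <= 21)%N)).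
have := check 0%N x isT x126; lazy zeta; rewrite labs0 e eqxx => /(_ hc) [_ /(_ hl) [h4 h3]].
split=> // EQ; have [y y126 ey] := lab0_onto (isT : (0 < 21)%N).
have := iffRL ((base_coded fr).2 y y126) ey; rewrite EQ => /(hc.2 y y126).
by rewrite ey => e0; rewrite -e0 in l0.
Qed.

(** A matrix of [stabs] keeps block 0 and sends the standard conic to itself or to a neighbour. As
    these matrices are transitive on labels, each conic of the block is the standard conic of a
    frame with the same block, and is linked to the original one. *)
Lemma reframe E l : frame E -> (l < 21)%N -> exists E', [/\ frame E', coded E lab0 l (conicset E'),
  dset E' 0 = dset E 0 & linked (conicset E) (conicset E')].
Proof.
move=> fr l21; move: l l21 E fr.
have [_ _ hr _] := and4P check_baseT.
pose lps := [seq label_perm m | m <- stabs].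
have slps : size lps = 2%N by vm_cast_no_check (erefl 2%N).
have nlps i : (i < 2)%N -> nth [::] lps i = label_perm (stab i).
  by move=> i2; rewrite (nth_map ((p0, p0), p0)) // -(size_map label_perm) slps.
have hr' : all id (reach [seq inv_perm p | p <- lps] 21 0 20) := hr.
clearbody lps; clear hr; move=> l l21; apply: (@reachP (fun l => forall E, frame E -> exists E', [/\ frame E',
    coded E lab0 l (conicset E'), dset E' 0 = dset E 0 & linked (conicset E) (conicset E')])
  lps [seq inv_perm p | p <- lps] 21 0 20 _ isT _ _ l l21 _).
- move=> i; rewrite size_map slps => i2; rewrite (nth_map [::]) ?slps // nlps //.
  by have [_ _ _ []] := stab_facts i2.
- move=> E fr; exists E; split=> //; [exact: base_coded|exact: rst_refl].
- move=> i y; rewrite size_map slps => i2 y21 IH E fr; rewrite nlps //.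
  have [hu _ _ [hp p11]] := stab_facts i2; have hU := mx_unitary char5 s2 hu.
  have fr1 := frame_mul char5 fr hU; have [E' [fr' hc' hd' hl']] := IH _ fr1.
  exists E'; split=> //; first exact: stab_coded fr i2 y21 hc'.
    by rewrite hd' dset_stab.
  apply: rst_trans hl'.
  have hb := stab_coded fr i2 (isT : (0 < 21)%N) (base_coded fr1).
  (* Label 0 means that the conic has not moved; any other label below 11 is that of a neighbour. *)
  have [z|nz] := posnP (nth 0%N (label_perm (stab i)) 0).
    rewrite z in hb; rewrite (coded_inj fr (base_coded fr) hb); exact: rst_refl.
  have ht := base_tangent char5 fr; have ht1 := base_tangent char5 fr1.
  apply: rst_step; split=> //; apply: (iffRL (neighbours fr ht1)).
  by exists (nth 0%N (label_perm (stab i)) 0) => //; rewrite mem_iota nz.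
by apply: nthT_all hr' _; rewrite size_reach.
Qed.

Lemma dset_rep E Q : frame E -> dset E 0 Q -> exists E', [/\ frame E', Q = conicset E',
  dset E' 0 = dset E 0 & linked (conicset E) Q].
Proof.
move=> fr /dsetP [x x126 h]; have [E' [fr' h' hd hl]] := reframe fr (lab_lt (isT : (0 < 150)%N) x126).
rewrite labs0 in h h'; have e := coded_inj fr h h'.
by exists E'; rewrite e.
Qed.

Lemma base_dset E : frame E -> dset E 0 (conicset E).
Proof.
move=> fr; have [x x126 e] := lab0_onto (isT : (0 < 21)%N).
by apply/dsetP; exists x; rewrite // labs0 e; exact: base_coded.
Qed.

Lemma dset_tangent E i : dset E i `<=` tangent_conics F.
Proof. by move=> Q []. Qed.

(** By [dset_rep], look from a frame in which [Q] is the standard conic: all its neighbours carry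
    labels of [lab0]. *)
Lemma dset_closed E Q Q' : frame E -> tangent_conics F Q' -> adjG F Q Q' ->
  dset E 0 Q -> dset E 0 Q'.
Proof.
move=> fr hQ' hadj /(dset_rep fr) [E' [fr' EQ <- _]]; rewrite EQ in hadj.
have [l hl hc] := iffLR (neighbours fr' hQ') hadj.
have [x x126 e] : exists2 x, (x < 126)%N & nth 0%N lab0 x = l.
  by apply: lab0_onto; move: hl; rewrite mem_iota => /andP [_ /leq_trans ->].
by apply/dsetP; exists x; rewrite // labs0 e.
Qed.

Lemma component_base E : frame E ->
  [set Q | tangent_conics F Q /\ linked (conicset E) Q] = dset E 0.
Proof.
move=> fr; apply: component_eq.
- exact: dset_tangent.
- exact: base_dset.
- move=> Q Q' hQ hQ' hadj; split; first exact: dset_closed.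
  by apply: dset_closed => //; exact: adjG_sym.
- by move=> Q /(dset_rep fr) [? []].
Qed.

Lemma dset_base E i : frame E -> (i < 150)%N ->
  exists2 E', frame E' & dset E i = dset E' 0.
Proof.
move=> + i150; move: i i150 E; elim/ltn_ind => i IH i150 E fr.
have [->|i0] := posnP i; first by exists E.
have := check_treeT; rewrite /check_tree => /allP/(_ i); rewrite mem_iota i0 => /(_ i150).
case: (nth _ _ _) => [g p] /= /and3P [g4 pi /eqP e].
have p150 := ltn_trans pi i150.
rewrite -e -(dset_gen char5 s2 fr g4 p150).
by apply: IH => //; apply: frame_mul => //; apply: mx_unitary => //; case: (gen_facts g4).
Qed.

Lemma comps_GP E : frame E -> comps_G F = [set D | exists2 i, (i < 150)%N & D = dset E i].
Proof.
move=> fr; apply/seteqP; split=> D.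
  move=> [Q hQ ->]; have [i i150 hi] := cover fr hQ; exists i => //.
  have [E' fr' e] := dset_base fr i150; rewrite e in hi *.
  have [E'' [fr'' -> <- _]] := dset_rep fr' hi; exact: component_base.
move=> [i i150 ->]; have [E' fr' ->] := dset_base fr i150.
exists (conicset E'); first exact: (base_tangent char5 fr').
by rewrite component_base.
Qed.

End BaseComponent.

Definition check_onto := all (fun lab => all (fun l => l \in lab) (iota 0 21)) labs.
Definition check_tab :=
  all (fun i => let gp := nth (0, 0)%N par_tree i.-1 in
    nth [::] tab i == pull (nth [::] tab gp.2) (nth [::] siginvs gp.1)) (iota 1 149) &&
  all (fun j => let r := nth 0%N row0 j in if j == 0%N then r == 4%N else (r < 4)%N) (iota 0 150).
Lemma check_ontoT : check_onto. Proof. by vm_cast_no_check (erefl true). Qed.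
Lemma check_tabT : check_tab. Proof. by vm_cast_no_check (erefl true). Qed.

Definition entry i j := nth 0%N (nth [::] tab i) j.
Definition Tindex T : nat :=
  match T with T_beta21 => 0 | T_gamma21 => 1 | T_alpha15_gamma6 => 2 | T_alpha3_gamma18 => 3 end.

Lemma tab0 : nth [::] tab 0 = row0.
Proof. by vm_cast_no_check (erefl row0). Qed.

Lemma entry_step i : (0 < i < 150)%N -> exists g p, [/\ (g < 4)%N, (p < i)%N,
  nth 0%N (nth [::] sig g) p = i &
  forall j, (j < 150)%N -> entry i j = entry p (nth 0%N (nth [::] siginvs g) j)].
Proof.
move=> /andP [i0 i150].
have := check_treeT; rewrite /check_tree => /allP/(_ i); rewrite mem_iota i0 => /(_ i150).
have /andP [/allP/(_ i) + _] := check_tabT; rewrite mem_iota i0 => /(_ i150).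
case: (nth _ _ _) => [g p]; lazy zeta => /eqP et /and3P [g4 pi /eqP e].
rewrite [(g, p).1]/= [(g, p).2]/= in et e g4 pi.
exists g, p; split=> // j j150; have [_ ss _ _] := inverse_pairP (sig_facts g4).
by rewrite /entry et nth_pull ?ss.
Qed.

Lemma entryP i j : (i < 150)%N -> (j < 150)%N ->
  if j == i then entry i j == 4%N else (entry i j < 4)%N.
Proof.
move: j; elim/ltn_ind: i => i IH j i150 j150.
have [->|i0] := posnP i.
  rewrite /entry tab0; have /andP [_ h] := check_tabT; exact: (all_iota h j150).
have [g [p [g4 pi e h]]] := entry_step (introT andP (conj i0 i150)).
have [_ _ hp hs] := inverse_pairP (sig_facts g4); have [q150 qK] := hs j j150.
have p150 := ltn_trans pi i150; rewrite h //; have := IH p pi _ p150 q150.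
suff -> : (nth 0%N (nth [::] siginvs g) j == p) = (j == i) by [].
by apply/eqP/eqP => [q|->]; [rewrite -qK q|rewrite -e; case: (hp p p150)].
Qed.

Lemma entry_lt i j : (i < 150)%N -> (j < 150)%N -> (entry i j < 4)%N = (j != i).
Proof.
by move=> i150 j150; have := entryP i150 j150; case: ifP => // _ /eqP ->.
Qed.

(** * The types between blocks, as a table *)

Section Types.

Variables (k : fieldType) (char5 : 5%N \in [pchar k]) (s : k).
Hypothesis s2 : s ^+ 2 = 2%:R.
Hypothesis closed_root : forall n (c : k), (0 < n)%N -> exists x : k, x ^+ n = c.
Variables (F : {mpoly k[3]}) (c : k).
Implicit Types (E B V W M : 'M[k]_3) (Q : conic k) (P : ppoint k).

Local Notation pti := (pti s).
Local Notation dset := (dset s F).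
Local Notation coded := (coded s F).
Local Notation frame E := (frame F E c).
Local Notation lab j := (nth [::] labs j).

Opaque pts ptv lab0 labs ptindex gens stabs ptperm tab.

Lemma lab_onto j m : (j < 150)%N -> (m < 21)%N -> exists2 x, (x < 126)%N & nth 0%N (lab j) x = m.
Proof.
have /and5P [_ _ _ _ /and5P [/eqP sl _ _ _ _]] := check_permsT.
move=> j150 m21; have /allP h := check_ontoT.
have hm := all_iota (h _ (mem_nth [::] (etrans (congr1 (leq j.+1) sl) j150))) m21.
by exists (index m (lab j)); rewrite ?nth_index // -(size_lab j150) index_mem.
Qed.

(** The point is a contact point of a conic of block 0, hence one of the 126 points of any frame, in
    particular of one whose block 0 is block [i] of [E]. There [reframe] gives a conic of the block
    through it. *)
Lemma coded_at E i x : frame E -> (i < 150)%N -> (x < 126)%N ->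
  exists Q, coded E (lab i) (nth 0%N (lab i) x) Q.
Proof.
move=> fr i150 x126.
have [E0 [_ [hQ h] _ _]] := reframe char5 s2 closed_root fr (lab_lt (isT : (0 < 150)%N) x126).
rewrite labs0 in h; have hz := pti_zeros char5 s2 x fr.
have [E' fr' e] := dset_base char5 s2 fr i150.
have [x' x'126 ex] := contact_pti char5 s2 closed_root fr' hQ (conj (iffRL (h x x126) erefl) hz).
have [E1 [fr1 [hQ1 h1] _ _]] := reframe char5 s2 closed_root fr' (lab_lt (isT : (0 < 150)%N) x'126).
have : dset E i (conicset E1).
  by rewrite e; split=> //; exists x'.
move=> [_ [x0 x0126 hx0]]; exists (conicset E1); split=> // y y126; rewrite hx0 //.
suff -> : nth 0%N (lab i) x0 = nth 0%N (lab i) x by [].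
by apply/esym/hx0 => //; rewrite ex; apply/h1 => //; rewrite labs0.
Qed.

Lemma dset_family E j : frame E -> (j < 150)%N -> exists g : nat -> conic k,
  [/\ forall m, (m < 21)%N -> coded E (lab j) m (g m),
      forall Q, dset E j Q <-> exists2 m, (m < 21)%N & Q = g m &
      forall m m', (m < 21)%N -> (m' < 21)%N -> g m = g m' -> m = m'].
Proof.
move=> fr j150.
have ex m : exists Q, (m < 21)%N -> coded E (lab j) m Q.
  have [m21|] := ltnP m 21; last by exists set0.
  have [x x126 <-] := lab_onto j150 m21.
  by have [Q hQ] := coded_at fr j150 x126; exists Q.
have [g hg] := boolp.choice ex; exists g; split=> // [Q|m m' m21 m'21 e].
  split=> [/dsetP [x x126 h]|[m m21 ->]]; last first.
    by have [x x126 e] := lab_onto j150 m21; apply/dsetP; exists x => //; rewrite e; exact: hg.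
  exists (nth 0%N (lab j) x); first exact: lab_lt.
  by apply: (coded_inj char5 s2 closed_root fr h); apply: hg; exact: lab_lt.
have [x x126 ex'] := lab_onto j150 m21.
have [_ h] := hg m m21; have [_ h'] := hg m' m'21.
by rewrite -ex' -(iffLR (h' x x126)) // -e; apply/h.
Qed.

Lemma family_card (D : set (conic k)) (g : nat -> conic k) (Pr : conic k -> Prop) (test : pred nat) n :
  (forall Q, D Q <-> exists2 m, (m < 21)%N & Q = g m) ->
  (forall m m', (m < 21)%N -> (m' < 21)%N -> g m = g m' -> m = m') ->
  (forall m, (m < 21)%N -> Pr (g m) <-> test m) ->
  [set Q | D Q /\ Pr Q] #= `I_n <-> (count test (iota 0 21) == n).
Proof.
move=> hD gi hP; rewrite -size_filter; apply: (card_seqP (g := g)).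
- by rewrite filter_uniq ?iota_uniq.
- by move=> i j; rewrite !mem_filter !mem_iota => /andP [_ i21] /andP [_ j21]; exact: gi.
- move=> Q; split=> [[/hD [m m21 ->] /(hP _ m21) h]|[m]].
    by exists m; rewrite ?mem_filter ?h ?mem_iota.
  by rewrite mem_filter mem_iota => /andP [h m21] ->; split; [apply/hD; exists m|apply/hP].
Qed.

Lemma meeting_card E j l Q : frame E -> (j < 150)%N -> coded E lab0 l Q ->
  forall n d, (n < 3)%N -> meeting F Q (dset E j) n #= `I_d <-> (profile (lab j) (fibre lab0 l) n == d).
Proof.
move=> fr j150 [hQ hl] n d n3; have [g [hg hD gi]] := dset_family fr j150.
have pts_card m : (m < 21)%N -> Q `&` g m `&` zeros F #= `I_n <->
    (nth 0%N (meets (lab j) (fibre lab0 l)) m == n).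
  move=> m21; have [hg1 hg2] := hg m m21.
  rewrite /meets (nth_map 0%N) ?size_iota // nth_iota // add0n count_map.
  rewrite count_filter -size_filter; apply: (card_seqP (g := pti E)).
  - by rewrite filter_uniq ?iota_uniq.
  - move=> x y; rewrite !mem_filter !mem_iota => /andP [_ x126] /andP [_ y126].
    exact: (pti_inj char5 s2 (frame_unit fr)).
  move=> P; split.
    move=> [[QP gP] zP]; have [x x126 e] := contact_pti char5 s2 closed_root fr hQ (conj QP zP).
    rewrite e in QP gP; exists x => //; rewrite mem_filter mem_iota x126 andbT /=.
    by rewrite (iffLR (hg2 x x126) gP) (iffLR (hl x x126) QP) !eqxx.
  move=> [x]; rewrite mem_filter mem_iota => /andP [/andP [/eqP h1 /eqP h2] x126] ->.
  by split; [split; [exact: (iffRL (hl x x126))|exact: (iffRL (hg2 x x126))]|exact: (pti_zeros char5 s2 _ fr)].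
apply: (iff_trans (@family_card _ g (fun Q' => Q `&` Q' `&` zeros F #= `I_n) _ d hD gi pts_card)).
have -> : profile (lab j) (fibre lab0 l) n = count (fun y => y == n) (meets (lab j) (fibre lab0 l)).
  by move: n n3 {pts_card} => [|[|[|]]].
suff -> : count (fun m => nth 0%N (meets (lab j) (fibre lab0 l)) m == n) (iota 0 21) =
  count (fun y => y == n) (meets (lab j) (fibre lab0 l)) by [].
set ms := meets _ _; have sms : size ms = 21%N by rewrite size_map size_iota.
clearbody ms; rewrite -[in RHS](mkseq_nth 0%N ms) sms /mkseq count_map.
by apply: eq_count.
Qed.

Lemma has_tP E j l Q t : frame E -> (j < 150)%N -> coded E lab0 l Q ->
  has_t F Q (dset E j) t <-> tcond t (profile (lab j) (fibre lab0 l)).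
Proof.
move=> fr j150 hQ; have h := meeting_card fr j150 hQ; case: t => /=.
- by split=> [[/h-/(_ isT) -> /h-/(_ isT) ->]|/andP [/h-/(_ isT) ? /h-/(_ isT) ?]].
- by split=> [[/h-/(_ isT) -> /h-/(_ isT) -> /h-/(_ isT) ->]|/and3P [/h-/(_ isT) ? /h-/(_ isT) ? /h-/(_ isT) ?]].
- by split=> [[/h-/(_ isT) -> /h-/(_ isT) ->]|/andP [/h-/(_ isT) ? /h-/(_ isT) ?]].
Qed.

Definition profiles j := [seq profile (lab j) (fibre lab0 l) | l <- iota 0 21].

Lemma has_T0P E j T : frame E -> (j < 150)%N ->
  has_T F (dset E 0) (dset E j) T <-> Tcond T (profiles j).
Proof.
move=> fr j150; have [g [hg hD gi]] := dset_family fr (isT : (0 < 150)%N).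
rewrite labs0 in hg.
have ht t m : (m < 21)%N -> has_t F (g m) (dset E j) t <-> tcond t (profile (lab j) (fibre lab0 m)).
  by move=> m21; exact: has_tP fr j150 (hg m m21).
have hall t : (forall Q, dset E 0 Q -> has_t F Q (dset E j) t) <-> all (tcond t) (profiles j).
  rewrite all_map; split=> [h|/all_iota h Q /hD [m m21 ->]].
    apply/allP => m; rewrite mem_iota => /andP [_ m21]; apply/(ht t m m21)/h/hD.
    by exists m.
  by apply/ht => //; exact: h.
have hcount t n : with_t F (dset E 0) (dset E j) t #= `I_n <-> (count (tcond t) (profiles j) == n).
  by rewrite count_map; exact: (@family_card _ g (fun Q => has_t F Q (dset E j) t) _ n hD gi (ht t)).
have hpair t t' n n' : (with_t F (dset E 0) (dset E j) t #= `I_n /\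
      with_t F (dset E 0) (dset E j) t' #= `I_n') <->
    (count (tcond t) (profiles j) == n) && (count (tcond t') (profiles j) == n').
  by split=> [[/hcount h /hcount h']|/andP [/hcount h /hcount h']] //; rewrite h.
by case: T; [exact: hall|exact: hall|exact: hpair|exact: hpair].
Qed.

Lemma Tcond_row0 j T : (j < 150)%N -> Tcond T (profiles j) <-> nth 0%N row0 j = Tindex T.
Proof.
move=> j150; have := all_iota check_typesT j150.
rewrite /row0 (nth_map 0%N) ?size_iota // nth_iota // add0n /Tflags -/(profiles j).
suff h (f : Ttype -> bool) : (count id [seq f T | T <- all_T] <= 1)%N ->
    f T <-> index true [seq f T | T <- all_T] = Tindex T by exact: (h (Tcond^~ (profiles j))).
rewrite /all_T /=; case: T => /=; case: (f T_beta21); case: (f T_gamma21);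
  by case: (f T_alpha15_gamma6); case: (f T_alpha3_gamma18).
Qed.

(** Multiplying the frame by a generator renames the blocks by [sig], which reduces row [i] to the
    row of its parent in the tree and finally to row 0. *)
Lemma has_TP E i j T : frame E -> (i < 150)%N -> (j < 150)%N ->
  has_T F (dset E i) (dset E j) T <-> entry i j = Tindex T.
Proof.
move=> + i150; move: i i150 E j; elim/ltn_ind => i IH i150 E j fr j150.
have [->|i0] := posnP i.
  by rewrite /entry tab0 -Tcond_row0 //; exact: has_T0P.
have [g [p [g4 pi e ->]]] := entry_step (introT andP (conj i0 i150)); last by [].
have [_ _ _ hs] := inverse_pairP (sig_facts g4); have [q150 qK] := hs j j150.
have p150 := ltn_trans pi i150.
have fr1 : frame (mx s (gen g) *m E).
  by apply: frame_mul => //; apply: mx_unitary => //; case: (gen_facts g4).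
have := IH p pi p150 _ _ fr1 q150.
by rewrite !(dset_gen char5 s2 fr g4) // qK e.
Qed.

Lemma entry_Tindex i j : (i < 150)%N -> (j < 150)%N -> j != i -> exists T, entry i j = Tindex T.
Proof.
move=> i150 j150; rewrite -entry_lt //.
case: (entry i j) => [|[|[|[|]]]] // _;
  by [exists T_beta21|exists T_gamma21|exists T_alpha15_gamma6|exists T_alpha3_gamma18].
Qed.

(** Distinct indices have a type in the table, whereas a block has no type with respect to
    itself. *)
Lemma dset_inj E i j : frame E -> (i < 150)%N -> (j < 150)%N -> dset E i = dset E j -> i = j.
Proof.
move=> fr i150 j150 e; apply/esym/eqP/contraT => ne.
have [T hT] := entry_Tindex i150 j150 ne.
have := iffRL (has_TP T fr i150 j150) hT; rewrite -e => /(has_TP T fr i150 i150) h.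
by have := entry_lt i150 i150; rewrite h eqxx; case: (T).
Qed.

(** Both sides describe the type of the same two sets of conics, read in the frames [E] and [gen g]
    times [E]. *)
Lemma entry_sig E g i j : frame E -> (g < 4)%N -> (i < 150)%N -> (j < 150)%N ->
  entry (nth 0%N (nth [::] sig g) i) (nth 0%N (nth [::] sig g) j) = entry i j.
Proof.
move=> fr g4 i150 j150; have [_ _ hp hs] := inverse_pairP (sig_facts g4).
have [si iK] := hp i i150; have [sj jK] := hp j j150.
have [->|ne] := eqVneq j i.
  have := entryP i150 i150; have := entryP si si.
  by rewrite !eqxx => /eqP -> /eqP ->.
have [T hT] := entry_Tindex i150 j150 ne; rewrite hT.
have fr1 : frame (mx s (gen g) *m E).
  by apply: frame_mul => //; apply: mx_unitary => //; case: (gen_facts g4).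
have := iffRL (has_TP T fr1 i150 j150) hT.
by rewrite !(dset_gen char5 s2 fr g4) // => /(has_TP T fr si sj).
Qed.

End Types.

(** * The finite graph on 150 vertices: definitions and checks *)

Local Open Scope nat_scope.

(** The value 2 is the [Tindex] of [T_alpha15_gamma6], the adjacency of [H]. *)
Definition adjacent u v := entry u v == 2.
(** Lying in the same component of [H]: the types [T_beta21] and [T_alpha3_gamma18] occur only
    between different components, and the value 4 on the diagonal is allowed. *)
Definition same u v := (entry u v != 0) && (entry u v != 3).
Definition nbrs u := [seq v <- iota 0 150 | adjacent u v].
Definition common u v := count (adjacent v) (nbrs u).
(** Indices of the image of block [a] under the map to the component of [r], as the value 0 stands
    for [T_beta21]. *)
Definition zeros_in r a := [seq m <- iota 0 150 | (entry a m == 0) && same r m].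
(** Representatives of the two classes other than that of vertex 0. *)
Definition reps : seq nat :=
  let r1 := find (fun i => ~~ same 0 i) (iota 0 150) in
  [:: r1; find (fun i => ~~ same 0 i && ~~ same r1 i) (iota 0 150)].

Fixpoint pairs (g : seq nat) : seq (nat * nat) :=
  if g is z :: g' then [seq (z, w) | w <- g'] ++ pairs g' else [::].
(** Chooses two vertices in each group, discarding their neighbours from the later groups, and
    requires that every complete selection be contained in the zeros of some row. The number [n] is
    fuel: one unit for each group and one for the final test, hence 8 in [check_search]. *)
Fixpoint search n (gs : seq (seq nat)) (sel : seq nat) : bool :=
  if n is n'.+1 then
    if gs is g :: gs' then
      all (fun pr => search n'
        [seq [seq z <- h | ~~ adjacent pr.1 z && ~~ adjacent pr.2 z] | h <- gs']
        (pr.1 :: pr.2 :: sel)) (pairs g)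
    else has (fun a => all (fun z => entry a z == 0) sel) (iota 0 150)
  else false.
Definition groups x := [seq [seq z <- nbrs y | z != x] | y <- nbrs x].

Definition check_rel := let vs := iota 0 150 in let cl := filter (same 0) vs in
  [&& all (fun i => entry 0 i == entry i 0) vs,
      all (fun u => all (same u) cl) cl, size cl == 50, common 0 0 == 7,
      all (fun w => common 0 w == 1) [seq w <- vs | entry 0 w == 1] &
      all (fun i => same 0 i || has (same^~ i) reps) vs].
(** The values of [common_size] in the order of [Tindex]. *)
Definition common_table := [:: 8; 5; 0; 3].
Definition check_cocliques :=
  all (fun r => let z0 := zeros_in r 0 in [&& ~~ same 0 r, size z0 == 15,
     all (fun m => all (fun m' => ~~ adjacent m m') z0) z0 &
     all (fun b => (b == 0) || same r b ||
       (count (fun m => entry b m == 0) z0 == nth 0 common_table (entry 0 b))) (iota 0 150)]) reps.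
Definition check_search := search 8 (groups 0) [:: 0].
Definition check_graph := [&& check_rel, check_cocliques & check_search].
Lemma check_graphT : check_graph. Proof. by vm_cast_no_check (erefl true). Qed.

Lemma check_relT : check_rel. Proof. by have /and3P [] := check_graphT. Qed.
Lemma check_cocliquesT : check_cocliques. Proof. by have /and3P [] := check_graphT. Qed.
Lemma check_searchT : check_search. Proof. by have /and3P [] := check_graphT. Qed.

Opaque tab entry iota.

Lemma mem_iota0 n x : (x \in iota 0 n) = (x < n).
Proof. by rewrite mem_iota. Qed.

Lemma mem_nbrs u v : (v \in nbrs u) = (v < 150) && adjacent u v.
Proof. by rewrite mem_filter mem_iota0 andbC. Qed.

Lemma mem_zeros_in r a m : (m \in zeros_in r a) = [&& m < 150, entry a m == 0 & same r m].
Proof. by rewrite mem_filter mem_iota0 andbC. Qed.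

Lemma zeros_in_lt r a m : m \in zeros_in r a -> m < 150.
Proof. by rewrite mem_zeros_in => /andP []. Qed.

Lemma size_iota_perm n (pi : nat -> nat) (P : pred nat) :
  (forall i, i < n -> pi i < n) -> {in gtn n &, injective pi} ->
  size [seq i <- iota 0 n | P (pi i)] = size (filter P (iota 0 n)).
Proof.
move=> hp hi; rewrite -(size_map pi); apply: perm_size.
have ui := iota_uniq 0 n.
have um : uniq (map pi (iota 0 n)).
  by rewrite map_inj_in_uniq // => i j; rewrite !mem_iota0 => i150 j150; exact: hi.
have sub : {subset map pi (iota 0 n) <= iota 0 n}.
  by move=> x /mapP [i]; rewrite !mem_iota0 => /hp ? ->.
have [_ e] := uniq_min_size um sub (eq_leq (esym (size_map pi _))).
by have := perm_filter P (uniq_perm um ui e); rewrite filter_map.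
Qed.

Lemma count1P (p : pred nat) g : count p g = 1 ->
  exists w, [/\ w \in g, p w & forall z, z \in g -> p z -> z = w].
Proof.
elim: g => [//|z g IH] /=; case pz : (p z); last first.
  rewrite add0n => /IH [w [wg pw h]].
  exists w; split=> //; first by rewrite inE wg orbT.
  by move=> y; rewrite inE => /orP [/eqP ->|]; [rewrite pz|exact: h].
rewrite -[1]addn0 -[nat_of_bool true]/1 => /addnI c0.
exists z; split; rewrite ?mem_head // => y; rewrite inE => /orP [/eqP //|yg py].
have : has p g by apply/hasP; exists y.
by rewrite has_count c0.
Qed.

Lemma pairsP (p : pred nat) g : count p g = 2 -> exists pr, [/\ pr \in pairs g, p pr.1, p pr.2 &
  forall z, z \in g -> p z -> z = pr.1 \/ z = pr.2].
Proof.
elim: g => [//|z g IH] /=; case pz : (p z).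
  move=> [/count1P [w [wg pw h]]]; exists (z, w); split=> //=; first by rewrite mem_cat map_f.
  by move=> y; rewrite inE => /orP [/eqP ->|yg /(h y yg)]; [left|right].
rewrite add0n => /IH [pr [h1 h2 h3 h]].
exists pr; split=> //; first by rewrite mem_cat h1 orbT.
by move=> y; rewrite inE => /orP [/eqP ->|]; [rewrite pz|exact: h].
Qed.

(** Follow the branch choosing in each group the two elements of [S]. The discarded vertices are
    adjacent to elements of [S], so no element of the coclique [S] is lost. *)
Lemma searchP (S : seq nat) n gs sel : {in S &, forall u v, ~~ adjacent u v} ->
  search n gs sel -> (forall g, g \in gs -> count (mem S) g = 2) ->
  exists2 a, a < 150 & forall z, (z \in sel) || ((z \in S) && has (fun g => z \in g) gs) ->
    entry a z = 0.
Proof.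
move=> cS; elim: n gs sel => [//|n IH] [|g gs] sel.
  move=> /hasP [a]; rewrite mem_iota0 => a150 /allP h _; exists a => // z.
  by rewrite andbF orbF => /h /eqP.
move=> h hg; have [pr [hpr p1 p2 hp]] := pairsP (hg g (mem_head _ _)).
have survive z : z \in S -> ~~ adjacent pr.1 z && ~~ adjacent pr.2 z.
  by move=> zS; rewrite !cS.
have [|a a150 ha] := IH _ _ (allP h _ hpr).
  move=> g' /mapP [h' hh' ->]; rewrite count_filter -(hg h'); last by rewrite inE hh' orbT.
  by apply: eq_count => z /=; case zS : (z \in S) => //=; exact: survive.
exists a => // z /orP [zs|/andP [zS /= /orP [zg|/hasP [g' hg' zg']]]]; apply: ha.
- by rewrite !inE zs !orbT.
- by case: (hp z zg zS) => ->; rewrite !inE eqxx ?orbT.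
apply/orP; right; rewrite zS; apply/hasP; eexists; first exact: map_f hg'.
by rewrite mem_filter survive.
Qed.

(** * Symmetry of the finite graph and classification of its 15-cocliques *)

Section Graph.

Hypothesis entry_sig : forall g i j, g < 4 -> i < 150 -> j < 150 ->
  entry (nth 0 (nth [::] sig g) i) (nth 0 (nth [::] sig g) j) = entry i j.

Record automorphism (pi : nat -> nat) : Prop := Automorphism {
  aut_lt : forall i, i < 150 -> pi i < 150;
  aut_inj : {in gtn 150 &, injective pi};
  aut_onto : forall i, i < 150 -> exists2 j, j < 150 & i = pi j;
  aut_entry : forall i j, i < 150 -> j < 150 -> entry (pi i) (pi j) = entry i j }.

(* Vertex-transitivity reduces every statement about the graph to one about vertex 0. *)
Lemma transitive i : i < 150 -> exists2 pi, automorphism pi & pi 0 = i.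
Proof.
elim/ltn_ind: i => i IH i150; have [->|i0] := posnP i.
  by exists id => //; split=> // j j150; exists j.
have [g [p [g4 pi e _]]] := entry_step (introT andP (conj i0 i150)).
have [f [f1 f2 f3 f4] f0] := IH p pi (ltn_trans pi i150).
have [_ _ hp hs] := inverse_pairP (sig_facts g4).
exists (fun j => nth 0 (nth [::] sig g) (f j)); last by rewrite f0.
split=> [j j150|j l j150 l150 h|j j150|j l j150 l150].
- by case: (hp _ (f1 j j150)).
- have [_ h1] := hp _ (f1 j j150); have [_ h2] := hp _ (f1 l l150).
  by apply: f2 => //; rewrite -h1 -h2 h.
- have [sj sK] := hs j j150; have [l l150 el] := f3 _ sj.
  by exists l; rewrite // -el sK.
- by rewrite entry_sig ?f1 // f4.
Qed.

Lemma same_aut f u v : automorphism f -> u < 150 -> v < 150 -> same (f u) (f v) = same u v.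
Proof. by move=> [_ _ _ f4] u150 v150; rewrite /same f4. Qed.

Lemma entry_sym i j : i < 150 -> j < 150 -> entry i j = entry j i.
Proof.
move=> i150 j150; have [f [f1 _ f3 f4] f0] := transitive i150; have [l l150 ->] := f3 j j150.
have /and5P [/all_iota h _ _ _ _] := check_relT.
by rewrite -f0 !f4 //; apply/eqP; exact: h.
Qed.

Lemma same_sym i j : i < 150 -> j < 150 -> same i j = same j i.
Proof. by move=> i150 j150; rewrite /same entry_sym. Qed.

Lemma same_refl i : i < 150 -> same i i.
Proof. by move=> i150; have := entryP i150 i150; rewrite eqxx /same => /eqP ->. Qed.

Lemma same_trans u v w : u < 150 -> v < 150 -> w < 150 -> same u v -> same v w -> same u w.
Proof.
move=> u150 v150 w150; have [f [f1 _ f3 f4] f0] := transitive v150.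
have [u' u'150 eu] := f3 u u150; have [w' w'150 ew] := f3 w w150.
rewrite same_sym // eu ew -f0 /same !f4 // -!/(same _ _) => h1 h2.
have /and5P [_ /allP h _ _ _] := check_relT.
have m x : x < 150 -> same 0 x -> x \in filter (same 0) (iota 0 150).
  by move=> x150 hx; rewrite mem_filter hx mem_iota0.
by have /allP := h u' (m _ u'150 h1); apply; exact: m.
Qed.

Lemma size_class u : u < 150 -> size (filter (same u) (iota 0 150)) = 50.
Proof.
move=> u150; have [f [f1 f2 f3 f4] f0] := transitive u150.
rewrite -(size_iota_perm _ f1 f2); have /and5P [_ _ /eqP h _ _] := check_relT.
apply: etrans (congr1 size _) h; apply: eq_in_filter => i; rewrite mem_iota0 => i150.
by rewrite -f0 /same !f4.
Qed.

Lemma commonE u v : common u v = size [seq w <- iota 0 150 | adjacent u w && adjacent v w].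
Proof. by rewrite /common -size_filter -filter_predI; apply: (congr1 size); apply: eq_filter => w /=; rewrite andbC. Qed.

Lemma common_aut f u v : automorphism f -> u < 150 -> v < 150 -> common (f u) (f v) = common u v.
Proof.
move=> [f1 f2 f3 f4] u150 v150; rewrite !commonE -(size_iota_perm _ f1 f2); apply: (congr1 size).
by apply: eq_in_filter => i; rewrite mem_iota0 => i150; rewrite /adjacent !f4.
Qed.

Lemma degree u : u < 150 -> common u u = 7.
Proof.
move=> u150; have [f fa <-] := transitive u150; rewrite (@common_aut f 0 0 fa isT isT).
by have /and5P [_ _ _ /eqP] := check_relT.
Qed.

Lemma common1 u v : u < 150 -> v < 150 -> entry u v = 1 -> common u v = 1.
Proof.
move=> u150 v150 h; have [f fa f0] := transitive u150; have [_ _ f3 f4] := fa.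
have [v' v'150 ev] := f3 v v150; move: h; rewrite -f0 ev (f4 0 v' isT v'150) (@common_aut f 0 v' fa isT v'150) => h.
have /and5P [_ _ _ _ /andP [/allP ha _]] := check_relT.
apply/eqP; apply: ha; rewrite mem_filter mem_iota0 h; exact: v'150.
Qed.

Lemma nonadjacent u v : u < 150 -> v < 150 -> same u v -> v != u -> ~~ adjacent u v ->
  entry u v = 1.
Proof.
move=> u150 v150 h ne; have := entryP u150 v150; rewrite (negPf ne); move: h; rewrite /same /adjacent.
by case: (entry u v) => [|[|[|[|]]]].
Qed.

Lemma adjacent_same u v : adjacent u v -> same u v.
Proof. by rewrite /adjacent /same => /eqP ->. Qed.

Lemma common_neighbour u v : u < 150 -> v < 150 -> entry u v = 1 ->
  exists w, [/\ w < 150, adjacent u w & adjacent w v].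
Proof.
move=> u150 v150 h; have := common1 u150 v150 h; rewrite commonE.
case e : (filter _ _) => [|w r] // _; exists w.
have : w \in w :: r by rewrite mem_head.
by rewrite -e mem_filter mem_iota0 /adjacent => /andP [/andP [? ?] w150]; rewrite (entry_sym w150).
Qed.

Lemma same_connected u v : u < 150 -> v < 150 -> same u v -> v != u ->
  adjacent u v \/ exists w, [/\ w < 150, adjacent u w & adjacent w v].
Proof.
move=> u150 v150 h ne; case ha : (adjacent u v); [by left|right].
exact: common_neighbour (nonadjacent u150 v150 h ne (negbT ha)).
Qed.

Lemma zeros_in_aut f r a : automorphism f -> r < 150 -> a < 150 ->
  perm_eq (zeros_in (f r) (f a)) (map f (zeros_in r a)).
Proof.
move=> [f1 f2 f3 f4] r150 a150; apply: uniq_perm.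
- by rewrite filter_uniq ?iota_uniq.
- rewrite map_inj_in_uniq ?filter_uniq ?iota_uniq // => i j.
  by rewrite !mem_zeros_in => /andP [i150 _] /andP [j150 _]; exact: f2.
move=> m; rewrite mem_zeros_in; apply/idP/mapP => [/and3P [m150 h1 h2]|[i]].
  have [i i150 e] := f3 m m150; exists i => //.
  by rewrite mem_zeros_in i150; move: h1 h2; rewrite e /same !f4 // => -> ->.
by rewrite mem_zeros_in => /and3P [i150 h1 h2] ->; rewrite f1 // /same !f4 // h1.
Qed.

Lemma zeros_in_same r r' a : r < 150 -> r' < 150 -> same r r' -> zeros_in r a = zeros_in r' a.
Proof.
move=> r150 r'150 h; apply: eq_in_filter => m; rewrite mem_iota0 => m150; congr (_ && _).
by apply/idP/idP; apply: same_trans => //; rewrite same_sym.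
Qed.

Lemma zeros_inP r a : r < 150 -> a < 150 -> ~~ same a r -> [/\ size (zeros_in r a) = 15,
  forall m m', m \in zeros_in r a -> m' \in zeros_in r a -> ~~ adjacent m m' &
  forall b, b < 150 -> b != a -> ~~ same r b ->
    size [seq m <- zeros_in r a | entry b m == 0] = nth 0 common_table (entry a b)].
Proof.
move=> r150 a150 h; have [f fa f0] := transitive a150; have [f1 f2 f3 f4] := fa.
have [r' r'150 er] := f3 r r150.
have h' : ~~ same 0 r' by move: h; rewrite er -f0 /same !f4.
have /and5P [_ _ _ _ /andP [_ /all_iota hr]] := check_relT.
have := hr r' r'150; rewrite (negPf h') orFb => /hasP [t tr htr].
have := allP check_cocliquesT t tr; lazy zeta => /and4P [_ /eqP h1 /allP h2 /all_iota h3].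
have t150 : t < 150 by rewrite -mem_iota0; apply: (allP (_ : all (mem (iota 0 150)) reps)); [vm_cast_no_check (erefl true)|].
have pe : perm_eq (zeros_in r a) (map f (zeros_in t 0)).
  have <- : zeros_in r' 0 = zeros_in t 0.
    by apply: (zeros_in_same 0 r'150 t150); rewrite (same_sym r'150 t150); exact: htr.
  by rewrite er -f0; exact: (zeros_in_aut fa r'150 (isT : 0 < 150)).
split; first by rewrite (perm_size pe) size_map.
  move=> m m'; rewrite (perm_mem pe m) (perm_mem pe m') => /mapP [i hi ->] /mapP [j hj ->].
  have i150 := zeros_in_lt hi; have j150 := zeros_in_lt hj.
  rewrite /adjacent (f4 i j i150 j150); have /allP h2i := h2 i hi; exact: h2i.
move=> b b150 ne nb; have [b' b'150 eb] := f3 b b150.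
rewrite (perm_size (perm_filter _ pe)) filter_map size_map size_filter.
have := h3 b' b'150; rewrite -(f4 0 b' isT b'150) f0 -eb.
have /negPf -> : b' != 0 by apply: contraNneq ne => z; rewrite eb z f0.
have /negPf -> : ~~ same t b'.
  apply: contra nb => htb; rewrite er eb (same_aut fa r'150 b'150).
  apply: (same_trans r'150 t150 b'150 _ htb); rewrite (same_sym r'150 t150); exact: htr.
rewrite !orFb => /eqP <-; apply: eq_in_count => m /zeros_in_lt m150.
by apply: (etrans (y := entry b (f m) == 0)); [exact: erefl|rewrite eb f4].
Qed.

(* Hoffman's bound is attained: counting edges and paths of length 2 from the coclique gives
   [\sum_v (d v - 3) ^ 2 = 0] over the vertices [v] outside it, [d v] being the number of
   neighbours of [v] in it. *)
Lemma hoffman r (S : seq nat) : r < 150 -> uniq S -> size S = 15 ->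
  {in S, forall u, (u < 150) && same r u} -> {in S &, forall u v, ~~ adjacent u v} ->
  forall v, v < 150 -> same r v -> v \notin S -> count (adjacent v) S = 3.
Proof.
move=> r150 uS sS hS cS.
pose L := filter (same r) (iota 0 150).
have memL x : (x \in L) = (x < 150) && same r x by rewrite mem_filter mem_iota0 andbC.
have SL u : u \in S -> u \in L by move=> /hS; rewrite memL.
pose d v := \sum_(u <- S) (adjacent v u : nat).
have dE v : d v = count (adjacent v) S.
  by rewrite /d -sum1_count [RHS]big_mkcond; apply: eq_bigr => u _; case: adjacent.
(* This is (n - 3)^2: with truncated subtraction one of the two squares is always 0. *)
pose sq n := (n - 3) ^ 2 + (3 - n) ^ 2.
have sqE n : n * n + 9 = 6 * n + sq n by rewrite /sq; nia.
have sumS n : \sum_(u <- S) n = 15 * n by rewrite big_const_seq count_predT sS iter_addn addn0 mulnC.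
have common_sum u w : u \in S -> w \in S -> \sum_(v <- L) (adjacent v u * adjacent v w) = common u w.
  move=> /hS /andP [u150 hu] /hS /andP [w150 hw].
  rewrite commonE -sum1_size /L !big_filter [LHS]big_mkcond [RHS]big_mkcond.
  apply: eq_big_seq => v; rewrite mem_iota0 => v150.
  rewrite /adjacent (entry_sym v150 u150) (entry_sym v150 w150) -!/(adjacent _ _).
  case: ifP => hv; first by case: (adjacent u v); case: (adjacent w v).
  case: ifP => // /andP [hu' _]; move: hv.
  by rewrite (same_trans r150 u150 v150 hu (adjacent_same hu')).
have s1 : \sum_(v <- L) d v = 105.
  rewrite exchange_big /=; transitivity (\sum_(u <- S) 7); last by rewrite sumS.
  apply: eq_big_seq => u Su; have /andP [u150 _] := hS u Su.
  rewrite -(degree u150) -(common_sum u u) //.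
  by apply: eq_bigr => v _; case: adjacent.
(* Pairs of elements of [S] are counted through their common neighbours: seven for equal ones, one
   otherwise, so 15 (7 + 14) = 315. *)
have s2 : \sum_(v <- L) d v * d v = 315.
  have -> : \sum_(v <- L) d v * d v =
      \sum_(u <- S) \sum_(w <- S) \sum_(v <- L) (adjacent v u * adjacent v w).
    rewrite -[RHS](eq_bigr _ (fun u _ => exchange_big _ _ _ _ _ _)) /= exchange_big /=.
    by apply: eq_bigr => v _; rewrite /d big_distrlr.
  transitivity (\sum_(u <- S) 21); last by rewrite sumS.
  apply: eq_big_seq => u Su; have /andP [u150 hu] := hS u Su.
  transitivity (\sum_(w <- S) (1 + 6 * (w == u))).
    apply: eq_big_seq => w wS; have /andP [w150 hw] := hS w wS.
    rewrite common_sum //; have [->|ne] := eqVneq w u; first by rewrite degree.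
    rewrite common1 // nonadjacent //; last exact: cS.
    by apply: same_trans hw => //; rewrite same_sym.
  rewrite big_split sumS -big_distrr /=.
  suff -> : \sum_(w <- S) (w == u : nat) = 1 by [].
  transitivity (count (pred1 u) S); last by rewrite (count_uniq_mem u uS) Su.
  by rewrite -sum1_count [RHS]big_mkcond; apply: eq_bigr => w _ /=; case: eqP.
(* The total is 315 + 9 * 50 - 6 * 105 = 135, which is what the 15 elements of [S], with [d] equal
   to 0, contribute alone. *)
have tot : \sum_(v <- L) sq (d v) = 135.
  have : \sum_(v <- L) (d v * d v + 9) = \sum_(v <- L) (6 * d v + sq (d v)).
    by apply: eq_bigr => v _; exact: sqE.
  have e6 : \sum_(v <- L) 6 * d v = 630 by rewrite -big_distrr /= s1.
  have e9 : \sum_(v <- L) 9 = 450.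
    by rewrite big_const_seq count_predT (size_class r150) iter_addn.
  rewrite big_split [RHS]big_split /= e6 e9 s2; lia.
have dS v : v \in S -> d v = 0.
  move=> vS; rewrite dE; apply/eqP; rewrite -leqn0 leqNgt -has_count; apply/hasPn => u Su.
  exact: cS.
move=> v v150 rv nS; rewrite -dE.
have : \sum_(v <- L | v \notin S) sq (d v) == 0.
  move: tot; rewrite (bigID (mem S)) /=.
  have -> : \sum_(v <- L | v \in S) sq (d v) = 135.
    transitivity (\sum_(v <- L | v \in S) 9); first by apply: eq_bigr => u /dS ->.
    rewrite -big_filter; have pe : perm_eq [seq v <- L | v \in S] S.
      apply: uniq_perm; rewrite ?filter_uniq ?iota_uniq // => u; rewrite mem_filter.
      by case Su : (u \in S) => //=; exact: SL.
    by rewrite (perm_big _ pe) sumS.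
  by move/eqP; rewrite -[X in _ == X]addn0 eqn_add2l.
rewrite sum_nat_seq_eq0 => /allP /(_ v); rewrite memL v150 rv nS => /(_ isT) /=.
rewrite /sq addn_eq0 !expn_eq0 /= !andbT !subn_eq0 => /andP [h1 h2].
by apply/eqP; rewrite eqn_leq h1.
Qed.

(** By [hoffman] each neighbour of 0 has three neighbours in [S], namely 0 and two others, as the
    search requires. Any other element of [S] has a common neighbour with 0, so it lies in one of
    the groups. *)
Lemma coclique0 r (S : seq nat) : r < 150 -> uniq S -> size S = 15 ->
  {in S, forall u, (u < 150) && same r u} -> {in S &, forall u v, ~~ adjacent u v} ->
  0 \in S -> exists2 a, a < 150 & {in S, forall z, entry a z = 0}.
Proof.
move=> r150 uS sS hS cS S0; have d3 := hoffman r150 uS sS hS cS.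
have /andP [_ r0] := hS 0 S0.
have hg g : g \in groups 0 -> count (mem S) g = 2.
  move=> /mapP [y]; rewrite mem_nbrs => /andP [y150 y0] ->.
  have yr : same r y by apply: same_trans (adjacent_same y0).
  have yS : y \notin S by apply: contraL y0 => yS; exact: cS.
  have hy0 : adjacent y 0 by rewrite /adjacent entry_sym.
  have e3 : count (mem S) (nbrs y) = 3.
    rewrite -(d3 y y150 yr yS) -!size_filter; apply: perm_size; apply: uniq_perm.
    - by rewrite filter_uniq // filter_uniq ?iota_uniq.
    - by rewrite filter_uniq.
    move=> z; rewrite !mem_filter mem_iota0 /=; case zS : (z \in S); last by rewrite andbF.
    by have /andP [-> _] := hS z zS; rewrite !andbT.
  have un : uniq (nbrs y) by rewrite filter_uniq ?iota_uniq.
  rewrite count_filter.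
  have := count_predUI (pred1 0) (predI (mem S) (predC (pred1 0))) (nbrs y).
  rewrite (eq_count (a2 := mem S)); last first.
    by move=> z /=; have [->|] := eqVneq z 0; rewrite ?S0 ?andbT.
  rewrite [X in _ + X = _](eq_count (a2 := pred0)); last by move=> z /=; case: eqP; rewrite ?andbF.
  rewrite count_pred0 e3 addn0 (count_uniq_mem 0 un) mem_nbrs hy0 => /eqP.
  by rewrite -[3]/(1 + 2) eqn_add2l => /eqP <-.
have [a a150 ha] := searchP cS check_searchT hg.
exists a => // z zS; apply: ha; rewrite mem_seq1.
have [//|z0] := eqVneq z 0; rewrite zS /=; have /andP [z150 rz] := hS z zS.
have hz : same 0 z by apply: same_trans rz; rewrite // same_sym.
have e1 : entry 0 z = 1 by apply: nonadjacent => //; exact: cS.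
have [y [y150 y1 y2]] := common_neighbour (isT : 0 < 150) z150 e1.
apply/hasP; exists [seq z <- nbrs y | z != 0].
  by apply/mapP; exists y; first by rewrite mem_nbrs y150.
by rewrite mem_filter z0 mem_nbrs z150.
Qed.

(** Move an element of [S] to vertex 0 and apply [coclique0]. The row found belongs to another
    class, since no entry within a class is 0, and the inclusion of [S] in its zeros is an equality
    because both have 15 elements. *)
Lemma coclique_zeros r (S : seq nat) : r < 150 -> uniq S -> size S = 15 ->
  {in S, forall u, (u < 150) && same r u} -> {in S &, forall u v, ~~ adjacent u v} ->
  exists a, [/\ a < 150, ~~ same r a & S =i zeros_in r a].
Proof.
move=> r150 uS sS hS cS.
have [x xS] : exists x, x \in S by case: (S) sS => [//|x q] _; exists x; rewrite mem_head.
have /andP [x150 rx] := hS x xS.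
have [f fa f0] := transitive x150; have [f1 f2 f3 f4] := fa.
have [r' r'150 er] := f3 r r150.
pose S' := [seq i <- iota 0 150 | f i \in S].
have pe : perm_eq S (map f S').
  apply: uniq_perm => //.
    rewrite map_inj_in_uniq ?filter_uniq ?iota_uniq // => i j.
    by rewrite !mem_filter !mem_iota0 => /andP [_ i150] /andP [_ j150]; exact: f2.
  move=> y; apply/idP/mapP => [yS|[i]]; last by rewrite mem_filter => /andP [? _] ->.
  have /andP [y150 _] := hS y yS; have [i i150 ei] := f3 y y150.
  by exists i; rewrite // mem_filter mem_iota0 -ei yS.
have mS' i : i \in S' -> (i < 150) && (f i \in S) by rewrite mem_filter mem_iota0 andbC.
have [|||||a a150 ha] := @coclique0 r' S' r'150.
- by rewrite filter_uniq ?iota_uniq.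
- by rewrite -sS (perm_size pe) size_map.
- by move=> i /mS' /andP [i150 /hS /andP [_]]; rewrite i150 er same_aut.
- by move=> i j /mS' /andP [i150 iS] /mS' /andP [j150 jS]; have := cS _ _ iS jS; rewrite /adjacent f4.
- by rewrite mem_filter mem_iota0 f0 xS.
have fa150 := f1 a a150.
have hz z : z \in S -> entry (f a) z = 0.
  by rewrite (perm_mem pe) => /mapP [i iS ->]; have /andP [i150 _] := mS' i iS; rewrite f4 // ha.
have nr : ~~ same r (f a).
  apply/negP => h; have : same (f a) x by apply: same_trans rx; rewrite // same_sym.
  by rewrite /same hz.
exists (f a); split=> //.
have nr' : ~~ same (f a) r by rewrite (same_sym fa150 r150).
have [sz _ _] := zeros_inP r150 fa150 nr'.
have sub : {subset S <= zeros_in r (f a)}.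
  by move=> z zS; have /andP [z150 rz] := hS z zS; rewrite mem_zeros_in z150 rz hz.
have [_ e] := uniq_min_size uS sub (eq_leq (etrans sz (esym sS))).
exact: e.
Qed.

End Graph.


Local Open Scope ring_scope.
Local Open Scope classical_set_scope.
Local Open Scope card_scope.

(** * Translation back to components of [H] and conclusion *)

Section Main.

Variables (k : fieldType) (char5 : 5%N \in [pchar k]) (s : k).
Hypothesis s2 : s ^+ 2 = 2%:R.
Hypothesis closed_root : forall n (c : k), (0 < n)%N -> exists x : k, x ^+ n = c.
Variables (F : {mpoly k[3]}) (E : 'M[k]_3) (c : k).
Hypothesis fr : frame F E c.

Local Notation D := (dset s F E).

Let esig g i j (g4 : (g < 4)%N) (i150 : (i < 150)%N) (j150 : (j < 150)%N) :=
  entry_sig char5 s2 closed_root fr g4 i150 j150.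

Lemma D_inj i j : (i < 150)%N -> (j < 150)%N -> D i = D j -> i = j.
Proof. exact: (dset_inj char5 s2 closed_root fr). Qed.

Lemma D_comp i : (i < 150)%N -> comps_G F (D i).
Proof. by move=> i150; rewrite (comps_GP char5 s2 closed_root fr); exists i. Qed.

Lemma D_has_T i j T : (i < 150)%N -> (j < 150)%N -> has_T F (D i) (D j) T <-> entry i j = Tindex T.
Proof. exact: (has_TP char5 s2 closed_root T fr). Qed.

Lemma D_adj i j : (i < 150)%N -> (j < 150)%N -> adjH F (D i) (D j) <-> adjacent i j.
Proof.
move=> i150 j150; rewrite /adjH /adjacent; split=> [[_ /D_has_T -> //]|/eqP e].
split; last exact/D_has_T.
move/(D_inj i150 j150) => ij; have := entry_lt i150 i150.
by rewrite {2}ij e eqxx.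
Qed.

Definition block i : set (set (conic k)) :=
  [set X | exists j, [/\ (j < 150)%N, same i j & X = D j]].

Lemma block_D i j : (j < 150)%N -> block i (D j) <-> same i j.
Proof.
move=> j150; split=> [[l [l150 h /(D_inj j150 l150) -> //]]|h].
by exists j.
Qed.

(** Adjacency stays inside a class, and two distinct vertices of a class are adjacent or have a
    common neighbour. *)
Lemma component_D i : (i < 150)%N ->
  [set X | comps_G F X /\ connected_in (comps_G F) (adjH F) (D i) X] = block i.
Proof.
move=> i150; apply: component_eq.
- by move=> X [j [j150 _ ->]]; exact: D_comp.
- by apply/block_D => //; exact: same_refl.
- move=> X Y; rewrite (comps_GP char5 s2 closed_root fr) => -[a a150 ->] [b b150 ->].
  move=> /(D_adj a150 b150) h; rewrite !block_D //; have hab := adjacent_same h.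
  by split=> h'; [apply: same_trans h' hab|apply: same_trans h' _; rewrite // same_sym].
move=> X [j [j150 h ->]]; have [->|ne] := eqVneq j i; first exact: rst_refl.
have step a b : (a < 150)%N -> (b < 150)%N -> adjacent a b ->
    connected_in (comps_G F) (adjH F) (D a) (D b).
  by move=> a150 b150 hab; apply: rst_step; split; [exact: D_comp|exact: D_comp|exact/D_adj].
have [hij|[w [w150 h1 h2]]] := same_connected esig i150 j150 h ne; first exact: step.
by apply: rst_trans (step _ _ i150 w150 h1) (step _ _ w150 j150 h2).
Qed.

Lemma comps_HP : comps_H F = [set K | exists2 i, (i < 150)%N & K = block i].
Proof.
apply/seteqP; split=> K.
  move=> [X hX ->]; have := hX; rewrite {1}(comps_GP char5 s2 closed_root fr) => -[i i150 ->].
  by exists i => //; exact: component_D.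
by move=> [i i150 ->]; exists (D i); [exact: D_comp|apply/esym; exact: component_D].
Qed.

Lemma block_eq i j : (i < 150)%N -> (j < 150)%N -> same i j -> block i = block j.
Proof.
move=> i150 j150 h; apply/seteqP; split=> X [l [l150 hl ->]]; apply/block_D => //.
  by apply: same_trans hl; rewrite // same_sym.
exact: same_trans h hl.
Qed.

Lemma gmapE r a : (a < 150)%N ->
  gmap F (block r) (D a) = [set X | exists2 m, m \in zeros_in r a & X = D m].
Proof.
move=> a150; apply/seteqP; split=> X.
  move=> [[m [m150 h ->]] /(D_has_T _ a150 m150) e].
  by exists m; rewrite // mem_zeros_in m150 h e.
move=> [m]; rewrite mem_zeros_in => /and3P [m150 /eqP e h] ->; split; first by exists m.
by apply/D_has_T.
Qed.

Lemma gmap_cap r a b : (a < 150)%N -> (b < 150)%N ->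
  gmap F (block r) (D a) `&` gmap F (block r) (D b) =
  [set X | exists2 m, m \in [seq m <- zeros_in r a | entry b m == 0%N] & X = D m].
Proof.
move=> a150 b150; rewrite !gmapE //; apply/seteqP; split=> X.
  move=> [[m hm ->] [m' hm' /(D_inj (zeros_in_lt hm) (zeros_in_lt hm')) e]].
  by exists m; rewrite // mem_filter hm andbT; move: hm'; rewrite e mem_zeros_in => /and3P [].
move=> [m]; rewrite mem_filter => /andP [hb hm] ->; split; exists m; [exact: hm|by []| |by []].
have : [&& m < 150, entry a m == 0 & same r m]%N by rewrite -mem_zeros_in.
by move=> /and3P [m150 _ h]; rewrite mem_zeros_in m150 hb h.
Qed.

Lemma card_D (S : seq nat) n : uniq S -> (forall m, m \in S -> (m < 150)%N) ->
  [set X | exists2 m, m \in S & X = D m] #= `I_n <-> (size S == n).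
Proof.
by move=> uS hS; apply: (card_seqP (g := D)) => // i j /hS i150 /hS j150; exact: D_inj.
Qed.

Lemma gmap_coclique r a : (r < 150)%N -> (a < 150)%N -> ~~ same r a ->
  cocliques 15 (block r) (adjH F) (gmap F (block r) (D a)).
Proof.
move=> r150 a150 h; have h' : ~~ same a r by rewrite (same_sym esig a150 r150).
have [sz cz _] := zeros_inP esig r150 a150 h'.
have uz : uniq (zeros_in r a) by rewrite filter_uniq ?iota_uniq.
split; first by move=> X [].
  by rewrite gmapE //; apply/card_D; rewrite ?sz // => m /zeros_in_lt.
rewrite gmapE // => X Y [m hm ->] [m' hm' ->] _ /D_adj.
by move=> /(_ (zeros_in_lt hm) (zeros_in_lt hm')); apply/negP; exact: cz.
Qed.

Lemma gmap_inter r a b T : (r < 150)%N -> (a < 150)%N -> (b < 150)%N ->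
  ~~ same r a -> ~~ same r b -> a <> b -> entry a b = Tindex T ->
  gmap F (block r) (D a) `&` gmap F (block r) (D b) #= `I_(common_size T).
Proof.
move=> r150 a150 b150 h hb ne e; have h' : ~~ same a r by rewrite (same_sym esig a150 r150).
have [_ _ hz] := zeros_inP esig r150 a150 h'.
have uz : uniq (zeros_in r a) by rewrite filter_uniq ?iota_uniq.
rewrite gmap_cap //; apply/card_D; first by rewrite filter_uniq.
  by move=> m; rewrite mem_filter => /andP [_ /zeros_in_lt].
rewrite hz // ?e; last by apply/eqP => e'; apply: ne.
by case: (T).
Qed.

(** For distinct blocks the intersection has 0, 3, 5 or 8 elements, never the 15 of each image. *)
Lemma gmap_inj r a b : (r < 150)%N -> (a < 150)%N -> (b < 150)%N ->
  ~~ same r a -> ~~ same r b -> gmap F (block r) (D a) = gmap F (block r) (D b) -> a = b.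
Proof.
move=> r150 a150 b150 ha hb e; apply/eqP/contraT => ne.
have [T hT] : exists T, entry a b = Tindex T by apply: entry_Tindex; rewrite // eq_sym.
have := gmap_inter r150 a150 b150 ha hb (elimN eqP ne) hT; rewrite -e setIid.
have [_ h _] := gmap_coclique r150 a150 ha; rewrite (card_eql h) => /card_eq_II/eqP.
by case: (T).
Qed.

Lemma gmap_surj r X : (r < 150)%N -> cocliques 15 (block r) (adjH F) X ->
  exists a, [/\ (a < 150)%N, ~~ same r a & gmap F (block r) (D a) = X].
Proof.
move=> r150 [Xr X15 cX].
pose S := [seq m <- iota 0 150 | `[< X (D m) >]].
have uS : uniq S by rewrite filter_uniq ?iota_uniq.
have memS m : m \in S <-> (m < 150)%N /\ X (D m).
  rewrite mem_filter mem_iota0; split=> [/andP [/asboolP]|[-> /asboolP ->]] //.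
have EX : X = [set Y | exists2 m, m \in S & Y = D m].
  apply/seteqP; split=> Y; last by move=> [m /memS [_ ?] ->].
  move=> XY; have [m [m150 _ e]] := Xr Y XY; exists m; rewrite // -?e.
  by apply/memS; rewrite -e.
have S15 : size S = 15%N.
  apply/eqP/(card_D _ uS); last by rewrite -EX.
  by move=> m /memS [].
have [|u v /memS [u150 Xu] /memS [v150 Xv]|a [a150 na e]] := coclique_zeros esig r150 uS S15.
- by move=> m /memS [m150 /Xr /block_D ->]; rewrite ?m150.
- apply/negP => h; apply: (cX _ _ Xu Xv); last exact/D_adj.
  move/(D_inj u150 v150) => uv; have := entry_lt u150 u150.
  by move: h; rewrite -uv /adjacent => /eqP ->; rewrite eqxx.
exists a; split=> //; rewrite gmapE // EX; apply/seteqP.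
by split=> Y [m hm ->]; exists m; rewrite // ?e // -e.
Qed.

Lemma main (C : 'I_3 -> set (set (conic k))) (i j l : 'I_3) : injective C ->
  range C = comps_H F -> ([set i; j; l] = [set: 'I_3])%SET ->
  set_bij (C i `|` C j) (cocliques 15 (C l) (adjH F)) (gmap F (C l)) /\
  (forall X Y, (C i `|` C j) X -> (C i `|` C j) Y -> X <> Y ->
     forall T, has_T F X Y T -> gmap F (C l) X `&` gmap F (C l) Y #= `I_(common_size T)).
Proof.
move=> C_inj C_comps ijl.
have hC m : exists2 r, (r < 150)%N & C m = block r.
  have : comps_H F (C m) by rewrite -C_comps; exists m.
  by rewrite comps_HP.
have [r r150 Er] := hC l.
(* Three names that cover a set of three indices are distinct. *)
have card2 (a b d : 'I_3) : ([set a; b; d] = [set: 'I_3])%SET -> a <> d /\ b <> d.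
  move=> e; have c3 : #|[set a; b; d]%SET| = 3%N by rewrite e cardsT card_ord.
  split=> z; move: c3; rewrite z.
    have -> : [set d; b; d]%SET = [set d; b]%SET by apply/setP => x; rewrite !inE orbAC orbb.
    by rewrite cards2; case: (_ != _).
  have -> : [set a; d; d]%SET = [set a; d]%SET by apply/setP => x; rewrite !inE -orbA orbb.
  by rewrite cards2; case: (_ != _).
have [il jl] := card2 _ _ _ ijl.
(* The union of the two components consists of the blocks outside the class of [r]: each block lies
   in some component, and distinct indices give distinct classes. *)
have hU X : (C i `|` C j) X <-> exists a, [/\ (a < 150)%N, ~~ same r a & X = D a].
  have out m : m <> l -> C m X -> exists a, [/\ (a < 150)%N, ~~ same r a & X = D a].
    move=> ml; have [r' r'150 Er'] := hC m; rewrite Er' => -[a [a150 h ->]]; exists a; split=> //.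
    apply/negP => ha; apply: ml; apply: C_inj; rewrite Er Er'; apply: block_eq => //.
    by apply: (same_trans esig r'150 a150 r150 h); rewrite (same_sym esig a150 r150).
  split=> [[]|[a [a150 h ->]]]; try exact: out.
  have : comps_H F (block a) by rewrite comps_HP; exists a.
  rewrite -C_comps => -[m _ Em].
  have aa : C m (D a) by rewrite Em; apply/block_D => //; exact: same_refl.
  have : m \in [set i; j; l]%SET by rewrite ijl inE.
  rewrite !inE => /orP [/orP [/eqP e|/eqP e]|/eqP e].
  - by left; rewrite -e.
  - by right; rewrite -e.
  by move: aa h; rewrite e Er => /(block_D _ a150) ->.
rewrite Er; split; last first.
  move=> X Y /hU [a [a150 ha ->]] /hU [b [b150 hb ->]] ne T /(D_has_T _ a150 b150) e.
  by apply: gmap_inter => // ab; apply: ne; rewrite ab.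
split.
- by move=> X /hU [a [a150 ha ->]]; exact: gmap_coclique.
- move=> X Y /set_mem /hU [a [a150 ha ->]] /set_mem /hU [b [b150 hb ->]].
  by move=> /(gmap_inj r150 a150 b150 ha hb) ->.
- move=> X /(gmap_surj r150) [a [a150 ha <-]]; exists (D a) => //.
  by apply/hU; exists a.
Qed.

End Main.

(** Algebraic closedness enters as the existence of radicals: a square root of 2, the constants of
    [hermitian_frame] and the scalings in [tangent_classify]. *)
Lemma closed_field_root (k : closedFieldType) n (c : k) : (0 < n)%N -> exists x : k, x ^+ n = c.
Proof.
move=> n0; have [x hx] := solve_monicpoly (fun i => if i == 0%N then c else 0) n0.
exists x; rewrite hx; case: n n0 {hx} => // n _.
rewrite big_ord_recl /= expr0 mulr1 big1 ?addr0 // => i _; exact: mul0r.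
Qed.

Theorem proposition1p11 (k : closedFieldType) (char5 : 5%N \in [pchar k]%R)
  (F : {mpoly k[3]}) (hermF : hermitian_curve F)
  (C : 'I_3 -> set (set (conic k)))
  (C_inj : injective C) (C_comps : range C = comps_H F)
  (i j l : 'I_3) (ijl : [set i; j; l]%SET = [set: 'I_3]%SET) :
  set_bij (C i `|` C j)%classic (cocliques 15 (C l) (adjH F)) (gmap F (C l)) /\
  (forall D D' : set (conic k), (C i `|` C j)%classic D ->
     (C i `|` C j)%classic D' -> D <> D' ->
     forall T : Ttype, has_T F D D' T ->
     (gmap F (C l) D `&` gmap F (C l) D' #= `I_(common_size T))%classic%card).
Proof.
have root := @closed_field_root k; have [s s2] := root 2%N 2%:R isT.
have [E [c fr]] := hermitian_frame char5 root hermF.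
exact: (main char5 s2 root fr C_inj C_comps ijl).
Qed.
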